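(* Let $\mathcal{M}$ be an admissible simple $\mathscr{C}$-module category which has the same graph and the same dual graph (up to isomorphism of graphs) as the left regular $\mathscr{C}$-module category ${}_{\mathscr{C}}\mathscr{C}$. Then $\mathcal{M}$ is equivalent to ${}_{\mathscr{C}}\mathscr{C}$ as a $\mathscr{C}$-module category.
   Context: $\mathscr{C}$ is the semi-simple rigid symmetric monoidal category of all finite dimensional modules over $\mathfrak{sl}_3=\mathfrak{sl}_3(\mathbb{C})$, with tensor product over $\mathbb{C}$. Its simple objects are $L((i,j))$, $i,j\in\mathbb{Z}_{\geq 0}$, where $L((i,j))$ is the simple module of highest weight $\lambda$ with $\lambda(h_1)=i$, $\lambda(h_2)=j$, for $h_1=e_{1,1}-e_{2,2}$, $h_2=e_{2,2}-e_{3,3}$. Put $\mathrm{F}=L((1,0))$ (the natural $3$-dimensional module) and $\mathrm{F}^*\cong L((0,1))$ (its dual). ${}_{\mathscr{C}}\mathscr{C}$ denotes $\mathscr{C}$ considered as a $\mathscr{C}$-module category via the left regular action. A $\mathscr{C}$-module category $\mathcal{M}$ is locally finitary if it is $\mathbb{C}$-linear, additive, idempotent split, Krull-Schmidt, has at most countably many isomorphism classes of indecomposable objects, and has finite dimensional morphism spaces. It is admissible if it is locally finitary and has weak kernels. It is simple if it is non-zero and has no $\mathscr{C}$-stable ideals except for $0$ and $\mathcal{M}$ itself. For a locally finitary $\mathcal{M}$ and $\theta\in\mathscr{C}$, the graph $\Gamma_\theta$ is the oriented graph whose vertices are the isomorphism classes of indecomposable objects of $\mathcal{M}$ and in which the number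 of arrows from $X$ to $Y$ is the multiplicity of $Y$ as a direct summand of $\theta(X)$. The graph of $\mathcal{M}$ is $\Gamma_{\mathrm{F}}$ and the dual graph of $\mathcal{M}$ is $\Gamma_{\mathrm{F}^*}$. Explicitly, the graph of ${}_{\mathscr{C}}\mathscr{C}$ has vertex set $\mathbb{Z}_{\geq 0}^2$ (with $(i,j)$ corresponding to $L((i,j))$) and exactly one arrow from $(i,j)$ to each of $(i+1,j)$, $(i-1,j+1)$, $(i,j-1)$ which belongs to $\mathbb{Z}_{\geq 0}^2$; the dual graph of ${}_{\mathscr{C}}\mathscr{C}$ is obtained by reversing all arrows. *)

(* Defs.v *)
From HB Require Import structures.
From mathcomp Require Import all_boot all_order all_algebra.
From mathcomp Require Import boolp classical_sets reals.
From mathcomp Require Import complex.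
Set Implicit Arguments.
Unset Strict Implicit.
Unset Printing Implicit Defensive.
Import GRing.Theory.
Local Open Scope ring_scope.
Local Open Scope classical_set_scope.

Record lin_cat (k : fieldType) := LinCat {
  ob :> Type;
  hom : ob -> ob -> lmodType k;
  idm : forall X : ob, hom X X;
  comp : forall X Y Z : ob, hom Y Z -> hom X Y -> hom X Z;
  compA : forall (X Y Z T : ob) (h : hom Z T) (g : hom Y Z) (f : hom X Y),
    comp h (comp g f) = comp (comp h g) f;
  comp1m : forall (X Y : ob) (f : hom X Y), comp (idm Y) f = f;
  compm1 : forall (X Y : ob) (f : hom X Y), comp f (idm X) = f;
  comp_linearl : forall (X Y Z : ob) (a : k) (g g' : hom Y Z) (f : hom X Y),
    comp (a *: g + g') f = a *: comp g f + comp g' f;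
  comp_linearr : forall (X Y Z : ob) (a : k) (g : hom Y Z) (f f' : hom X Y),
    comp g (a *: f + f') = a *: comp g f + comp g f' }.

Arguments hom {k l} X Y : rename.
Arguments idm {k l} X : rename.
Arguments comp {k l X Y Z} g f : rename.

Declare Scope cat_scope.
Delimit Scope cat_scope with cat.
Local Open Scope cat_scope.
Notation "g ∘ f" := (comp g f) (at level 40, left associativity) : cat_scope.

Section CategoryNotions.
Variables (k : fieldType) (M : lin_cat k).
Implicit Types X Y Z : M.

Definition is_iso X Y (f : hom X Y) : Prop :=
  exists g : hom Y X, g ∘ f = idm X /\ f ∘ g = idm Y.

Definition isomorphic X Y : Prop := exists f : hom X Y, is_iso f.

Definition is_zero X : Prop := idm X = 0.

(* S is a biproduct of the finite family X; a zero object when I is empty. *)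
Definition direct_sum (I : finType) (X : I -> M) (S : M) : Prop :=
  exists (inj : forall i, hom (X i) S) (proj : forall i, hom S (X i)),
    [/\ forall i, proj i ∘ inj i = idm (X i),
        forall i j, i != j -> proj j ∘ inj i = 0
      & \sum_i inj i ∘ proj i = idm S].

Definition additive : Prop :=
  forall (I : finType) (X : I -> M), exists S, direct_sum X S.

Definition idempotent_split : Prop :=
  forall X (e : hom X X), e ∘ e = e ->
  exists (Y : M) (p : hom X Y) (i : hom Y X), i ∘ p = e /\ p ∘ i = idm Y.

Definition indecomposable X : Prop :=
  ~ is_zero X /\
  forall Y : bool -> M, direct_sum Y X -> exists b, is_zero (Y b).

(* The ring of endomorphisms of X is local. *)
Definition local_end X : Prop :=
  ~ is_zero X /\ forall f : hom X X, is_iso f \/ is_iso (idm X - f).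

Definition krull_schmidt : Prop :=
  forall X, exists (n : nat) (Y : 'I_n -> M),
    (forall i, local_end (Y i)) /\ direct_sum Y X.

Definition countably_many_indecomposables : Prop :=
  exists e : nat -> M,
    forall X, indecomposable X -> exists n, isomorphic X (e n).

Definition finite_dimensional (V : lmodType k) : Prop :=
  exists (n : nat) (e : 'I_n -> V),
    forall v, exists c : 'I_n -> k, v = \sum_i c i *: e i.

Definition locally_finitary : Prop :=
  [/\ additive, idempotent_split, krull_schmidt,
      countably_many_indecomposables
    & forall X Y, finite_dimensional (hom X Y)].

Definition weak_kernels : Prop :=
  forall X Y (f : hom X Y), exists (K : M) (i : hom K X),
    f ∘ i = 0 /\
    forall Z (g : hom Z X), f ∘ g = 0 -> exists h : hom Z K, g = i ∘ h.

Definition admissible : Prop := locally_finitary /\ weak_kernels.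

(* n is the number of summands isomorphic to Y in some decomposition of Z into
   indecomposables; by Krull-Schmidt it does not depend on the decomposition. *)
Definition has_multiplicity Y Z (n : nat) : Prop :=
  exists (m : nat) (W : 'I_m -> M),
    [/\ forall i, indecomposable (W i), direct_sum W Z
      & #|[set i | `[< isomorphic (W i) Y >]]%SET| = n].

(* A plain predicate: [set M] would force M into the universe of choice types,
   too small for categories of vector spaces. *)
Definition iso_class X : M -> Prop := isomorphic X.

End CategoryNotions.

Record monoidal_cat (k : fieldType) := MonoidalCat {
  mon_cat :> lin_cat k;
  tob : mon_cat -> mon_cat -> mon_cat;
  thom : forall A A' B B' : mon_cat,
    hom A A' -> hom B B' -> hom (tob A B) (tob A' B');
  tunit : mon_cat;
  alpha : forall A B C : mon_cat, hom (tob (tob A B) C) (tob A (tob B C));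
  lambda : forall A : mon_cat, hom (tob tunit A) A;
  rho : forall A : mon_cat, hom (tob A tunit) A;
  thom_id : forall A B : mon_cat, thom (idm A) (idm B) = idm (tob A B);
  thom_comp : forall (A A' A'' B B' B'' : mon_cat)
      (f' : hom A' A'') (f : hom A A') (g' : hom B' B'') (g : hom B B'),
    thom (f' ∘ f) (g' ∘ g) = thom f' g' ∘ thom f g;
  thom_linearl : forall (A A' B B' : mon_cat) (a : k) (f f' : hom A A')
      (g : hom B B'), thom (a *: f + f') g = a *: thom f g + thom f' g;
  thom_linearr : forall (A A' B B' : mon_cat) (a : k) (f : hom A A')
      (g g' : hom B B'), thom f (a *: g + g') = a *: thom f g + thom f g';
  alpha_iso : forall A B C : mon_cat, is_iso (alpha A B C);
  lambda_iso : forall A : mon_cat, is_iso (lambda A);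
  rho_iso : forall A : mon_cat, is_iso (rho A);
  alpha_nat : forall (A A' B B' C C' : mon_cat)
      (f : hom A A') (g : hom B B') (h : hom C C'),
    alpha A' B' C' ∘ thom (thom f g) h = thom f (thom g h) ∘ alpha A B C;
  lambda_nat : forall (A A' : mon_cat) (f : hom A A'),
    lambda A' ∘ thom (idm tunit) f = f ∘ lambda A;
  rho_nat : forall (A A' : mon_cat) (f : hom A A'),
    rho A' ∘ thom f (idm tunit) = f ∘ rho A;
  pentagon : forall A B C D : mon_cat,
    alpha A B (tob C D) ∘ alpha (tob A B) C D =
    thom (idm A) (alpha B C D) ∘ alpha A (tob B C) D
      ∘ thom (alpha A B C) (idm D);
  triangle : forall A B : mon_cat,
    thom (idm A) (lambda B) ∘ alpha A tunit B = thom (rho A) (idm B) }.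

Arguments tob {k m} A B : rename.
Arguments thom {k m A A' B B'} f g : rename.
Arguments tunit {k m} : rename.
Arguments alpha {k m} A B C : rename.
Arguments lambda {k m} A : rename.
Arguments rho {k m} A : rename.

Record module_cat (k : fieldType) (C : monoidal_cat k) := ModuleCat {
  mod_cat :> lin_cat k;
  aob : C -> mod_cat -> mod_cat;
  ahom : forall (A A' : C) (X X' : mod_cat),
    hom A A' -> hom X X' -> hom (aob A X) (aob A' X');
  aalpha : forall (A B : C) (X : mod_cat),
    hom (aob (tob A B) X) (aob A (aob B X));
  alambda : forall X : mod_cat, hom (aob tunit X) X;
  ahom_id : forall (A : C) (X : mod_cat), ahom (idm A) (idm X) = idm (aob A X);
  ahom_comp : forall (A A' A'' : C) (X X' X'' : mod_cat)
      (f' : hom A' A'') (f : hom A A') (g' : hom X' X'') (g : hom X X'),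
    ahom (f' ∘ f) (g' ∘ g) = ahom f' g' ∘ ahom f g;
  ahom_linearl : forall (A A' : C) (X X' : mod_cat) (a : k) (f f' : hom A A')
      (g : hom X X'), ahom (a *: f + f') g = a *: ahom f g + ahom f' g;
  ahom_linearr : forall (A A' : C) (X X' : mod_cat) (a : k) (f : hom A A')
      (g g' : hom X X'), ahom f (a *: g + g') = a *: ahom f g + ahom f g';
  aalpha_iso : forall (A B : C) (X : mod_cat), is_iso (aalpha A B X);
  alambda_iso : forall X : mod_cat, is_iso (alambda X);
  aalpha_nat : forall (A A' B B' : C) (X X' : mod_cat)
      (f : hom A A') (g : hom B B') (h : hom X X'),
    aalpha A' B' X' ∘ ahom (thom f g) h = ahom f (ahom g h) ∘ aalpha A B X;
  alambda_nat : forall (X X' : mod_cat) (f : hom X X'),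
    alambda X' ∘ ahom (idm tunit) f = f ∘ alambda X;
  apentagon : forall (A B D : C) (X : mod_cat),
    aalpha A B (aob D X) ∘ aalpha (tob A B) D X =
    ahom (idm A) (aalpha B D X) ∘ aalpha A (tob B D) X
      ∘ ahom (alpha A B D) (idm X);
  atriangle : forall (A : C) (X : mod_cat),
    ahom (idm A) (alambda X) ∘ aalpha A tunit X = ahom (rho A) (idm X) }.

Arguments aob {k C m} A X : rename.
Arguments ahom {k C m A A' X X'} f g : rename.
Arguments aalpha {k C m} A B X : rename.
Arguments alambda {k C m} X : rename.

Definition regular (k : fieldType) (C : monoidal_cat k) : module_cat C :=
  @ModuleCat k C (mon_cat C) (@tob k C) (@thom k C) (@alpha k C) (@lambda k C)
    (@thom_id k C) (@thom_comp k C) (@thom_linearl k C) (@thom_linearr k C)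
    (@alpha_iso k C) (@lambda_iso k C) (@alpha_nat k C) (@lambda_nat k C)
    (@pentagon k C) (@triangle k C).

Definition stable_ideal (k : fieldType) (C : monoidal_cat k)
    (M : module_cat C) (I : forall X Y : M, set (hom X Y)) : Prop :=
  [/\ forall X Y : M, I X Y 0,
      forall (X Y : M) (a : k) (f g : hom X Y),
        I X Y f -> I X Y g -> I X Y (a *: f + g),
      forall (X Y Z : M) (g : hom Y Z) (f : hom X Y),
        I X Y f -> I X Z (g ∘ f),
      forall (X Y Z : M) (g : hom Y Z) (f : hom X Y),
        I Y Z g -> I X Z (g ∘ f)
    & forall (A : C) (X Y : M) (f : hom X Y),
        I X Y f -> I (aob A X) (aob A Y) (ahom (idm A) f)].

Definition simple_module_cat (k : fieldType) (C : monoidal_cat k)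
    (M : module_cat C) : Prop :=
  (exists X : M, ~ is_zero X) /\
  forall I : (forall X Y : M, set (hom X Y)), stable_ideal I ->
    (forall (X Y : M) (f : hom X Y), I X Y f -> f = 0) \/
    (forall (X Y : M) (f : hom X Y), I X Y f).

Record lin_functor (k : fieldType) (M N : lin_cat k) := LinFunctor {
  fob :> M -> N;
  fhom : forall X Y : M, hom X Y -> hom (fob X) (fob Y);
  fhom_id : forall X : M, fhom (idm X) = idm (fob X);
  fhom_comp : forall (X Y Z : M) (g : hom Y Z) (f : hom X Y),
    fhom (g ∘ f) = fhom g ∘ fhom f;
  fhom_linear : forall (X Y : M) (a : k) (f g : hom X Y),
    fhom (a *: f + g) = a *: fhom f + fhom g }.

Arguments fhom {k M N} l {X Y} f : rename.

Definition is_equivalence (k : fieldType) (M N : lin_cat k)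
    (F : lin_functor M N) : Prop :=
  exists (G : lin_functor N M)
    (eta : forall X : M, hom (G (F X)) X) (eps : forall Y : N, hom (F (G Y)) Y),
    [/\ forall X, is_iso (eta X), forall Y, is_iso (eps Y),
        forall (X X' : M) (f : hom X X'),
          eta X' ∘ fhom G (fhom F f) = f ∘ eta X
      & forall (Y Y' : N) (g : hom Y Y'),
          eps Y' ∘ fhom F (fhom G g) = g ∘ eps Y].

Record module_functor (k : fieldType) (C : monoidal_cat k)
    (M N : module_cat C) := ModuleFunctor {
  mfun :> lin_functor M N;
  mstr : forall (A : C) (X : M), hom (mfun (aob A X)) (aob A (mfun X));
  mstr_iso : forall (A : C) (X : M), is_iso (mstr A X);
  mstr_nat : forall (A A' : C) (X X' : M) (f : hom A A') (g : hom X X'),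
    mstr A' X' ∘ fhom mfun (ahom f g) = ahom f (fhom mfun g) ∘ mstr A X;
  mstr_assoc : forall (A B : C) (X : M),
    aalpha A B (mfun X) ∘ mstr (tob A B) X =
    ahom (idm A) (mstr B X) ∘ mstr A (aob B X) ∘ fhom mfun (aalpha A B X);
  mstr_unit : forall X : M,
    alambda (mfun X) ∘ mstr tunit X = fhom mfun (alambda X) }.

Definition module_equivalent (k : fieldType) (C : monoidal_cat k)
    (M N : module_cat C) : Prop :=
  exists F : module_functor M N, is_equivalence F.

(* An oriented graph, with [arrows x y] the number of arrows from x to y *)
Record graph := Graph {
  vertex : Type;
  arrows : vertex -> vertex -> nat }.

Definition graph_isomorphic (G H : graph) : Prop :=
  exists phi : vertex G -> vertex H, bijective phi /\
    forall x y, arrows (phi x) (phi y) = arrows x y.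

Record indec_class (k : fieldType) (M : lin_cat k) := IndecClass {
  cls :> M -> Prop;
  clsP : exists2 X : M, indecomposable X & cls = iso_class X }.

(* The number of arrows is read off representatives; the default value 0 is
   never used when M is locally finitary. *)
Definition Gamma (k : fieldType) (C : monoidal_cat k) (M : module_cat C)
    (theta : C) : graph :=
  @Graph (indec_class M) (fun c d =>
    xget 0%N [set n | exists X Y : M,
      [/\ cls c X, cls d Y & has_multiplicity Y (aob theta X) n]]).

Section Tensor.
Variable k : fieldType.
Implicit Types V W U X : vectType k.

(* The coordinates of a tensor are taken on the library's bases of V and W;
   [pure] is the universal bilinear map, by [tlift_pure] and [tens_ext]. *)
Definition tens V W : vectType k := 'M[k]_(\dim {:V}, \dim {:W}).

Definition pure V W (v : V) (w : W) : tens V W :=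
  \matrix_(i, j) (coord (vbasis {:V}) i v * coord (vbasis {:W}) j w).

Definition bas V (i : 'I_(\dim {:V})) : V := (vbasis {:V})`_i.

Definition tlift V W U (f : V -> W -> U) (t : tens V W) : U :=
  \sum_i \sum_j (t : 'M_(_, _)) i j *: f (bas i) (bas j).

Definition bilin V W U (f : V -> W -> U) : Prop :=
  (forall (a : k) v v' w, f (a *: v + v') w = a *: f v w + f v' w) /\
  (forall (a : k) v w w', f v (a *: w + w') = a *: f v w + f v w').

Lemma bas_sum V (v : V) : v = \sum_i coord (vbasis {:V}) i v *: bas i.
Proof. exact: coord_vbasis (memvf v). Qed.

Lemma pure_bilin V W : bilin (@pure V W).
Proof.
split=> [a v v' w|a v w w']; apply/matrixP => i j; rewrite !mxE linearP /=.
  by rewrite mulrDl mulrA.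
by rewrite mulrDr mulrCA.
Qed.

Lemma bilin_suml V W U (f : V -> W -> U) (fP : bilin f) (I : finType)
    (c : I -> k) (v : I -> V) w :
  f (\sum_i c i *: v i) w = \sum_i c i *: f (v i) w.
Proof.
have f0 : f 0 w = 0.
  have := fP.1 1 0 0 w.
  by rewrite !scale1r addr0 => /eqP; rewrite addrC -subr_eq subrr => /eqP.
elim/big_rec2: _ => [|i x y _ <-]; first by [].
by rewrite fP.1.
Qed.

Lemma bilin_sumr V W U (f : V -> W -> U) (fP : bilin f) (I : finType)
    (c : I -> k) v (w : I -> W) :
  f v (\sum_i c i *: w i) = \sum_i c i *: f v (w i).
Proof.
by apply: (@bilin_suml W V U (fun w v => f v w)); split=> *;
  [rewrite fP.2|rewrite fP.1].
Qed.

Lemma tlift_linear V W U (f : V -> W -> U) : linear (tlift f).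
Proof.
move=> a s t; rewrite /tlift scaler_sumr -big_split; apply: eq_bigr => i _ /=.
rewrite scaler_sumr -big_split; apply: eq_bigr => j _ /=.
by rewrite !mxE scalerDl scalerA.
Qed.

HB.instance Definition _ V W U (f : V -> W -> U) :=
  GRing.isLinear.Build k (tens V W) U *:%R (tlift f) (tlift_linear f).

Lemma tlift_pure V W U (f : V -> W -> U) v w :
  bilin f -> tlift f (pure v w) = f v w.
Proof.
move=> fP; rewrite [in RHS](bas_sum v) (bilin_suml fP).
apply: eq_bigr => i _; rewrite [in RHS](bas_sum w) (bilin_sumr fP) scaler_sumr.
apply: eq_bigr => j _; rewrite scalerA; congr (_ *: _).
by rewrite /pure mxE.
Qed.

Lemma pure_bas V W (i : 'I_(\dim {:V})) (j : 'I_(\dim {:W})) :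
  pure (bas i) (bas j) = delta_mx i j.
Proof.
apply/matrixP => i' j'; rewrite !mxE.
rewrite !(coord_free, basis_free (vbasisP _)) //.
by rewrite -natrM mulnb ![_ == i']eq_sym ![_ == j']eq_sym.
Qed.

Lemma tens_ext V W U (f g : tens V W -> U) : linear f -> linear g ->
  (forall v w, f (pure v w) = g (pure v w)) -> f =1 g.
Proof.
move=> fL gL fg t.
pose f' : {linear tens V W -> U} :=
  HB.pack f (GRing.isLinear.Build _ _ _ _ f fL).
pose g' : {linear tens V W -> U} :=
  HB.pack g (GRing.isLinear.Build _ _ _ _ g gL).
rewrite -[f]/(f' : _ -> _) -[g]/(g' : _ -> _).
rewrite (matrix_sum_delta (t : 'M_(_, _))) !linear_sum; apply: eq_bigr => i _.
rewrite !linear_sum; apply: eq_bigr => j _; rewrite !linearZ /=.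
by congr (_ *: _); rewrite -pure_bas; apply: fg.
Qed.

Definition tmap V V' W W' (f : V -> V') (g : W -> W') : tens V W -> tens V' W' :=
  tlift (fun v w => pure (f v) (g w)).

Definition tassoc V W U : tens (tens V W) U -> tens V (tens W U) :=
  tlift (fun t u => tlift (fun v w => pure v (pure w u)) t).

Definition tassoc_inv V W U : tens V (tens W U) -> tens (tens V W) U :=
  tlift (fun v t => tlift (fun w u => pure (pure v w) u) t).

Definition tlunit V : tens k^o V -> V := tlift (fun (a : k^o) v => a *: v).

Definition trunit V : tens V k^o -> V := tlift (fun v (a : k^o) => a *: v).

HB.instance Definition _ V V' W W' (f : V -> V') (g : W -> W') :=
  GRing.Linear.copy (tmap f g) (tlift (fun v w => pure (f v) (g w))).
HB.instance Definition _ V W U := GRing.Linear.copy (@tassoc V W U)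
  (tlift (fun t u => tlift (fun v w => pure v (pure w u)) t)).
HB.instance Definition _ V W U := GRing.Linear.copy (@tassoc_inv V W U)
  (tlift (fun v t => tlift (fun w u => pure (pure v w) u) t)).
HB.instance Definition _ V :=
  GRing.Linear.copy (@tlunit V) (tlift (fun (a : k^o) (v : V) => a *: v)).
HB.instance Definition _ V :=
  GRing.Linear.copy (@trunit V) (tlift (fun (v : V) (a : k^o) => a *: v)).

Lemma pureDl V W (v v' : V) (w : W) : pure (v + v') w = pure v w + pure v' w.
Proof. by have := (pure_bilin V W).1 1 v v' w; rewrite !scale1r. Qed.

Lemma pureDr V W (v : V) (w w' : W) : pure v (w + w') = pure v w + pure v w'.
Proof. by have := (pure_bilin V W).2 1 v w w'; rewrite !scale1r. Qed.

Lemma pure0l V W (w : W) : pure (0 : V) w = 0.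
Proof. by apply: (addrI (pure 0 w)); rewrite -pureDl !addr0. Qed.

Lemma pure0r V W (v : V) : pure v (0 : W) = 0.
Proof. by apply: (addrI (pure v 0)); rewrite -pureDr !addr0. Qed.

Lemma pureZl V W a (v : V) (w : W) : pure (a *: v) w = a *: pure v w.
Proof. by have := (pure_bilin V W).1 a v 0 w; rewrite pure0l !addr0. Qed.

Lemma pureZr V W a (v : V) (w : W) : pure v (a *: w) = a *: pure v w.
Proof. by have := (pure_bilin V W).2 a v w 0; rewrite pure0r !addr0. Qed.

Lemma pureBl V W (v v' : V) (w : W) : pure (v - v') w = pure v w - pure v' w.
Proof. by rewrite pureDl -scaleN1r pureZl scaleN1r. Qed.

Lemma pureBr V W (v : V) (w w' : W) : pure v (w - w') = pure v w - pure v w'.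
Proof. by rewrite pureDr -scaleN1r pureZr scaleN1r. Qed.

Definition pureE := (pureDl, pureDr, pureZl, pureZr).

Lemma tlift_fun V W U (f g : V -> W -> U) a t :
  tlift (fun v w => a *: f v w + g v w) t = a *: tlift f t + tlift g t.
Proof.
rewrite /tlift scaler_sumr -big_split; apply: eq_bigr => i _ /=.
rewrite scaler_sumr -big_split; apply: eq_bigr => j _ /=.
by rewrite scalerDr !scalerA mulrC.
Qed.

Lemma eq_tlift V W U (f g : V -> W -> U) t :
  (forall v w, f v w = g v w) -> tlift f t = tlift g t.
Proof. by move=> fg; do 2!apply: eq_bigr => ? _; rewrite fg. Qed.

Lemma tmap_pure V V' W W' (f : V -> V') (g : W -> W') v w :
  linear f -> linear g -> tmap f g (pure v w) = pure (f v) (g w).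
Proof.
move=> fL gL; rewrite /tmap tlift_pure//.
by split=> *; rewrite ?fL ?gL !pureE.
Qed.

Lemma tassoc_pure V W U (v : V) (w : W) (u : U) :
  tassoc (pure (pure v w) u) = pure v (pure w u).
Proof.
rewrite /tassoc tlift_pure; last first.
  split=> [a t t' u'|a t u' u'']; first by rewrite linearP.
  by rewrite -tlift_fun; apply: eq_tlift => *; rewrite !pureE.
by rewrite tlift_pure//; split=> *; rewrite !pureE.
Qed.

Lemma tassoc_inv_pure V W U (v : V) (w : W) (u : U) :
  tassoc_inv (pure v (pure w u)) = pure (pure v w) u.
Proof.
rewrite /tassoc_inv tlift_pure; last first.
  split=> [a v' v'' t|a v' t t']; last by rewrite linearP.
  by rewrite -tlift_fun; apply: eq_tlift => *; rewrite !pureE.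
by rewrite tlift_pure//; split=> *; rewrite !pureE.
Qed.

Lemma tlunit_pure V (a : k^o) (v : V) : tlunit (pure a v) = a *: v.
Proof.
rewrite /tlunit tlift_pure//.
by split=> *; rewrite ?scalerDl ?scalerDr !scalerA // mulrC.
Qed.

Lemma trunit_pure V (a : k^o) (v : V) : trunit (pure v a) = a *: v.
Proof.
rewrite /trunit tlift_pure//.
by split=> *; rewrite ?scalerDl ?scalerDr !scalerA // mulrC.
Qed.

Lemma compP V W U (f : W -> U) (g : V -> W) :
  linear f -> linear g -> linear (fun x => f (g x)).
Proof. by move=> fL gL a x y; rewrite gL fL. Qed.

Lemma pure_linearl V W (w : W) : linear (fun v : V => pure v w).
Proof. by move=> a v v'; rewrite !pureE. Qed.

Lemma pure_linearr V W (v : V) : linear (pure v : W -> _).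
Proof. by move=> a w w'; rewrite !pureE. Qed.

Lemma tens_ext3l V W U X (f g : tens (tens V W) U -> X) :
  linear f -> linear g ->
  (forall v w u, f (pure (pure v w) u) = g (pure (pure v w) u)) -> f =1 g.
Proof.
move=> fL gL fg; apply: tens_ext => // t u.
apply: (tens_ext (f := fun t => f (pure t u)) (g := fun t => g (pure t u)))
  => [||v w]; last exact: fg.
  exact/compP/pure_linearl.
exact/compP/pure_linearl.
Qed.

Lemma tens_ext3r V W U X (f g : tens V (tens W U) -> X) :
  linear f -> linear g ->
  (forall v w u, f (pure v (pure w u)) = g (pure v (pure w u))) -> f =1 g.
Proof.
move=> fL gL fg; apply: tens_ext => // v t.
apply: (tens_ext (f := fun t => f (pure v t)) (g := fun t => g (pure v t)))
  => [||w u]; last exact: fg.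
  exact/compP/pure_linearr.
exact/compP/pure_linearr.
Qed.

Lemma tens_ext4 V W U (Z : vectType k) X (f g : tens (tens (tens V W) U) Z -> X) :
  linear f -> linear g ->
  (forall v w u z, f (pure (pure (pure v w) u) z) =
                   g (pure (pure (pure v w) u) z)) -> f =1 g.
Proof.
move=> fL gL fg; apply: tens_ext => // t z.
apply: (tens_ext3l (f := fun t => f (pure t z)) (g := fun t => g (pure t z)))
  => [||v w u]; last exact: fg.
  exact/compP/pure_linearl.
exact/compP/pure_linearl.
Qed.

Lemma tassocK V W U : cancel (@tassoc V W U) (@tassoc_inv V W U).
Proof.
apply: (tens_ext3l (g := id)) => [||v w u]; [|by []|].
  by apply: compP; exact: linearP.
by rewrite tassoc_pure tassoc_inv_pure.
Qed.

Lemma tassoc_invK V W U : cancel (@tassoc_inv V W U) (@tassoc V W U).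
Proof.
apply: (tens_ext3r (g := id)) => [||v w u]; [|by []|].
  by apply: compP; exact: linearP.
by rewrite tassoc_inv_pure tassoc_pure.
Qed.

Lemma tlunitK V : cancel (@tlunit V) (pure (1 : k^o)).
Proof.
apply: (tens_ext (g := id)) => [||a v]; [|by []|].
  by apply: compP; [exact: pure_linearr|exact: linearP].
by rewrite tlunit_pure pureZr -pureZl [_ *: 1]mulr1.
Qed.

Lemma tlunit_invK V : cancel (pure (1 : k^o)) (@tlunit V).
Proof. by move=> v; rewrite tlunit_pure scale1r. Qed.

Lemma trunitK V : cancel (@trunit V) (fun v => pure v (1 : k^o)).
Proof.
apply: (tens_ext (g := id)) => [||v a]; [|by []|].
  move=> a s t; rewrite linearP; exact: pure_linearl.
by rewrite trunit_pure pureZl -pureZr [_ *: 1]mulr1.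
Qed.

Lemma trunit_invK V : cancel (fun v => pure v (1 : k^o)) (@trunit V).
Proof. by move=> v; rewrite trunit_pure scale1r. Qed.

End Tensor.

Section Sl3.
Variable k : fieldType.

Definition traceless : {pred 'M[k]_3} := [pred A | \tr A == 0].

Fact traceless_submod : submod_closed traceless.
Proof.
split=> [|a A B]; rewrite !inE ?linear0// => /eqP A0 /eqP B0.
by rewrite linearP /= A0 B0 addr0 mulr0.
Qed.
HB.instance Definition _ :=
  GRing.isSubmodClosed.Build k 'M[k]_3 traceless traceless_submod.

Record sl3 := Sl3 { sl3_mx :> 'M[k]_3; sl3_mxP : sl3_mx \in traceless }.
HB.instance Definition _ := [isSub for sl3_mx].
HB.instance Definition _ := [Choice of sl3 by <:].
HB.instance Definition _ := [SubChoice_isSubLmodule of sl3 by <:].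

Fact bracket_proof (A B : sl3) : A *m B - B *m A \in traceless.
Proof. by rewrite inE raddfB /= mxtrace_mulC subrr. Qed.
Definition bracket (A B : sl3) : sl3 := Sl3 (bracket_proof A B).

Record sl3_module := Sl3Module {
  car :> vectType k;
  act : sl3 -> car -> car;
  act_linearl : forall (a : k) (x y : sl3) (v : car),
    act (a *: x + y) v = a *: act x v + act y v;
  act_linearr : forall x : sl3, linear (act x);
  act_bracket : forall (x y : sl3) (v : car),
    act (bracket x y) v = act x (act y v) - act y (act x v) }.

Implicit Types V W U : sl3_module.

Lemma actDr V x (v w : V) : act x (v + w) = act x v + act x w.
Proof. by have := act_linearr x 1 v w; rewrite !scale1r. Qed.

Lemma act0r V x : act x (0 : V) = 0.
Proof. by apply: (addrI (act x 0)); rewrite -actDr !addr0. Qed.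

Lemma actZr V x a (v : V) : act x (a *: v) = a *: act x v.
Proof. by have := act_linearr x a v 0; rewrite act0r !addr0. Qed.

Section Morphisms.
Variables V W : sl3_module.

Definition equivariant : {pred 'Hom(V, W)} :=
  fun f => `[< forall (x : sl3) (v : V), f (act x v) = act x (f v) >].

Fact equivariant_submod : submod_closed equivariant.
Proof.
split=> [|a f g /asboolP fE /asboolP gE]; apply/asboolP => x v.
  by rewrite !lfunE /= act0r.
by rewrite !lfunE /= !lfunE /= fE gE act_linearr.
Qed.
HB.instance Definition _ := GRing.isSubmodClosed.Build k 'Hom(V, W) equivariant
  equivariant_submod.

Record sl3_hom := Sl3Hom {
  sl3_lfun :> 'Hom(V, W); sl3_lfunP : sl3_lfun \in equivariant }.
HB.instance Definition _ := [isSub for sl3_lfun].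
HB.instance Definition _ := [Choice of sl3_hom by <:].
HB.instance Definition _ := [SubChoice_isSubLmodule of sl3_hom by <:].

End Morphisms.

Lemma sl3_homE V W (f : sl3_hom V W) x (v : V) : f (act x v) = act x (f v).
Proof. by have /asboolP := sl3_lfunP f. Qed.

Lemma sl3_hom_eq V W (f g : sl3_hom V W) : (f : V -> W) =1 g -> f = g.
Proof. by move=> fg; apply: val_inj; apply/lfunP. Qed.

Definition mk_lin (V W : vectType k) (f : V -> W) (fL : linear f) :
  {linear V -> W} := HB.pack f (GRing.isLinear.Build _ _ _ _ f fL).

Fact mk_hom_equivariant V W (f : V -> W) (fL : linear f)
    (fE : forall x v, f (act x v) = act x (f v)) :
  linfun (mk_lin fL) \in @equivariant V W.
Proof. by apply/asboolP => x v; rewrite !lfunE; exact: fE. Qed.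

Definition mk_hom V W (f : V -> W) (fL : linear f)
    (fE : forall x v, f (act x v) = act x (f v)) : sl3_hom V W :=
  Sl3Hom (mk_hom_equivariant fL fE).

Lemma mk_homE V W (f : V -> W) (fL : linear f) fE v :
  @mk_hom V W f fL fE v = f v.
Proof. exact: (lfunE (mk_lin fL)). Qed.

Lemma sl3_homP V W (f : sl3_hom V W) : linear f.
Proof. exact: linearP. Qed.

Lemma sl3_hom_lin V W a (f g : sl3_hom V W) v :
  (a *: f + g) v = a *: f v + g v.
Proof. by rewrite /= !lfunE /= lfunE. Qed.

Definition sl3_id V : sl3_hom V V :=
  @mk_hom V V id (fun _ _ _ => erefl) (fun _ _ => erefl).

Fact sl3_comp_equivariant V W U (g : sl3_hom W U) (f : sl3_hom V W) x v :
  g (f (act x v)) = act x (g (f v)).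
Proof. by rewrite !sl3_homE. Qed.

Definition sl3_comp V W U (g : sl3_hom W U) (f : sl3_hom V W) : sl3_hom V U :=
  mk_hom (compP (sl3_homP g) (sl3_homP f)) (sl3_comp_equivariant g f).

Lemma sl3_idE V v : sl3_id V v = v.
Proof. exact: mk_homE. Qed.

Lemma sl3_compE V W U (g : sl3_hom W U) (f : sl3_hom V W) v :
  sl3_comp g f v = g (f v).
Proof. exact: mk_homE. Qed.

Definition sl3_lin_cat : lin_cat k.
Proof.
refine (@LinCat k sl3_module (fun V W => sl3_hom V W : lmodType k)
  sl3_id sl3_comp _ _ _ _ _).
- by move=> *; apply: sl3_hom_eq => v; rewrite !sl3_compE.
- by move=> *; apply: sl3_hom_eq => v; rewrite sl3_compE sl3_idE.
- by move=> *; apply: sl3_hom_eq => v; rewrite sl3_compE sl3_idE.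
- by move=> *; apply: sl3_hom_eq => v; rewrite sl3_hom_lin !sl3_compE sl3_hom_lin.
- move=> *; apply: sl3_hom_eq => v.
  by rewrite sl3_hom_lin !sl3_compE sl3_hom_lin sl3_homP.
Defined.

(* x (v ⊗ w) = x v ⊗ w + v ⊗ x w *)
Definition tact V W (x : sl3) : tens V W -> tens V W :=
  tlift (fun v w => pure (act x v) w + pure v (act x w)).

Fact tact_bilin V W x :
  bilin (fun (v : V) (w : W) => pure (act x v) w + pure v (act x w)).
Proof.
by split=> *; rewrite act_linearr !pureE scalerDr addrACA.
Qed.

Lemma tact_linear V W x : linear (@tact V W x).
Proof. exact: linearP. Qed.

Lemma tact_pure V W x (v : V) (w : W) :
  tact x (pure v w) = pure (act x v) w + pure v (act x w).
Proof. exact/tlift_pure/tact_bilin. Qed.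

Lemma tactD V W x (s t : tens V W) : tact x (s + t) = tact x s + tact x t.
Proof. by have := tact_linear x 1 s t; rewrite !scale1r. Qed.

Fact tact_bracket_aux (Z : zmodType) (a b c d p q : Z) :
  a - b + (c - d) = a + p + (q + c) - (b + q + (p + d)).
Proof.
rewrite (addrC q c) [a + p + _]addrACA (addrC p d) [b + q + _]addrACA (addrC q p).
by rewrite opprD [RHS]addrACA subrr addr0 opprD addrACA.
Qed.

Definition tens_module V W : sl3_module.
Proof.
apply: (@Sl3Module (tens V W) (@tact V W)).
- move=> a x y v; rewrite /tact -tlift_fun; apply: eq_tlift => {}v w.
  by rewrite !act_linearl !pureE scalerDr addrACA.
- exact: tact_linear.
- move=> x y.
  apply: (tens_ext (f := tact (bracket x y))
    (g := fun t => tact x (tact y t) - tact y (tact x t))) => [||v w].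
  + exact: tact_linear.
  + by move=> a s t; rewrite !tact_linear scalerBr opprD addrACA.
  + rewrite !tact_pure !act_bracket pureBl pureBr !tactD !tact_pure.
    exact: tact_bracket_aux.
Defined.

Definition trivial_module : sl3_module.
Proof.
apply: (@Sl3Module k^o (fun _ _ => 0)).
- by move=> *; rewrite scaler0 addr0.
- by move=> x a v w; rewrite scaler0 addr0.
- by move=> *; rewrite subrr.
Defined.

Fact tmap_equivariant V V' W W' (f : sl3_hom V V') (g : sl3_hom W W') x
    (t : tens_module V W) :
  (tmap f g (act x t) : tens_module V' W') = act x (tmap f g t : tens_module V' W').
Proof.
have fL := sl3_homP f; have gL := sl3_homP g.
move: t; apply: (tens_ext (f := fun t => tmap f g (tact x t))
  (g := fun t => tact x (tmap f g t))) => [||v w].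
- by apply: compP; [exact: linearP|exact: tact_linear].
- by apply: compP; [exact: tact_linear|exact: linearP].
- by rewrite tmap_pure// !tact_pure (linearD (tmap f g)) /= !tmap_pure// !sl3_homE.
Qed.

Definition sl3_tmap V V' W W' (f : sl3_hom V V') (g : sl3_hom W W') :
    sl3_hom (tens_module V W) (tens_module V' W') :=
  @mk_hom (tens_module V W) (tens_module V' W') (tmap f g) (linearP (tmap f g))
    (tmap_equivariant f g).

Fact tassoc_equivariant V W U x (t : tens_module (tens_module V W) U) :
  (tassoc (act x t) : tens_module V (tens_module W U)) =
  act x (tassoc t : tens_module V (tens_module W U)).
Proof.
move: t; apply: (tens_ext3l
  (f := fun t => tassoc (@tact (tens_module V W) U x t))
  (g := fun t => @tact V (tens_module W U) x (tassoc t))) => [||v w u].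
- exact: (compP (linearP (@tassoc k V W U)) (@tact_linear (tens_module V W) U x)).
- exact: (compP (@tact_linear V (tens_module W U) x) (linearP (@tassoc k V W U))).
- rewrite tassoc_pure !tact_pure /= !tact_pure !pureE.
  by rewrite !(linearD (@tassoc _ _ _ _)) /= !tassoc_pure addrA.
Qed.

Definition sl3_assoc V W U :
    sl3_hom (tens_module (tens_module V W) U) (tens_module V (tens_module W U)) :=
  @mk_hom (tens_module (tens_module V W) U) (tens_module V (tens_module W U))
    (@tassoc k V W U) (linearP (@tassoc k V W U)) (@tassoc_equivariant V W U).

Fact tlunit_equivariant V x (t : tens_module trivial_module V) :
  tlunit (act x t) = act x (tlunit t).
Proof.
move: t; apply: (tens_ext
  (f := fun t => tlunit (@tact trivial_module V x t))
  (g := fun t => act x (tlunit t))) => [||a v].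
- by apply: compP; [exact: linearP|exact: tact_linear].
- by apply: compP; [exact: act_linearr|exact: linearP].
- by rewrite tact_pure /= pure0l add0r !tlunit_pure actZr.
Qed.

Definition sl3_lunit V : sl3_hom (tens_module trivial_module V) V :=
  @mk_hom (tens_module trivial_module V) V (@tlunit k V) (linearP (@tlunit k V))
    (@tlunit_equivariant V).

Fact trunit_equivariant V x (t : tens_module V trivial_module) :
  trunit (act x t) = act x (trunit t).
Proof.
move: t; apply: (tens_ext
  (f := fun t => trunit (@tact V trivial_module x t))
  (g := fun t => act x (trunit t))) => [||v a].
- by apply: compP; [exact: linearP|exact: tact_linear].
- by apply: compP; [exact: act_linearr|exact: linearP].
- by rewrite tact_pure /= pure0r addr0 !trunit_pure actZr.
Qed.

Definition sl3_runit V : sl3_hom (tens_module V trivial_module) V :=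
  @mk_hom (tens_module V trivial_module) V (@trunit k V) (linearP (@trunit k V))
    (@trunit_equivariant V).

Lemma sl3_iso (V W : sl3_lin_cat) (f : sl3_hom V W) (g : W -> V) :
  cancel f g -> cancel g f -> @is_iso k sl3_lin_cat V W f.
Proof.
move=> fK gK.
have gL : linear g.
  by move=> a x y; apply: (can_inj fK); rewrite linearP /= !gK.
have gE x (w : W) : g (act x w) = act x (g w).
  by apply: (can_inj fK); rewrite sl3_homE !gK.
exists (mk_hom gL gE); split; apply: sl3_hom_eq => v.
  by rewrite sl3_compE sl3_idE mk_homE fK.
by rewrite sl3_compE sl3_idE mk_homE gK.
Qed.

Lemma sl3_tmapE V V' W W' (f : sl3_hom V V') (g : sl3_hom W W') v w :
  sl3_tmap f g (pure v w) = pure (f v) (g w).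
Proof.
rewrite (mk_homE (V := tens_module V W) (W := tens_module V' W')).
exact: (tmap_pure _ _ (sl3_homP f) (sl3_homP g)).
Qed.

Lemma sl3_assocE V W U (v : V) (w : W) (u : U) :
  sl3_assoc V W U (pure (pure v w) u) = pure v (pure w u).
Proof.
rewrite (mk_homE (V := tens_module (tens_module V W) U)
  (W := tens_module V (tens_module W U))).
exact: tassoc_pure.
Qed.

Lemma sl3_lunitE V (a : k^o) (v : V) : sl3_lunit V (pure a v) = a *: v.
Proof.
rewrite (mk_homE (V := tens_module trivial_module V) (W := V)).
exact: tlunit_pure.
Qed.

Lemma sl3_runitE V (a : k^o) (v : V) : sl3_runit V (pure v a) = a *: v.
Proof.
rewrite (mk_homE (V := tens_module V trivial_module) (W := V)).
exact: trunit_pure.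
Qed.

Lemma sl3_ext2 V W X (f g : sl3_hom (tens_module V W) X) :
  (forall (v : V) (w : W), f (pure v w) = g (pure v w)) -> f = g.
Proof.
move=> fg; apply: sl3_hom_eq.
exact: (tens_ext (V := V) (W := W) (sl3_homP f) (sl3_homP g) fg).
Qed.

Lemma sl3_ext3 V W U X (f g : sl3_hom (tens_module (tens_module V W) U) X) :
  (forall (v : V) (w : W) (u : U),
     f (pure (pure v w) u) = g (pure (pure v w) u)) -> f = g.
Proof.
move=> fg; apply: sl3_hom_eq.
exact: (tens_ext3l (V := V) (W := W) (sl3_homP f) (sl3_homP g) fg).
Qed.

Lemma sl3_ext4 V W U Z X
    (f g : sl3_hom (tens_module (tens_module (tens_module V W) U) Z) X) :
  (forall (v : V) (w : W) (u : U) (z : Z),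
     f (pure (pure (pure v w) u) z) = g (pure (pure (pure v w) u) z)) -> f = g.
Proof.
move=> fg; apply: sl3_hom_eq.
exact: (tens_ext4 (V := V) (W := W) (U := U) (sl3_homP f) (sl3_homP g) fg).
Qed.

Definition sl3E := (sl3_compE, sl3_idE, sl3_tmapE, sl3_assocE, sl3_lunitE,
  sl3_runitE).

Fact sl3_tmap_id V W : sl3_tmap (sl3_id V) (sl3_id W) = sl3_id (tens_module V W).
Proof. by apply: sl3_ext2 => v w; rewrite !sl3E. Qed.

Fact sl3_tmap_comp V V' V'' W W' W'' (f' : sl3_hom V' V'') (f : sl3_hom V V')
    (g' : sl3_hom W' W'') (g : sl3_hom W W') :
  sl3_tmap (sl3_comp f' f) (sl3_comp g' g) =
  sl3_comp (sl3_tmap f' g') (sl3_tmap f g).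
Proof. by apply: sl3_ext2 => v w; rewrite !sl3E. Qed.

Fact sl3_tmap_linearl V V' W W' a (f f' : sl3_hom V V') (g : sl3_hom W W') :
  sl3_tmap (a *: f + f') g = a *: sl3_tmap f g + sl3_tmap f' g.
Proof.
by apply: sl3_ext2 => v w; rewrite sl3_hom_lin !sl3E sl3_hom_lin !pureE.
Qed.

Fact sl3_tmap_linearr V V' W W' a (f : sl3_hom V V') (g g' : sl3_hom W W') :
  sl3_tmap f (a *: g + g') = a *: sl3_tmap f g + sl3_tmap f g'.
Proof.
by apply: sl3_ext2 => v w; rewrite sl3_hom_lin !sl3E sl3_hom_lin !pureE.
Qed.

Fact sl3_assoc_iso V W U : @is_iso k sl3_lin_cat _ _ (sl3_assoc V W U).
Proof.
apply: (@sl3_iso (tens_module (tens_module V W) U)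
  (tens_module V (tens_module W U)) _ (@tassoc_inv k V W U)) => t.
  by rewrite (mk_homE (V := tens_module (tens_module V W) U)); exact: tassocK.
by rewrite (mk_homE (V := tens_module (tens_module V W) U)); exact: tassoc_invK.
Qed.

Fact sl3_lunit_iso V : @is_iso k sl3_lin_cat _ _ (sl3_lunit V).
Proof.
apply: (@sl3_iso (tens_module trivial_module V) V _ (pure (1 : k^o))) => t.
  by rewrite (mk_homE (V := tens_module trivial_module V)); exact: tlunitK.
by rewrite (mk_homE (V := tens_module trivial_module V)); exact: tlunit_invK.
Qed.

Fact sl3_runit_iso V : @is_iso k sl3_lin_cat _ _ (sl3_runit V).
Proof.
apply: (@sl3_iso (tens_module V trivial_module) V _
  (fun v => pure v (1 : k^o))) => t.
  by rewrite (mk_homE (V := tens_module V trivial_module)); exact: trunitK.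
by rewrite (mk_homE (V := tens_module V trivial_module)); exact: trunit_invK.
Qed.

Fact sl3_assoc_nat V V' W W' U U' (f : sl3_hom V V') (g : sl3_hom W W')
    (h : sl3_hom U U') :
  sl3_comp (sl3_assoc V' W' U') (sl3_tmap (sl3_tmap f g) h) =
  sl3_comp (sl3_tmap f (sl3_tmap g h)) (sl3_assoc V W U).
Proof. by apply: sl3_ext3 => v w u; rewrite !sl3E. Qed.

Fact sl3_lunit_nat V V' (f : sl3_hom V V') :
  sl3_comp (sl3_lunit V') (sl3_tmap (sl3_id trivial_module) f) =
  sl3_comp f (sl3_lunit V).
Proof. by apply: sl3_ext2 => a v; rewrite !sl3E linearZ. Qed.

Fact sl3_runit_nat V V' (f : sl3_hom V V') :
  sl3_comp (sl3_runit V') (sl3_tmap f (sl3_id trivial_module)) =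
  sl3_comp f (sl3_runit V).
Proof. by apply: sl3_ext2 => v a; rewrite !sl3E linearZ. Qed.

Fact sl3_pentagon V W U Z :
  sl3_comp (sl3_assoc V W (tens_module U Z)) (sl3_assoc (tens_module V W) U Z) =
  sl3_comp (sl3_comp (sl3_tmap (sl3_id V) (sl3_assoc W U Z))
                     (sl3_assoc V (tens_module W U) Z))
           (sl3_tmap (sl3_assoc V W U) (sl3_id Z)).
Proof. by apply: sl3_ext4 => v w u z; rewrite !sl3E. Qed.

Fact sl3_triangle V W :
  sl3_comp (sl3_tmap (sl3_id V) (sl3_lunit W)) (sl3_assoc V trivial_module W) =
  sl3_tmap (sl3_runit V) (sl3_id W).
Proof. by apply: sl3_ext3 => v a w; rewrite !sl3E !pureE. Qed.

Definition sl3_mod : monoidal_cat k :=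
  @MonoidalCat k sl3_lin_cat tens_module sl3_tmap trivial_module
    sl3_assoc sl3_lunit sl3_runit sl3_tmap_id sl3_tmap_comp
    sl3_tmap_linearl sl3_tmap_linearr sl3_assoc_iso sl3_lunit_iso sl3_runit_iso
    sl3_assoc_nat sl3_lunit_nat sl3_runit_nat sl3_pentagon sl3_triangle.

Definition natural_module : sl3_module.
Proof.
apply: (@Sl3Module 'cV[k]_3 (fun x v => sl3_mx x *m v)).
- by move=> a x y v; rewrite mulmxDl scalemxAl.
- by move=> x a v w; rewrite mulmxDr scalemxAr.
- by move=> x y v; rewrite mulmxBl !mulmxA.
Defined.

Definition dual_act V (x : sl3) (phi : 'Hom(V, k^o)) : 'Hom(V, k^o) :=
  - (phi \o linfun (mk_lin (act_linearr (s := V) x)))%VF.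

Lemma dual_actE V x (phi : 'Hom(V, k^o)) v :
  dual_act x phi v = - phi (act x v).
Proof. by rewrite opp_lfunE comp_lfunE lfunE. Qed.

Definition dual_module V : sl3_module.
Proof.
apply: (@Sl3Module 'Hom(V, k^o) (@dual_act V)).
- move=> a x y phi; apply/lfunP => v.
  rewrite add_lfunE scale_lfunE !dual_actE act_linearl linearP /=.
  by rewrite opprD scalerN.
- move=> x a phi psi; apply/lfunP => v.
  rewrite add_lfunE scale_lfunE !dual_actE add_lfunE scale_lfunE.
  by rewrite opprD scalerN.
- move=> x y phi; apply/lfunP => v.
  rewrite dual_actE act_bracket add_lfunE [X in _ = _ + X]opp_lfunE !dual_actE.
  by rewrite linearB /= !opprK opprB.
Defined.

End Sl3.

Definition nat_F (k : fieldType) : sl3_mod k := natural_module k.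
Definition dual_F (k : fieldType) : sl3_mod k := dual_module (natural_module k).

(* Main.v *)
(* Let X be an indecomposable object of M in the class that corresponds to the
   trivial module under the graph isomorphism for F.  Counting paths in the
   graph, X occurs in F^n X as often as the trivial module occurs in F^(tensor
   n).  Hence, modulo the radical, every morphism F^n X -> X is the action on X
   of a morphism in C, and since every sl3-module is a direct summand of a sum of
   tensor powers of F, so is every morphism V X -> X.  The morphisms f of M such
   that b (B f) a lies in the radical of End(X), for all B in C, a : X -> B Y and
   b : B Z -> X, form a stable ideal not containing id_X, which is zero by
   simplicity; by the interchange law it contains all radical morphisms V X -> X.
   So Hom(V X, X) = Hom_C(V, 1), and by duality V |-> V X is fully faithful.  It
   is essentially surjective because the morphisms factoring through some V X
   form a nonzero stable ideal.

   Complete reducibility comes from the Casimir operator: on a singular vector of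
   weight (a, b) it acts by a positive multiple of a^2 + ab + b^2 + 3(a + b), so
   its generalised kernel consists of invariants, and taking invariants is exact.
   Every nonzero module V receives a nonzero map from a tensor power of F, by
   induction on the weight of a singular vector: F^* V, resp. F V, contains a
   singular vector of weight (a - 1, b), resp. (a, b - 1). *)
Require Import Defs.
From HB Require Import structures.
From mathcomp Require Import all_boot all_order all_algebra perm.
From mathcomp Require Import boolp classical_sets reals.
From mathcomp Require Import complex ring.
Set Implicit Arguments.
Unset Strict Implicit.
Unset Printing Implicit Defensive.
Import GRing.Theory Num.Theory Defs.
Local Open Scope ring_scope.
Local Open Scope cat_scope.

(** * Linear categories and local endomorphism rings *)

Lemma dep_choice (I : Type) (T : I -> Type) (P : forall i, T i -> Prop) :
  (forall i, exists x, P i x) -> exists f : forall i, T i, forall i, P i (f i).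
Proof.
by move=> ex; exists (fun i => projT1 (cid (ex i))) => i; exact: projT2 (cid (ex i)).
Qed.

Section LinearAlgebra.
Variables (k : closedFieldType) (V : lmodType k).

(** With n generators, n + 1 of the vectors give a coefficient matrix with more rows than columns,
    hence a nonzero row kernel. The relation is packed as a polynomial so that for [v i] the i-th
    iterate of an operator it reads as an annihilating polynomial. *)
Lemma finite_dimensional_dep (fdV : finite_dimensional V) (v : nat -> V) :
  exists2 p : {poly k}, p != 0 & \sum_(i < size p) p`_i *: v i = 0.
Proof.
have [n [e eP]] := fdV.
have [c cP] := choice (fun i : 'I_n.+1 => eP (v i)).
pose A : 'M[k]_(n.+1, n) := \matrix_(i, j) c i j.
have kA : kermx A != 0.
  by rewrite kermx_eq0 /row_free neq_ltn ltnS rank_leq_col.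
have [l] : exists l, row l (kermx A) != 0.
  apply/existsP; apply: contraR kA => /existsPn rows0; apply/eqP/row_matrixP => i.
  by rewrite row0; apply/eqP/negPn/rows0.
set x := row l _ => x0.
have xA : x *m A = 0 by apply: sub_kermxP; exact: row_sub.
pose p := \poly_(i < n.+1) x 0 (inord i).
have pE (j : 'I_n.+1) : p`_j = x 0 j by rewrite coef_poly ltn_ord inord_val.
exists p.
  apply: contraNneq x0 => p0; apply/eqP/rowP => j.
  by rewrite -pE p0 coef0 mxE.
rewrite (big_ord_widen n.+1 (fun i => p`_i *: v i)) ?size_poly //.
rewrite big_mkcond /= (eq_bigr (fun j : 'I_n.+1 => x 0 j *: v j)); last first.
  move=> j _; rewrite -pE; case: ltnP => // /(nth_default 0) ->.
  by rewrite scale0r.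
transitivity (\sum_j (\sum_(l < n.+1) x 0 l * A l j) *: e j).
  under [RHS]eq_bigr do rewrite scaler_suml.
  rewrite exchange_big /=; apply: eq_bigr => i _; rewrite cP scaler_sumr.
  by apply: eq_bigr => j _; rewrite scalerA [A _ _]mxE.
rewrite big1 // => j _.
by have /matrixP/(_ 0 j) := xA; rewrite mxE [RHS]mxE => ->; rewrite scale0r.
Qed.

(** Roots of a polynomial annihilating v are split off one at a time: for a root z either v is an
    eigenvector, or [f v - z *: v] is nonzero and annihilated by the quotient. The predicate P lets
    the search stay inside an eigenspace of a commuting operator. *)
Lemma finite_dimensional_eigen (fdV : finite_dimensional V) (f : {linear V -> V})
    (P : V -> Prop) (v : V) :
  (forall w a, P w -> P (f w - a *: w)) -> P v -> v != 0 ->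
  exists w a, [/\ P w, w != 0 & f w = a *: w].
Proof.
move=> Pf Pv v0.
have [p p0] := finite_dimensional_dep fdV (fun i => iter i f v).
elim: {p}(size p) {-2}p (leqnn (size p)) p0 v Pv v0 => [|n IHn] p.
  by rewrite leqn0 size_poly_eq0 => ->.
move=> ps p0 v Pv v0 pv.
have /closed_rootP [z /factor_theorem [q qE]] : size p != 1.
  apply: contraNneq v0 => /eqP/size_poly1P [c c0 pc].
  move: pv; rewrite pc size_polyC c0 big_ord1 coefC eqxx /= => /eqP.
  by rewrite scaler_eq0 (negPf c0).
have [fv|fv] := eqVneq (f v - z *: v) 0.
  by exists v, z; split => //; apply/eqP; rewrite -subr_eq0 fv.
have q0 : q != 0 by apply: contraNneq p0 => q0; rewrite qE q0 mul0r.
have sp : size p = (size q).+1 by rewrite qE size_Mmonic ?monicXsubC // size_XsubC addn2.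
apply: (IHn q _ q0 (f v - z *: v)) => //; first by rewrite -ltnS -sp.
  exact: Pf.
rewrite -[RHS]pv sp.
under eq_bigr => i _.
  have -> : iter i f (f v - z *: v) = iter i.+1 f v - z *: iter i f v.
    by elim: (nat_of_ord i) => //= j ->; rewrite linearB /= linearZ_LR.
  rewrite scalerBr scalerA mulrC; over.
rewrite sumrB; apply/eqP; rewrite eq_sym.
rewrite (eq_bigr (fun i : 'I_(size q).+1 =>
    (if i == 0%N :> nat then 0 else q`_i.-1) *: iter i f v -
    (q`_i * z) *: iter i f v)); last first.
  by move=> i _; rewrite qE mulrBr coefB coefMX coefMC scalerBl.
rewrite sumrB big_ord_recl /= scale0r add0r [X in _ - X]big_ord_recr /=.
rewrite nth_default // mul0r scale0r addr0; apply/eqP; congr (_ - _).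
by apply: eq_bigr => i _; rewrite mulrC.
Qed.

End LinearAlgebra.

Section LinCat.
Variables (k : fieldType) (M : lin_cat k).
Implicit Types X Y Z : M.

Lemma compDl X Y Z (g g' : hom Y Z) (f : hom X Y) :
  (g + g') ∘ f = g ∘ f + g' ∘ f.
Proof. by have := comp_linearl 1 g g' f; rewrite !scale1r. Qed.

Lemma compDr X Y Z (g : hom Y Z) (f f' : hom X Y) :
  g ∘ (f + f') = g ∘ f + g ∘ f'.
Proof. by have := comp_linearr 1 g f f'; rewrite !scale1r. Qed.

Lemma comp0m X Y Z (f : hom X Y) : (0 : hom Y Z) ∘ f = 0.
Proof. by apply: (addrI (0 ∘ f)); rewrite -compDl !addr0. Qed.

Lemma compm0 X Y Z (g : hom Y Z) : g ∘ (0 : hom X Y) = 0.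
Proof. by apply: (addrI (g ∘ 0)); rewrite -compDr !addr0. Qed.

Lemma compZl X Y Z a (g : hom Y Z) (f : hom X Y) : (a *: g) ∘ f = a *: (g ∘ f).
Proof. by have := comp_linearl a g 0 f; rewrite comp0m !addr0. Qed.

Lemma compZr X Y Z a (g : hom Y Z) (f : hom X Y) : g ∘ (a *: f) = a *: (g ∘ f).
Proof. by have := comp_linearr a g f 0; rewrite compm0 !addr0. Qed.

Lemma compBl X Y Z (g g' : hom Y Z) (f : hom X Y) :
  (g - g') ∘ f = g ∘ f - g' ∘ f.
Proof. by rewrite -scaleN1r compDl compZl scaleN1r. Qed.

Lemma compBr X Y Z (g : hom Y Z) (f f' : hom X Y) :
  g ∘ (f - f') = g ∘ f - g ∘ f'.
Proof. by rewrite -scaleN1r compDr compZr scaleN1r. Qed.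

Lemma comp_suml X Y Z (I : Type) (s : seq I) (P : pred I) (g : I -> hom Y Z)
    (f : hom X Y) :
  (\sum_(i <- s | P i) g i) ∘ f = \sum_(i <- s | P i) g i ∘ f.
Proof.
by elim/big_rec2: _ => [|i x y _ <-]; rewrite ?comp0m ?compDl.
Qed.

Lemma comp_sumr X Y Z (I : Type) (s : seq I) (P : pred I) (g : hom Y Z)
    (f : I -> hom X Y) :
  g ∘ (\sum_(i <- s | P i) f i) = \sum_(i <- s | P i) g ∘ f i.
Proof.
by elim/big_rec2: _ => [|i x y _ <-]; rewrite ?compm0 ?compDr.
Qed.

Lemma compNl X Y Z (g : hom Y Z) (f : hom X Y) : (- g) ∘ f = - (g ∘ f).
Proof. by rewrite -sub0r compBl comp0m sub0r. Qed.

Lemma compNr X Y Z (g : hom Y Z) (f : hom X Y) : g ∘ (- f) = - (g ∘ f).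
Proof. by rewrite -sub0r compBr compm0 sub0r. Qed.

Lemma is_isoN X Y (f : hom X Y) : is_iso (- f) -> is_iso f.
Proof.
by move=> [g [gf fg]]; exists (- g); rewrite compNl compNr -compNr gf -compNl.
Qed.

Lemma is_iso_id X : is_iso (idm X).
Proof. by exists (idm X); rewrite comp1m. Qed.

Lemma is_iso_comp X Y Z (g : hom Y Z) (f : hom X Y) :
  is_iso g -> is_iso f -> is_iso (g ∘ f).
Proof.
move=> [g' [g'g gg']] [f' [f'f ff']]; exists (f' ∘ g').
by rewrite !compA -(compA f') g'g compm1 f'f -(compA g) ff' compm1 gg'.
Qed.

Lemma isomorphic_refl X : isomorphic X X.
Proof. by exists (idm X); exact: is_iso_id. Qed.

Lemma isomorphic_sym X Y : isomorphic X Y -> isomorphic Y X.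
Proof. by move=> [f [g [gf fg]]]; exists g, f. Qed.

Lemma isomorphic_trans X Y Z :
  isomorphic X Y -> isomorphic Y Z -> isomorphic X Z.
Proof.
by move=> [f fI] [g gI]; exists (g ∘ f); exact: is_iso_comp.
Qed.

Lemma isomorphic_class X Y : isomorphic X Y -> iso_class X = iso_class Y.
Proof.
move=> XY; apply/funext => Z; apply/propext; split; last exact: isomorphic_trans.
exact/isomorphic_trans/isomorphic_sym.
Qed.

Lemma direct_sum_iso (I : finType) (W : I -> M) Z Z' :
  isomorphic Z Z' -> direct_sum W Z -> direct_sum W Z'.
Proof.
move=> [f [g [gf fg]]] [inj [proj [pi0 pi1 pi2]]].
exists (fun i => f ∘ inj i), (fun i => proj i ∘ g); split => [i|i j ij|].
- by rewrite compA -(compA (proj i)) gf compm1.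
- by rewrite compA -(compA (proj j)) gf compm1 pi1.
- rewrite -fg -[in RHS](compm1 f) -pi2 comp_sumr comp_suml.
  by apply: eq_bigr => i _; rewrite !compA.
Qed.

Lemma direct_sum1 X : direct_sum (fun _ : 'I_1 => X) X.
Proof.
exists (fun=> idm X), (fun=> idm X); split => [i|i j|].
- by rewrite comp1m.
- by rewrite (ord1 i) (ord1 j).
- by rewrite big_ord1 comp1m.
Qed.

Lemma direct_sum_sigma (I : finType) (J : I -> finType) (W : I -> M)
    (Y : forall i, J i -> M) Z :
  direct_sum W Z -> (forall i, direct_sum (Y i) (W i)) ->
  direct_sum (fun x : {i : I & J i} => Y (tag x) (tagged x)) Z.
Proof.
move=> [inj [proj [p1 p2 p3]]] /dep_choice [inj' /dep_choice [proj' YW]].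
exists (fun x => inj (tag x) ∘ inj' _ (tagged x)).
exists (fun x => proj' _ (tagged x) ∘ proj (tag x)); split => [[i j]|[i j] [i' j']|] /=.
- by have [q1 _ _] := YW i; rewrite compA -(compA (proj' i j)) p1 compm1 q1.
- rewrite compA -(compA (proj' i' j')); have [eqi|ii'] := eqVneq i i'; last first.
    by move=> _; rewrite p2 // compm0 comp0m.
  case: i' / eqi j' => j'; rewrite -tag_eqE /tag_eq /= eqxx tagged_asE /= => jj'.
  by have [_ q2 _] := YW i; rewrite p1 compm1 q2.
- rewrite -p3 -(sig_big_dep xpredT (fun _ _ => true)
    (fun i j => inj i ∘ inj' i j ∘ (proj' i j ∘ proj i))) /=.
  apply: eq_bigr => i _; have [_ _ q3] := YW i.
  rewrite -[in RHS](compm1 (inj i)) -q3 comp_sumr comp_suml.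
  by apply: eq_bigr => j _; rewrite !compA.
Qed.

Lemma direct_sum_reindex (I J : finType) (h : J -> I) (W : I -> M) Z :
  bijective h -> direct_sum W Z -> direct_sum (fun j => W (h j)) Z.
Proof.
move=> bh [inj [proj [p1 p2 p3]]].
exists (fun j => inj (h j)), (fun j => proj (h j)); split => [//|i j ij|].
  by apply: p2; rewrite (inj_eq (bij_inj bh)).
by rewrite -p3 (reindex h) //; exact: onW_bij.
Qed.

End LinCat.

Section Local.
Variables (k : fieldType) (M : lin_cat k).
Implicit Types X Y Z : M.

Lemma idem_iso X (e : hom X X) : e ∘ e = e -> is_iso e -> e = idm X.
Proof. by move=> ee [g [ge _]]; rewrite -[LHS]comp1m -ge -compA ee. Qed.

(** With u the inverse of g f, the composite f u g is an idempotent of the local ring End(Y), so it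
    is 0 or 1; it cannot be 0, as this would force the identity of X to vanish. *)
Lemma local_retract_iso X Y (f : hom X Y) (g : hom Y X) :
  local_end Y -> ~ is_zero X -> is_iso (g ∘ f) -> is_iso f /\ is_iso g.
Proof.
move=> [Y0 Yl] X0 [u [ug gu]].
have ee : (f ∘ u ∘ g) ∘ (f ∘ u ∘ g) = f ∘ u ∘ g.
  by rewrite !compA -(compA (f ∘ u) g f) -(compA (f ∘ u) (g ∘ f)) gu compm1.
have e1 : f ∘ u ∘ g = idm Y.
  have [/(idem_iso ee) //|eI] := Yl (f ∘ u ∘ g).
  have /idem_iso/(_ eI)/eqP : (idm Y - f ∘ u ∘ g) ∘ (idm Y - f ∘ u ∘ g) = idm Y - f ∘ u ∘ g.
    by rewrite compBl comp1m compBr ee compm1 subrr subr0.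
  rewrite -subr_eq0 addrAC subrr add0r oppr_eq0 => /eqP e0.
  have : g ∘ (f ∘ u ∘ g) ∘ f ∘ u = idm X by rewrite !compA gu comp1m gu.
  by rewrite e0 compm0 !comp0m => /esym/X0.
by split; [exists (u ∘ g) | exists (f ∘ u)]; split; rewrite ?compA // -compA.
Qed.

Lemma local_end_iso X Y : isomorphic X Y -> local_end X -> local_end Y.
Proof.
move=> [f [g [gf fg]]] [X0 Xl]; split=> [Y0|h].
  by apply: X0; rewrite /is_zero -gf -(comp1m f) Y0 comp0m compm0.
have tr (u : hom X X) : is_iso u -> is_iso (f ∘ u ∘ g).
  move=> uI; have fI : is_iso f by exists g.
  have gI : is_iso g by exists f.
  exact: (is_iso_comp (is_iso_comp fI uI) gI).
have gh : f ∘ (g ∘ h ∘ f) ∘ g = h by rewrite !compA fg comp1m -compA fg compm1.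
case: (Xl (g ∘ h ∘ f)) => /tr; first by rewrite gh; left.
by rewrite compBr compBl compm1 fg gh; right.
Qed.

Lemma local_endD X (f g : hom X X) :
  local_end X -> is_iso (f + g) -> is_iso f \/ is_iso g.
Proof.
move=> Xl [u [ufg fgu]]; have [X0 Xl'] := Xl.
have [I|I] := Xl' (u ∘ f); [left|right].
  by case: (local_retract_iso Xl X0 I).
move: I; rewrite -ufg compDr addrC addrA addNr add0r => I.
by case: (local_retract_iso Xl X0 I).
Qed.

Lemma local_indecomposable X : local_end X -> indecomposable X.
Proof.
move=> [X0 Xl]; split=> // Y [inj [proj [p1 p2 p3]]].
have ee b : (inj b ∘ proj b) ∘ (inj b ∘ proj b) = inj b ∘ proj b.
  by rewrite !compA -(compA (inj b)) p1 compm1.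
have e01 b : idm X - inj b ∘ proj b = inj (~~ b) ∘ proj (~~ b).
  by rewrite -p3 big_bool; case: b => /=; [rewrite addrAC subrr add0r|rewrite addrK].
have zero b : inj b ∘ proj b = idm X -> is_zero (Y (~~ b)).
  move=> e1; rewrite /is_zero -p1 -(comp1m (inj _)) -e1 !compA p2 ?comp0m //.
  by case: b {e1}.
case: (Xl (inj true ∘ proj true)) => [/(idem_iso (ee _))/zero|]; first by exists false.
by rewrite e01 => /(idem_iso (ee _))/zero; exists true.
Qed.

(** Splitting both e and 1 - e writes X as a biproduct of two objects, one of which must be zero. *)
Lemma indecomposable_idem X (e : hom X X) : idempotent_split M ->
  indecomposable X -> e ∘ e = e -> e = 0 \/ e = idm X.
Proof.
move=> split [X0 Xi] ee; pose f := idm X - e.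
have ef : e ∘ f = 0 by rewrite compBr compm1 ee subrr.
have fe : f ∘ e = 0 by rewrite compBl comp1m ee subrr.
have ff : f ∘ f = f by rewrite {2}/f compBr compm1 fe subr0.
have [Y [p [i [ip pi]]]] := split X e ee; have [Z [q [j [jq qj]]]] := split X f ff.
have pe : p ∘ e = p by rewrite -ip compA pi comp1m.
have ei : e ∘ i = i by rewrite -ip -compA pi compm1.
have qf : q ∘ f = q by rewrite -jq compA qj comp1m.
have fj : f ∘ j = j by rewrite -jq -compA qj compm1.
pose T b := if b then Y else Z.
have TX : direct_sum T X.
  exists (fun b => if b as b return hom (T b) X then i else j).
  exists (fun b => if b as b return hom X (T b) then p else q).
  split => [[]|[] [] //= _|] //=.
  - by rewrite -qf -ei -compA (compA f) fe comp0m compm0.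
  - by rewrite -pe -fj -compA (compA e) ef comp0m compm0.
  - by rewrite big_bool /= ip jq addrC subrK.
have [[] /= T0] := Xi T TX; [left|right].
  by rewrite -ip -(compm1 i) T0 compm0 comp0m.
apply/esym/eqP; rewrite -subr_eq0 -/f -jq -(compm1 j) T0 compm0 comp0m.
exact: eqxx.
Qed.

(** The form of the Krull-Schmidt property shared by the two categories to be compared: for [M] it
    follows from local finitarity, for sl3-modules it comes from complete reducibility. *)
Definition krull_schmidt_cat : Prop :=
  [/\ forall X : M, exists (n : nat) (Y : 'I_n -> M),
        (forall i, indecomposable (Y i)) /\ direct_sum Y X,
      forall X : M, indecomposable X -> local_end X
    & forall X Y : M, finite_dimensional (hom X Y)].

(** For indecomposable X, the idempotent onto the first summand of a decomposition into local
    objects is nonzero, hence the identity, so X is isomorphic to that summand. *)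
Lemma locally_finitary_ks : locally_finitary M -> krull_schmidt_cat.
Proof.
move=> [_ split ks _ fd]; split => // X; first have [n [Y [Yl YX]]] := ks X.
  by exists n, Y; split=> // i; exact: local_indecomposable.
move=> [X0 Xi]; have [[|n] [Y [Yl YX]]] := ks X.
  by case: X0; have [i [p [_ _]]] := YX; rewrite big_ord0.
have [inj [proj [p1 p2 p3]]] := YX.
have ee : inj ord0 ∘ proj ord0 ∘ (inj ord0 ∘ proj ord0) = inj ord0 ∘ proj ord0.
  by rewrite compA -(compA (inj _)) p1 compm1.
have [e0|e1] := indecomposable_idem split (conj X0 Xi) ee.
  have [Y0 _] := Yl ord0; case: Y0; rewrite /is_zero -p1 -[RHS](comp0m _ (inj ord0)).
  by rewrite -(compm0 _ (proj ord0)) -e0 !compA p1 comp1m.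
by apply: local_end_iso (Yl ord0); exists (inj ord0), (proj ord0).
Qed.

End Local.

(** * The residue field of a local endomorphism ring *)

Section Residue.
Variables (k : closedFieldType) (M : lin_cat k).
Implicit Types X Y Z : M.

(** The quotient map from End(X) to its residue field, which is k itself because k is algebraically
    closed. *)
Definition residue_char X (r : hom X X -> k) : Prop :=
  [/\ forall a f g, r (a *: f + g) = a * r f + r g,
      forall f g, r (f ∘ g) = r f * r g,
      r (idm X) = 1
    & forall f, r f != 0 -> is_iso f].

(** Left multiplication by f has an eigenvalue c, and then f - c is not invertible. Such a c is
    unique because non-isomorphisms form a two-sided ideal, and uniqueness makes [r] linear and
    multiplicative. *)
Lemma residue_exists X :
  local_end X -> finite_dimensional (hom X X) -> exists r, @residue_char X r.
Proof.
move=> Xl fd; have [X0 _] := Xl.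
have /choice [r rP] (f : hom X X) : exists c, ~ is_iso (f - c *: idm X).
  have fL : linear (fun g : hom X X => f ∘ g) by move=> *; exact: comp_linearr.
  pose F : {linear hom X X -> hom X X} :=
    HB.pack (fun g : hom X X => f ∘ g) (GRing.isLinear.Build _ _ _ _ _ fL).
  have idX0 : idm X != 0 by exact/eqP.
  have [//|w [c [_ w0 fw]]] := @finite_dimensional_eigen _ _ fd F (fun=> True) _ _ I idX0.
  exists c => -[u [uf _]].
  case/eqP: w0; rewrite -(comp1m w) -uf -compA compBl compZl comp1m.
  by move: fw => /= ->; rewrite subrr compm0.
have scal a : a != 0 -> is_iso (a *: idm X).
  by move=> a0; exists (a^-1 *: idm X); rewrite !compZl !compZr !comp1m !scalerA mulVf ?mulfV // scale1r.
have uniq f c : ~ is_iso (f - c *: idm X) -> r f = c.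
  move=> fc; apply/eqP/negPn/negP => rc.
  have := scal (r f - c); rewrite subr_eq0 => /(_ rc).
  have -> : (r f - c) *: idm X = (f - c *: idm X) + - (f - r f *: idm X).
    by rewrite opprB [RHS]addrC addrA subrK scalerBl.
  by case/(local_endD Xl) => // /is_isoN; exact: rP.
have nisoD (f g : hom X X) : ~ is_iso f -> ~ is_iso g -> ~ is_iso (f + g).
  by move=> fI gI fgI; case: (local_endD Xl fgI).
have nisol (f g : hom X X) : ~ is_iso f -> ~ is_iso (f ∘ g).
  by move=> fI fgI; case: (local_retract_iso Xl X0 fgI).
have nisor (f g : hom X X) : ~ is_iso g -> ~ is_iso (f ∘ g).
  by move=> fI fgI; case: (local_retract_iso Xl X0 fgI).
exists r; split=> [a f g|f g||f].
- apply: uniq.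
  have -> : a *: f + g - (a * r f + r g) *: idm X =
      (f - r f *: idm X) ∘ (a *: idm X) + (g - r g *: idm X).
    rewrite compZr compm1 scalerBr scalerA scalerDl opprD -!addrA; congr (_ + _).
    by rewrite addrCA.
  by apply: nisoD => //; exact: nisol.
- apply: uniq.
  have -> : f ∘ g - (r f * r g) *: idm X =
      (f - r f *: idm X) ∘ g + (r f *: idm X) ∘ (g - r g *: idm X).
    by rewrite compBl !compZl !comp1m scalerBr scalerA addrA subrK.
  by apply: nisoD; [exact: nisol | exact: nisor].
- by apply: uniq; rewrite scale1r subrr => -[u [u0 _]]; apply: X0; rewrite /is_zero -u0 compm0.
- move=> rf; apply: contrapT => fI; move: rf; rewrite (uniq f 0) ?eqxx //.
  by rewrite scale0r subr0.
Qed.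

End Residue.

(** * Krull-Schmidt multiplicities and graphs *)

Section Multiplicity.
Variables (k : closedFieldType) (M : lin_cat k).
Implicit Types X Y Z : M.

Definition mult (I : finType) (W : I -> M) X : nat :=
  #|[set i | `[< isomorphic (W i) X >]]%SET|.

(** Insert the decomposition of the identity of Z between g a and f b. A summand not isomorphic to X
    contributes residue 0, since no automorphism of X factors through it; so the identity matrix of
    size p factors through a space of dimension [mult W X]. *)
Lemma rank_le_mult X (r : hom X X -> k) (I : finType) (W : I -> M) Z p
    (f : 'I_p -> hom X Z) (g : 'I_p -> hom Z X) :
  local_end X -> residue_char r -> (forall i, local_end (W i)) ->
  direct_sum W Z -> (forall i j, r (g i ∘ f j) = (i == j)%:R) ->
  (p <= mult W X)%N.
Proof.
move=> Xl [rlin rM r1 rI] Wl [inj [proj [p1 p2 p3]]] gf.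
have r0 : r 0 = 0.
  by have := rlin (-1) (idm X) (idm X); rewrite scaleN1r addNr mulN1r r1 addNr.
have rD u v : r (u + v) = r u + r v by have := rlin 1 u v; rewrite scale1r mul1r.
(* For the summands not isomorphic to X the pair is the dummy (0, 0). *)
have /dep_choice [u uP] (i : I) : exists u : hom (W i) X * hom X (W i),
    isomorphic (W i) X -> u.2 ∘ u.1 = idm (W i).
  have [[u [v [vu _]]]|nI] := pselect (isomorphic (W i) X); first by exists (u, v).
  by exists (0, 0).
pose S := [set i | `[< isomorphic (W i) X >]]%SET.
pose G : 'M[k]_(p, #|S|) :=
  \matrix_(a, s) r (g a ∘ inj (enum_val s) ∘ (u (enum_val s)).2).
pose H : 'M[k]_(#|S|, p) :=
  \matrix_(s, b) r ((u (enum_val s)).1 ∘ (proj (enum_val s) ∘ f b)).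
have GH : G *m H = 1%:M.
  apply/matrixP => a b; rewrite mxE [RHS]mxE -gf -[in RHS](compm1 (g a)) -p3 comp_sumr comp_suml.
  rewrite (big_morph r rD r0) (bigID (mem S)) /= [X in _ = _ + X]big1 ?addr0.
    rewrite [RHS]big_enum_val /=; apply: eq_bigr => s _; rewrite [G _ _]mxE [H _ _]mxE -rM.
    have := enum_valP s; rewrite inE => /asboolP/(uP (enum_val s)) uS.
    by rewrite !compA -(compA _ _ (u _).1) uS compm1.
  move=> i /[!inE] iS; apply/eqP/negPn/negP => /rI.
  rewrite compA -compA => /(local_retract_iso (Wl i) (proj1 Xl)) [fI _].
  move/negP: iS; apply; apply/asboolP/isomorphic_sym.
  by exists (proj i ∘ f b).
by rewrite -[p](mxrank1 k) -GH (leq_trans (mxrankM_maxl _ _)) ?rank_leq_col.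
Qed.

Lemma mult_le_rank X (I : finType) (W : I -> M) Z : direct_sum W Z ->
  exists (f : 'I_(mult W X) -> hom X Z) (g : 'I_(mult W X) -> hom Z X),
    forall i j, g i ∘ f j = (i == j)%:R *: idm X.
Proof.
move=> [inj [proj [p1 p2 p3]]].
have /dep_choice [u uP] (i : I) : exists u : hom (W i) X * hom X (W i),
    isomorphic (W i) X -> u.1 ∘ u.2 = idm X.
  have [[u [v [_ uv]]]|nI] := pselect (isomorphic (W i) X); first by exists (u, v).
  by exists (0, 0).
exists (fun s => inj (enum_val s) ∘ (u (enum_val s)).2).
exists (fun s => (u (enum_val s)).1 ∘ proj (enum_val s)) => s t.
rewrite compA -(compA _ (proj _)); have [<-|st] := eqVneq s t.
  rewrite p1 compm1 scale1r uP //.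
  by have := enum_valP s; rewrite inE => /asboolP.
by rewrite p2 ?compm0 ?comp0m ?scale0r // (inj_eq enum_val_inj) eq_sym.
Qed.

Hypothesis ks : krull_schmidt_cat M.

Lemma indecomposable_local X : indecomposable X -> local_end X.
Proof. by case: ks => _ + _; exact. Qed.

Lemma indecomposable_iso X Y :
  isomorphic X Y -> indecomposable X -> indecomposable Y.
Proof.
by move=> XY /indecomposable_local/(local_end_iso XY)/local_indecomposable.
Qed.

Lemma residue_indecomposable X :
  indecomposable X -> exists r : hom X X -> k, residue_char r.
Proof.
by move=> /indecomposable_local Xl; apply: residue_exists => //; case: ks.
Qed.

(** The inclusions and projections of the copies of X in one decomposition form a dual system, whose
    size the other decomposition bounds. By symmetry multiplicities are well defined. *)
Lemma mult_le (I J : finType) (W : I -> M) (W' : J -> M) X Z :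
  indecomposable X ->
  (forall j, indecomposable (W' j)) ->
  direct_sum W Z -> direct_sum W' Z -> (mult W X <= mult W' X)%N.
Proof.
move=> Xi Wi /(@mult_le_rank X) [f [g gf]] WZ.
have [r rP] := residue_indecomposable Xi.
apply: (rank_le_mult (f := f) (g := g) (indecomposable_local Xi) rP _ WZ).
  by move=> i; exact: indecomposable_local.
move=> i j; rewrite gf; case: rP => rlin _ r1 _.
have r0 : r 0 = 0.
  by have := rlin (-1) (idm X) (idm X); rewrite scaleN1r addNr mulN1r r1 addNr.
by rewrite -[_ *: _]addr0 rlin r1 r0 addr0 mulr1.
Qed.

Lemma eq_mult_iso (I : finType) (W : I -> M) X Y :
  isomorphic X Y -> mult W X = mult W Y.
Proof.
move=> XY; apply: eq_card => i; rewrite !inE; apply/asboolP/asboolP => WX.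
  exact: isomorphic_trans WX XY.
exact: isomorphic_trans WX (isomorphic_sym XY).
Qed.

Lemma mult_unique (I J : finType) (W : I -> M) (W' : J -> M) X X' Z Z' :
  indecomposable X -> isomorphic X X' -> isomorphic Z Z' ->
  (forall i, indecomposable (W i)) -> (forall j, indecomposable (W' j)) ->
  direct_sum W Z -> direct_sum W' Z' -> mult W X = mult W' X'.
Proof.
move=> Xi XX' ZZ' Wi Wi' WZ WZ'; rewrite -(eq_mult_iso W' XX').
have {}WZ := direct_sum_iso ZZ' WZ.
by apply/eqP; rewrite eqn_leq !(@mult_le _ _ _ _ _ Z').
Qed.

Lemma cls_indecomposable (c : indec_class M) X : cls c X -> indecomposable X.
Proof. by case: (clsP c) => Y Yi -> YX; exact: indecomposable_iso YX Yi. Qed.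

Lemma cls_iso (c : indec_class M) X Y : cls c X -> cls c Y <-> isomorphic X Y.
Proof.
case: (clsP c) => Z Zi -> ZX; split=> [ZY|]; last exact: isomorphic_trans.
exact: isomorphic_trans (isomorphic_sym ZX) ZY.
Qed.

Lemma cls_ex (c : indec_class M) : exists X, cls c X.
Proof. by case: (clsP c) => X _ ->; exists X; exact: isomorphic_refl. Qed.

Lemma indec_class_of X : indecomposable X -> exists c : indec_class M, cls c X.
Proof.
move=> Xi; have cP : exists2 Y, indecomposable Y & iso_class X = iso_class Y.
  by exists X.
by exists (IndecClass cP); exact: isomorphic_refl.
Qed.

Lemma indec_class_eq (c d : indec_class M) X : cls c X -> cls d X -> c = d.
Proof.
case: c d => [c cP] [d dP] /= cX dX.
have cd : c = d.
  case: (cP) (dP) cX dX => Y _ -> [Z _ ->] YX ZX.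
  exact: isomorphic_class (isomorphic_trans YX (isomorphic_sym ZX)).
by case: d / cd dP {dX} => dP; congr IndecClass; exact: Prop_irrelevance.
Qed.

End Multiplicity.

Arguments cls_iso {k M c X Y}.

Section Action.
Variables (k : fieldType) (C : monoidal_cat k) (M : module_cat C).
Implicit Types (A B : C) (X Y Z : M).

Lemma ahomDl A A' X X' (f f' : hom A A') (g : hom X X') :
  ahom (f + f') g = ahom f g + ahom f' g.
Proof. by have := ahom_linearl 1 f f' g; rewrite !scale1r. Qed.

Lemma ahomDr A A' X X' (f : hom A A') (g g' : hom X X') :
  ahom f (g + g') = ahom f g + ahom f g'.
Proof. by have := ahom_linearr 1 f g g'; rewrite !scale1r. Qed.

Lemma ahom0l A A' X X' (g : hom X X') : ahom (0 : hom A A') g = 0.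
Proof. by apply: (addrI (ahom 0 g)); rewrite -ahomDl !addr0. Qed.

Lemma ahom0r A A' X X' (f : hom A A') : ahom f (0 : hom X X') = 0.
Proof. by apply: (addrI (ahom f 0)); rewrite -ahomDr !addr0. Qed.

Lemma ahomZl A A' X X' a (f : hom A A') (g : hom X X') :
  ahom (a *: f) g = a *: ahom f g.
Proof. by have := ahom_linearl a f 0 g; rewrite ahom0l !addr0. Qed.

Lemma ahom_sumr A A' X X' (I : finType) (f : hom A A') (g : I -> hom X X') :
  ahom f (\sum_i g i) = \sum_i ahom f (g i).
Proof. by elim/big_rec2: _ => [|i x y _ <-]; rewrite ?ahom0r ?ahomDr. Qed.

Lemma ahom_compl A A' A'' X (f' : hom A' A'') (f : hom A A') :
  ahom (f' ∘ f) (idm X) = ahom f' (idm X) ∘ ahom f (idm X).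
Proof. by rewrite -ahom_comp comp1m. Qed.

Lemma ahom_compr A X X' X'' (g' : hom X' X'') (g : hom X X') :
  ahom (idm A) (g' ∘ g) = ahom (idm A) g' ∘ ahom (idm A) g.
Proof. by rewrite -ahom_comp comp1m. Qed.

Lemma ahom_swap A A' X X' (f : hom A A') (g : hom X X') :
  ahom (idm A') g ∘ ahom f (idm X) = ahom f (idm X') ∘ ahom (idm A) g.
Proof. by rewrite -!ahom_comp !comp1m !compm1. Qed.

Lemma is_iso_ahom A A' X X' (f : hom A A') (g : hom X X') :
  is_iso f -> is_iso g -> is_iso (ahom f g).
Proof.
move=> [f' [f'f ff']] [g' [g'g gg']]; exists (ahom f' g').
by rewrite -!ahom_comp f'f ff' g'g gg' !ahom_id.
Qed.

Lemma isomorphic_aob A X X' : isomorphic X X' -> isomorphic (aob A X) (aob A X').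
Proof.
by move=> [f fI]; exists (ahom (idm A) f); apply: is_iso_ahom; first exact: is_iso_id.
Qed.

Lemma direct_sum_aob A (I : finType) (W : I -> M) Z :
  direct_sum W Z -> direct_sum (fun i => aob A (W i)) (aob A Z).
Proof.
move=> [inj [proj [p1 p2 p3]]].
exists (fun i => ahom (idm A) (inj i)), (fun i => ahom (idm A) (proj i)).
split=> [i|i j ij|]; first by rewrite -ahom_compr p1 ahom_id.
  by rewrite -ahom_compr p2 // ahom0r.
by rewrite -ahom_id -p3 ahom_sumr; apply: eq_bigr => i _; rewrite ahom_compr.
Qed.

End Action.

Section Graph.
Variables (k : closedFieldType) (C : monoidal_cat k) (M : module_cat C).
Hypothesis ks : krull_schmidt_cat M.

(** The set read by [xget] is a singleton, since multiplicities depend neither on the decomposition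
    nor on the representatives. *)
Lemma arrowsE (theta : C) (c d : indec_class M) (X : M) n (W : 'I_n -> M) :
  cls c X -> (forall i, indecomposable (W i)) -> direct_sum W (aob theta X) ->
  @arrows (Gamma M theta) c d = #|[set i | `[< cls d (W i) >]]%SET|.
Proof.
move=> cX Wi WX; have [Y dY] := cls_ex d.
have WdE : #|[set i | `[< cls d (W i) >]]%SET| = mult W Y.
  apply: eq_card => i; rewrite !inE; apply/asboolP/asboolP.
    by move/(cls_iso dY)/isomorphic_sym.
  by move/isomorphic_sym/(cls_iso dY).
apply: xget_unique => [|m].
  by exists X, Y; split=> //; exists n, W; split.
move=> [X' [Y' [cX' dY' [m' [W' [Wi' WX' <-]]]]]]; rewrite WdE.
apply: (mult_unique (Z := aob theta X') (Z' := aob theta X) ks) => //.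
- exact: cls_indecomposable dY'.
- exact/(cls_iso dY').
- exact/isomorphic_aob/(cls_iso cX').
Qed.

End Graph.

(* T may live in a universe too large for an eqType, so the values are labelled by
   representatives in 'I_n + 'I_m. *)
Lemma fiber_card_bij (T : Type) n m (c : 'I_n -> T) (c' : 'I_m -> T) :
  (forall d, #|[set i | `[< c i = d >]]%SET| = #|[set i | `[< c' i = d >]]%SET|) ->
  exists h : 'I_m -> 'I_n, bijective h /\ forall j, c' j = c (h j).
Proof.
move=> cc'; pose g (x : 'I_n + 'I_m) := match x with inl i => c i | inr j => c' j end.
pose lab x := odflt x [pick y | `[< g y = g x >]].
have labg x : g (lab x) = g x.
  by rewrite /lab; case: pickP => //= y /asboolP.
have labE x y : (lab x == lab y) = `[< g x = g y >].
  apply/eqP/asboolP => [xy|xy]; first by rewrite -labg xy labg.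
  have : [pick z | `[< g z = g x >]] = [pick z | `[< g z = g y >]].
    by apply: eq_pick => z; rewrite xy.
  rewrite /lab => <-; case: pickP => //= /(_ x); by rewrite asboolT.
pose s := [tuple lab (inl i) | i < n]; pose t := [tuple lab (inr i) | i < m].
have st : perm_eq s t.
  apply/allP => l _ /=; apply/eqP.
  have cnt p (h : 'I_p -> 'I_n + 'I_m) : count_mem l [seq h i | i <- enum 'I_p] =
      #|[set i | h i == l]%SET|.
    rewrite count_map cardE -size_filter -filter_predI; congr size.
    by apply: eq_filter => i; rewrite !inE andbT.
  rewrite !cnt; have [/existsP [z /eqP zl]|/existsPn nz] := boolP [exists z, lab z == l].
    rewrite -zl; transitivity (#|[set i | `[< c i = g z >]]%SET|).
      by apply: eq_card => i; rewrite !inE labE.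
    by rewrite cc'; apply: eq_card => i; rewrite !inE labE.
  by rewrite !eq_card0 // => i; rewrite inE (negPf (nz _)).
have nm : n = m by have := perm_size st; rewrite !size_tuple.
move: cc' @g @lab labg labE @s @t st; case: m / nm c' => c' _ g lab _ labE s t.
rewrite perm_sym => /tuple_permP [q tE]; exists q; split.
  by exists (q^-1)%g => i; rewrite ?permK ?permKV.
move=> j; have := congr1 (fun u => nth (lab (inl j)) u j) tE.
rewrite -!tnth_nth tnth_mktuple /s /t !tnth_mktuple => /eqP.
by rewrite labE => /asboolP.
Qed.

(** * Transport of decompositions along a graph isomorphism *)

Section Matched.
Variables (k : closedFieldType) (C : monoidal_cat k) (M N : module_cat C).
Hypotheses (ksM : krull_schmidt_cat M) (ksN : krull_schmidt_cat N).
Variables (theta : C) (phi : indec_class M -> indec_class N).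
Hypothesis phi_bij : bijective phi.
Hypothesis phi_arrows : forall c d,
  @arrows (Gamma N theta) (phi c) (phi d) = @arrows (Gamma M theta) c d.

(** This relation turns path counting into an induction: applying [theta] preserves it, and it
    forces equal multiplicities of corresponding indecomposables. *)
Definition matched (Z : M) (Z' : N) : Prop :=
  exists (I : finType) (W : I -> M) (W' : I -> N) (c : I -> indec_class M),
    [/\ direct_sum W Z, direct_sum W' Z', forall i, cls (c i) (W i)
      & forall i, cls (phi (c i)) (W' i)].

(** Equal arrow counts say that the two families of classes have fibres of equal size, so one
    decomposition can be reindexed by the other. *)
Lemma matched_theta_indecomposable c X X' :
  cls c X -> cls (phi c) X' -> matched (aob theta X) (aob theta X').
Proof.
move=> cX cX'; have [psi phiK psiK] := phi_bij.
have [ks1 _ _] := ksM; have [n [W [Wi WX]]] := ks1 (aob theta X).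
have [ks2 _ _] := ksN; have [m [W' [Wi' WX']]] := ks2 (aob theta X').
have [a aP] := choice (fun i => indec_class_of (Wi i)).
have [b bP] := choice (fun i => indec_class_of (Wi' i)).
have [d|h [hb hE]] := @fiber_card_bij _ _ _ (fun i => phi (a i)) b.
  transitivity (@arrows (Gamma M theta) c (psi d)).
    rewrite (arrowsE ksM (psi d) cX Wi WX); apply: eq_card => i; rewrite !inE.
    apply/asboolP/asboolP => [<-|da]; first by rewrite phiK.
    by rewrite (indec_class_eq (aP i) da) psiK.
  rewrite -phi_arrows psiK (arrowsE ksN d cX' Wi' WX'); apply: eq_card => i.
  rewrite !inE; apply/asboolP/asboolP => [db|<- //].
  exact: (indec_class_eq (bP i) db).
exists 'I_m, (fun j => W (h j)), W', (fun j => a (h j)); split=> //.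
- exact: direct_sum_reindex.
- by move=> j; rewrite -hE.
Qed.

Lemma matched_theta Z Z' : matched Z Z' -> matched (aob theta Z) (aob theta Z').
Proof.
move=> [I [W [W' [c [WZ WZ' cW cW']]]]].
have mi i : matched (aob theta (W i)) (aob theta (W' i)).
  exact: matched_theta_indecomposable (cW i) (cW' i).
have [J /dep_choice [V /dep_choice [V' /dep_choice [d dP]]]] := dep_choice mi.
exists {i : I & J i}, (fun x => V (tag x) (tagged x)).
exists (fun x => V' (tag x) (tagged x)), (fun x => d (tag x) (tagged x)).
split=> [| |[i j]|[i j]] /=; [| |by case: (dP i)..].
- by apply: direct_sum_sigma (direct_sum_aob theta WZ) _ => i; case: (dP i).
- by apply: direct_sum_sigma (direct_sum_aob theta WZ') _ => i; case: (dP i).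
Qed.

Lemma matched_iter c X X' n : cls c X -> cls (phi c) X' ->
  matched (iter n (aob theta) X) (iter n (aob theta) X').
Proof.
move=> cX cX'; elim: n => [|n IHn] /=; last exact: matched_theta.
exists 'I_1, (fun=> X), (fun=> X'), (fun=> c).
by split=> //; exact: direct_sum1.
Qed.

End Matched.

(** * Coherence and mates *)

Section Cancel.
Variables (k : fieldType) (M : lin_cat k).
Implicit Types X Y Z T : M.

Lemma comp_reassoc X Y Z T (g : hom Y Z) (f : hom X Y) (u : hom X Z) :
  g ∘ f = u -> forall h : hom T X, g ∘ (f ∘ h) = u ∘ h.
Proof. by move=> <- h; rewrite compA. Qed.

Lemma iso_epi X Y Z (f : hom X Y) (g g' : hom Y Z) :
  is_iso f -> g ∘ f = g' ∘ f -> g = g'.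
Proof.
by move=> [u [_ fu]] gf; rewrite -(compm1 g) -fu compA gf -compA fu compm1.
Qed.

Lemma iso_mono X Y Z (f : hom Y Z) (g g' : hom X Y) :
  is_iso f -> f ∘ g = f ∘ g' -> g = g'.
Proof.
by move=> [u [uf _]] fg; rewrite -(comp1m g) -uf -compA fg compA uf comp1m.
Qed.

End Cancel.

Section Coherence.
Variables (k : fieldType) (C : monoidal_cat k) (M : module_cat C).
Implicit Types (A B V W D : C) (X Y Z : M).

(** The module version of Kelly's derived unit law: after acting by [tunit], which loses nothing by
    naturality of [alambda], the identity follows from the pentagon and the triangles. *)
Lemma alambda_aalpha V X :
  alambda (aob V X) ∘ aalpha tunit V X = ahom (lambda V) (idm X).
Proof.
apply: (iso_epi (alambda_iso _)); rewrite -!alambda_nat; congr (_ ∘ _).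
have I : is_iso (aalpha tunit (tob tunit V) X ∘ ahom (alpha tunit tunit V) (idm X)).
  by apply: is_iso_comp; [exact: aalpha_iso
    |exact/is_iso_ahom/is_iso_id/alpha_iso].
apply: (iso_epi I).
rewrite ahom_compr compA -2!(compA (ahom (idm tunit) (alambda _))) compA.
rewrite -(compA (ahom (idm tunit) (alambda _))) -apentagon compA atriangle.
rewrite compA -aalpha_nat -compA -ahom_compl triangle aalpha_nat.
by rewrite ahom_id.
Qed.

(** The zigzag identity for W, with source [tob tunit W] so that no unitor has to be inverted. *)
Definition is_dual W D (ev : hom (tob D W) tunit) (coev : hom tunit (tob W D)) :=
  rho W ∘ thom (idm W) ev ∘ alpha W D W ∘ thom coev (idm W) = lambda W.

(** Transposition along the duality, from Hom(D V, 1) to Hom(V, W), up to the left unitor of V. *)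
Definition mate V W D (coev : hom tunit (tob W D)) (phi : hom (tob D V) tunit) :
    hom (tob tunit V) W :=
  rho W ∘ thom (idm W) phi ∘ alpha W D V ∘ thom coev (idm V).

Lemma mate_dual V W D (ev : hom (tob D W) tunit) coev (f : hom V W) :
  is_dual ev coev -> mate coev (ev ∘ thom (idm D) f) = f ∘ lambda V.
Proof.
move=> WD; rewrite -lambda_nat -WD /mate -[in LHS](comp1m (idm W)) thom_comp.
rewrite -!compA; do 2!congr (_ ∘ _); rewrite !compA -alpha_nat -!compA.
by congr (_ ∘ _); rewrite -!thom_comp thom_id !comp1m !compm1.
Qed.

(* The action on X of the mate of phi factors through g as soon as phi is the
   transpose of g; K depends on W and X only. *)
Lemma ahom_mate W D X coev (ev : hom (tob D W) tunit) :
  exists K : hom (aob tunit (aob W X)) (aob W X),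
  forall V (phi : hom (tob D V) tunit) (g : hom (aob V X) (aob W X)) u,
    aalpha D W X ∘ u = ahom (idm D) g ∘ aalpha D V X ->
    ahom phi (idm X) = ahom ev (idm X) ∘ u ->
    ahom (mate coev phi) (idm X) =
    K ∘ ahom (idm tunit) g ∘ aalpha tunit V X.
Proof.
have [ai [ai1 ai2]] := aalpha_iso D W X.
exists (ahom (idm W) (alambda X ∘ ahom ev (idm X) ∘ ai) ∘ aalpha W D (aob W X)
        ∘ ahom coev (idm (aob W X))) => V phi g u uE phiE.
have {uE}uE : u = ai ∘ (ahom (idm D) g ∘ aalpha D V X).
  by rewrite -uE compA ai1 comp1m.
rewrite {}uE in phiE.
rewrite /mate !ahom_compl -atriangle -!compA.
rewrite (comp_reassoc (aalpha_nat _ _ _)) -compA.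
rewrite (compA (ahom (idm W) (alambda X))) -ahom_compr phiE.
rewrite !ahom_compr -!compA; do 3!congr (_ ∘ _).
have pent T (h : hom T _) : ahom (idm W) (aalpha D V X) ∘ (aalpha W (tob D V) X ∘
    (ahom (alpha W D V) (idm X) ∘ h)) =
    aalpha W D (aob V X) ∘ (aalpha (tob W D) V X ∘ h).
  by rewrite !compA apentagon.
rewrite pent aalpha_nat ahom_id (comp_reassoc (esym (aalpha_nat _ _ _))) -!compA.
by congr (_ ∘ _); rewrite !compA thom_id ahom_swap.
Qed.

(** As K in [ahom_mate] is independent of V, phi and g, it can be computed from the case g = id, phi
    = [ev], where the mate is the left unitor; this gives K = [alambda]. *)
Lemma mate_ahom W D X coev (ev : hom (tob D W) tunit) V
    (phi : hom (tob D V) tunit) (g : hom (aob V X) (aob W X)) u :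
  is_dual ev coev ->
  aalpha D W X ∘ u = ahom (idm D) g ∘ aalpha D V X ->
  ahom phi (idm X) = ahom ev (idm X) ∘ u ->
  ahom (mate coev phi) (idm X) = g ∘ ahom (lambda V) (idm X).
Proof.
move=> WD uE phiE; have [K KP] := ahom_mate X coev ev.
have KE : K = alambda (aob W X).
  have := KP W ev (idm _) (idm _); rewrite !compm1 !ahom_id !comp1m compm1 => /(_ erefl erefl).
  rewrite /mate WD -alambda_aalpha => /(iso_epi (aalpha_iso _ _ _)) //.
by rewrite (KP _ _ _ _ uE phiE) KE alambda_nat -compA alambda_aalpha.
Qed.

End Coherence.

(** * Recognition of the regular module category *)

Section TensorPowers.
Variables (k : fieldType) (C : monoidal_cat k) (F : C).

Definition tpow n : C := iter n (tob F) tunit.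

(** Finite sums of composites through tensor powers of F. For the identity of B this expresses that
    B is a direct summand of a sum of tensor powers. *)
Inductive tgenerated (A B : C) : hom A B -> Prop :=
| tgenerated0 : tgenerated 0
| tgeneratedD n (g : hom (tpow n) B) (h : hom A (tpow n)) f :
    tgenerated f -> tgenerated (g ∘ h + f).

End TensorPowers.

Section Recognition.
Variables (k : closedFieldType) (C : monoidal_cat k) (F : C).
Hypothesis ksC : krull_schmidt_cat (regular C).
Hypothesis splitC : idempotent_split C.
Hypothesis biprodC : forall A B : C, exists (S : C) (iA : hom A S) (iB : hom B S)
  (pA : hom S A) (pB : hom S B), [/\ pA ∘ iA = idm A, pB ∘ iB = idm B,
    pA ∘ iB = 0 & pB ∘ iA = 0].
Hypothesis sectionC : forall (V : C) (f : hom V tunit), f != 0 ->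
  exists s : hom tunit V, f ∘ s = idm tunit.
Hypothesis dualC : forall W : C, exists (D : C) (ev : hom (tob D W) tunit)
  (coev : hom tunit (tob W D)), is_dual ev coev.
Hypothesis tgenC : forall B : C, tgenerated F (idm B).

Variable M : module_cat C.
Hypothesis ksM : krull_schmidt_cat M.
Hypothesis simpleM : simple_module_cat M.
Variable phi : indec_class M -> indec_class (regular C).
Hypothesis phi_bij : bijective phi.
Hypothesis phi_arrows : forall c d,
  @arrows (Gamma (regular C) F) (phi c) (phi d) = @arrows (Gamma M F) c d.
Variables (c : indec_class M) (X : M).
Hypotheses (cX : cls c X) (phi_c : cls (phi c) (tunit : regular C)).
Variable r : hom X X -> k.
Hypothesis rP : residue_char r.
Implicit Types (A B V W D : C) (Y Z : M).

Let Xl : local_end X.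
Proof. exact: (indecomposable_local ksM (cls_indecomposable ksM cX)). Qed.

Let rD f g : r (f + g) = r f + r g.
Proof. by case: rP => rlin _ _ _; have := rlin 1 f g; rewrite scale1r mul1r. Qed.

Let r0 : r 0 = 0.
Proof. by have := rD 0 0; rewrite addr0 => /esym/eqP; rewrite -subr_eq0 addrK => /eqP. Qed.

Let rZ a f : r (a *: f) = a * r f.
Proof. by case: rP => rlin _ _ _; have := rlin a f 0; rewrite !addr0 r0 addr0. Qed.

Let rB f g : r (f - g) = r f - r g.
Proof. by rewrite -scaleN1r rD rZ mulN1r. Qed.

Let r_sum (I : finType) (f : I -> hom X X) : r (\sum_i f i) = \sum_i r (f i).
Proof. exact: (big_morph r rD r0). Qed.

Let r1 : r (idm X) = 1. Proof. by case: rP. Qed.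

(** Membership in the radical of the category, tested on the residue of X. *)
Definition radical_map Z (f : hom Z X) : Prop := forall a : hom X Z, r (f ∘ a) = 0.

(** The comparison map from Hom(V, 1) in [C] to Hom(V X, X) in [M], whose surjectivity is the
    crux. *)
Definition unit_map V (f : hom V tunit) : hom (aob V X) X :=
  alambda X ∘ ahom f (idm X).

Lemma unit_map0 V : unit_map (0 : hom V _) = 0.
Proof. by rewrite /unit_map ahom0l compm0. Qed.

Lemma unit_mapD V (f g : hom V tunit) : unit_map (f + g) = unit_map f + unit_map g.
Proof. by rewrite /unit_map ahomDl compDr. Qed.

Lemma unit_mapZ V a (f : hom V tunit) : unit_map (a *: f) = a *: unit_map f.
Proof. by rewrite /unit_map ahomZl compZr. Qed.

Lemma unit_map_comp V W (f : hom W tunit) (g : hom V W) :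
  unit_map (f ∘ g) = unit_map f ∘ ahom g (idm X).
Proof. by rewrite /unit_map ahom_compl compA. Qed.

Lemma aob_tpow n Y : isomorphic (aob (tpow F n) Y) (iter n (aob F) Y).
Proof.
elim: n => [|n IHn] /=; first by exists (alambda Y); exact: alambda_iso.
apply: isomorphic_trans (isomorphic_aob F IHn).
by exists (aalpha F (tpow F n) Y); exact: aalpha_iso.
Qed.

(* The d maps b i come from C and form, with the a i, a nondegenerate d x d block
   of the pairing (f, u) |-> r (f u), whose rank is at most the multiplicity d of
   X; so subtracting their span makes f radical. *)
Lemma tpow_unit_map n (f : hom (aob (tpow F n) X) X) :
  exists g : hom (tpow F n) tunit, radical_map (f - unit_map g).
Proof.
have [I [W [W' [d [WZ WZ' dW dW']]]]] :=
  matched_iter ksM ksC phi_bij phi_arrows n cX phi_c.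
have {}WZ := direct_sum_iso (isomorphic_sym (aob_tpow n X)) WZ.
have multE : mult W X = mult W' (tunit : regular C).
  apply: eq_card => i; rewrite !inE; apply/asboolP/asboolP => [WX|WT].
    have cW : cls c (W i) by apply/(cls_iso cX); exact: isomorphic_sym.
    apply/isomorphic_sym/(cls_iso phi_c).
    by rewrite -(indec_class_eq (dW i) cW).
  have cW : cls (phi c) (W' i) by apply/(cls_iso phi_c); exact: isomorphic_sym.
  have /(bij_inj phi_bij) dc := indec_class_eq (dW' i) cW.
  by apply/isomorphic_sym/(cls_iso cX); rewrite -dc.
have [a [b ba]] := mult_le_rank (tunit : regular C) WZ'; rewrite -multE in a b ba *.
have [li [li1 li2]] := alambda_iso X.
pose A i : hom X (aob (tpow F n) X) := ahom (a i : hom tunit (tpow F n)) (idm X) ∘ li.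
pose B i := unit_map (b i : hom (tpow F n) tunit).
have BA i j : B i ∘ A j = (i == j)%:R *: idm X.
  rewrite /A /B /unit_map -compA [X in _ ∘ X]compA -ahom_compl.
  have -> : (b i : hom (tpow F n) tunit) ∘ (a j : hom tunit (tpow F n)) =
    (i == j)%:R *: idm tunit by exact: ba.
  by rewrite ahomZl ahom_id !compZl compZr comp1m li2.
exists (\sum_i r (f ∘ A i) *: b i).
have -> : unit_map (\sum_i r (f ∘ A i) *: b i) = \sum_i r (f ∘ A i) *: B i.
  elim/big_rec2: _ => [|i x y _ <-]; first exact: unit_map0.
  by rewrite unit_mapD unit_mapZ.
set f' := f - _ => u; apply/eqP/negPn/negP => fu0.
have f'A j : r (f' ∘ A j) = 0.
  rewrite /f' compBl rB comp_suml r_sum (bigD1 j) //= big1 ?addr0.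
    by rewrite compZl BA eqxx rZ rZ mul1r r1 mulr1 subrr.
  by move=> i ij; rewrite compZl BA (negPf ij) scale0r scaler0 r0.
(* Were f' not radical on u, then u, made orthogonal to all B i and rescaled, would enlarge the dual
   system by the pair (f', v), giving one more copy of X than the multiplicity allows. The new pair
   takes the index [ord_max]. *)
pose v := (r (f' ∘ u))^-1 *: (u - \sum_i r (B i ∘ u) *: A i).
have Bv j : r (B j ∘ v) = 0.
  rewrite /v compZr rZ compBr rB comp_sumr r_sum (bigD1 j) //= big1 ?addr0.
    by rewrite compZr BA eqxx rZ rZ mul1r r1 mulr1 subrr mulr0.
  by move=> i ij; rewrite compZr BA eq_sym (negPf ij) scale0r scaler0 r0.
have f'v : r (f' ∘ v) = 1.
  rewrite /v compZr rZ compBr rB comp_sumr r_sum big1 ?subr0 ?mulVf //.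
  by move=> i _; rewrite compZr rZ f'A mulr0.
suff : (mult W X < mult W X)%N by rewrite ltnn.
apply: (@rank_le_mult _ _ X r _ W _ _
  (fun s => if unlift ord_max s is Some i then A i else v)
  (fun s => if unlift ord_max s is Some i then B i else f') Xl rP _ WZ).
  by move=> i; exact: (indecomposable_local ksM (cls_indecomposable ksM (dW i))).
move=> s t; case: (unliftP ord_max s) => [i|] ->; case: (unliftP ord_max t) => [j|] ->.
- by rewrite BA rZ r1 mulr1 (inj_eq lift_inj).
- by rewrite Bv eq_sym eq_liftF.
- by rewrite f'A eq_liftF.
- by rewrite f'v eqxx.
Qed.

Lemma radical_map0 Z : radical_map (0 : hom Z X).
Proof. by move=> a; rewrite comp0m. Qed.

Lemma radical_mapD Z (f g : hom Z X) :
  radical_map f -> radical_map g -> radical_map (f + g).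
Proof. by move=> fR gR a; rewrite compDl rD fR gR addr0. Qed.

Lemma radical_map_comp Y Z (f : hom Z X) (g : hom Y Z) :
  radical_map f -> radical_map (f ∘ g).
Proof. by move=> fR a; rewrite -compA. Qed.

(** Each term of the presentation of the identity of B factors through a tensor power, where
    [tpow_unit_map] applies. *)
Lemma unit_map_radical B (f : hom (aob B X) X) :
  exists g : hom B tunit, radical_map (f - unit_map g).
Proof.
rewrite -[f]compm1 -ahom_id; elim: (tgenC B) => [|n g h e _ [e' fe]].
  exists 0; rewrite unit_map0 ahom0l compm0 subr0; exact: radical_map0.
have [g' fg] := tpow_unit_map (f ∘ ahom g (idm X)).
exists (g' ∘ h + e'); rewrite ahomDl ahom_compl compDr unit_mapD unit_map_comp.
rewrite opprD addrACA compA -compBl; apply: radical_mapD => //.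
exact: radical_map_comp.
Qed.

Let I Y Z (f : hom Y Z) : Prop := forall B (a : hom X (aob B Y)) (b : hom (aob B Z) X),
  r (b ∘ ahom (idm B) f ∘ a) = 0.

(** By simplicity the ideal [I] is zero or everything; taking B = [tunit] and the unitor with its
    inverse for b and a shows that it misses the identity of X. *)
Lemma radical_ideal_zero Y Z (f : hom Y Z) : I f -> f = 0.
Proof.
have stI : stable_ideal (@I).
  split=> [Y' Z' B a b|Y' Z' s g h Ig Ih B a b|T Y' Z' g h Ih B a b|
           T Y' Z' g h Ig B a b|A Y' Z' g Ig B a b].
  - by rewrite ahom0r compm0 comp0m.
  - by rewrite ahom_linearr compDr compZr compDl compZl rD rZ Ig Ih mulr0 addr0.
  - by rewrite ahom_compr compA.
  - by rewrite ahom_compr compA -compA.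
  - have [ai [ai1 ai2]] := aalpha_iso B A Y'.
    have := Ig (tob B A) (ai ∘ a) (b ∘ aalpha B A Z').
    rewrite -thom_id -(compA b) aalpha_nat -!compA (comp_reassoc ai2) comp1m.
    by rewrite !compA.
have [_ /(_ _ stI) [I0|I1]] := simpleM; first exact: I0.
have [li [li1 li2]] := alambda_iso X.
have /eqP := I1 X X (idm X) tunit li (alambda X).
by rewrite ahom_id compm1 li2 r1 oner_eq0.
Qed.

(* Only b needs to be replaced by a morphism b0 of C, past which f commutes. *)
Lemma radical_map_zero V (f : hom (aob V X) X) : radical_map f -> f = 0.
Proof.
move=> fR; apply: radical_ideal_zero => B a b.
have [b0 bR] := unit_map_radical b.
have -> : b = (b - unit_map b0) + unit_map b0 by rewrite subrK.
move: (b - _) bR => b' bR.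
rewrite !compDl rD -(compA b') bR add0r /unit_map -(compA (alambda X)).
by rewrite -ahom_swap compA alambda_nat -!compA fR.
Qed.

Lemma unit_map_full V (f : hom (aob V X) X) : exists g, f = unit_map g.
Proof.
have [g /radical_map_zero/eqP] := unit_map_radical f.
by rewrite subr_eq0 => /eqP; exists g.
Qed.

(** By duality g becomes a morphism (D V) X -> X, which comes from [C] by [unit_map_full]; the mate
    of that morphism acts as g. *)
Lemma action_full V W (g : hom (aob V X) (aob W X)) :
  exists f : hom V W, g = ahom f (idm X).
Proof.
have [D [ev [coev WD]]] := dualC W.
have [ai [ai1 ai2]] := aalpha_iso D W X.
pose u := ai ∘ (ahom (idm D) g ∘ aalpha D V X).
have uE : aalpha D W X ∘ u = ahom (idm D) g ∘ aalpha D V X.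
  by rewrite /u compA ai2 comp1m.
have [phi' phiE] := unit_map_full (unit_map ev ∘ u).
have [li [li1 li2]] := lambda_iso V.
exists (mate coev phi' ∘ li); rewrite ahom_compl (mate_ahom WD uE) -?compA.
  by rewrite -ahom_compl li2 ahom_id compm1.
by apply: (iso_mono (alambda_iso X)); rewrite compA; exact: esym.
Qed.

(** If h acts by zero, so does its transpose DV -> 1. A nonzero transpose would have a section,
    making the identity of X zero; hence the transpose vanishes, and h with it. *)
Lemma action_faithful V W (f g : hom V W) :
  ahom f (idm X) = ahom g (idm X) -> f = g.
Proof.
move=> fg; apply/eqP; rewrite -subr_eq0.
have : ahom (f - g) (idm X) = 0.
  by rewrite -scaleN1r ahomDl ahomZl fg scaleN1r subrr.
move: (f - g) => {f g fg}h hX; apply/eqP.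
have [D [ev [coev WD]]] := dualC W.
have h'X : ahom (ev ∘ thom (idm D) h) (idm X) = 0.
  rewrite ahom_compl.
  have [ai [ai1 ai2]] := aalpha_iso D W X.
  rewrite -(comp1m (ahom (thom _ _) _)) -ai1 -(compA ai) aalpha_nat hX.
  by rewrite ahom0r !(comp0m, compm0).
apply: (iso_epi (lambda_iso V)); rewrite -(mate_dual h WD) comp0m.
have -> : ev ∘ thom (idm D) h = 0; last first.
  have t0 : thom (idm W) (0 : hom (tob D V) tunit) = 0.
    exact: (ahom0r (M := regular C)).
  by rewrite /mate t0 compm0 !comp0m.
apply/eqP/negPn/negP => /sectionC [s hs].
case: Xl => X0 _; apply: X0; rewrite /is_zero.
have [li [li1 li2]] := alambda_iso X.
rewrite -li2 -(comp1m li) -ahom_id -hs ahom_compl h'X.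
by rewrite comp0m comp0m compm0.
Qed.

(** The morphisms factoring through some B X form a stable ideal, closed under sums thanks to
    biproducts, that contains the identity of X. So Y is a retract of some B X; fullness and
    faithfulness lift the resulting idempotent to B, where it splits. *)
Lemma aob_essentially_surjective Y :
  exists V (f : hom (aob V X) Y) (g : hom Y (aob V X)),
    g ∘ f = idm _ /\ f ∘ g = idm _.
Proof.
pose J Y Z (f : hom Y Z) : Prop := exists B (h : hom Y (aob B X)) (g : hom (aob B X) Z),
  f = g ∘ h.
have stJ : stable_ideal J.
  split=> [Y' Z|Y' Z a f f' [B [h [g ->]]] [B' [h' [g' ->]]]|
           Y' Z T u f [B [h [g ->]]]|Y' Z T u f [B [h [g ->]]]|A Y' Z f [B [h [g ->]]]].
  - by exists tunit, 0, 0; rewrite comp0m.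
  - have [S [iA [iB [pA [pB [p1 p2 p3 p4]]]]]] := biprodC B B'.
    exists S, (ahom iA (idm X) ∘ (a *: h) + ahom iB (idm X) ∘ h').
    exists (g ∘ ahom pA (idm X) + g' ∘ ahom pB (idm X)).
    have q1 : ahom pA (idm X) ∘ ahom iA (idm X) = idm _ by rewrite -ahom_compl p1 ahom_id.
    have q2 : ahom pB (idm X) ∘ ahom iB (idm X) = idm _ by rewrite -ahom_compl p2 ahom_id.
    have q3 : ahom pA (idm X) ∘ ahom iB (idm X) = 0 by rewrite -ahom_compl p3 ahom0l.
    have q4 : ahom pB (idm X) ∘ ahom iA (idm X) = 0 by rewrite -ahom_compl p4 ahom0l.
    rewrite compDr !compDl -!compA (comp_reassoc q1) (comp_reassoc q2) (comp_reassoc q3).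
    by rewrite (comp_reassoc q4) !comp0m !compm0 !comp1m addr0 add0r compZr.
  - by exists B, h, (u ∘ g); rewrite compA.
  - by exists B, (h ∘ f), g; rewrite compA.
  - have [ai [ai1 ai2]] := aalpha_iso A B X.
    exists (tob A B), (ai ∘ ahom (idm A) h), (ahom (idm A) g ∘ aalpha A B X).
    by rewrite -compA (comp_reassoc ai2) comp1m ahom_compr.
have [_ /(_ _ stJ) [J0|J1]] := simpleM.
  have [li [li1 li2]] := alambda_iso X.
  case: Xl => X0 _; case: X0; apply: (J0 X X).
  by exists tunit, li, (alambda X); rewrite li2.
have [B [h [g /esym gh]]] := J1 Y Y (idm Y).
have [e eX] := action_full (h ∘ g).
have ee : e ∘ e = e.
  apply: action_faithful; rewrite ahom_compl -eX.
  by rewrite compA -(compA h) gh compm1.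
have [V [p [i [ip pi]]]] := splitC ee.
exists V, (g ∘ ahom i (idm X)), (ahom p (idm X) ∘ h); split.
  rewrite compA -(compA _ h) eX -!ahom_compl -ip.
  by rewrite !compA pi comp1m pi ahom_id.
by rewrite compA -(compA g) -ahom_compl ip -eX compA gh comp1m gh.
Qed.

(** A quasi-inverse of V |-> V X is chosen: [th] and [ti] are the mutually inverse comparison maps
    with Y, and [lift] inverts the action on morphisms. *)
Let obj Y := projT1 (cid (aob_essentially_surjective Y)).
Let exY Y := projT2 (cid (aob_essentially_surjective Y)).
Let th Y : hom (aob (obj Y) X) Y := projT1 (cid (exY Y)).
Let exth Y := projT2 (cid (exY Y)).
Let ti Y : hom Y (aob (obj Y) X) := projT1 (cid (exth Y)).
Let tith Y : ti Y ∘ th Y = idm _. Proof. exact: proj1 (projT2 (cid (exth Y))). Qed.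
Let thti Y : th Y ∘ ti Y = idm _. Proof. exact: proj2 (projT2 (cid (exth Y))). Qed.
Let lift V W (g : hom (aob V X) (aob W X)) : hom V W := projT1 (cid (action_full g)).
Let liftE V W (g : hom (aob V X) (aob W X)) : ahom (lift g) (idm X) = g.
Proof. exact: esym (projT2 (cid (action_full g))). Qed.

Let fmap Y Z (f : hom Y Z) : hom (obj Y) (obj Z) := lift (ti Z ∘ f ∘ th Y).

Let fmapE Y Z (f : hom Y Z) : ahom (fmap f) (idm X) = ti Z ∘ f ∘ th Y.
Proof. exact: liftE. Qed.

Let fmap_id Y : fmap (idm Y) = idm (obj Y).
Proof. by apply: action_faithful; rewrite liftE ahom_id compm1 tith. Qed.

Let fmap_comp Y Z T (g : hom Z T) (f : hom Y Z) : fmap (g ∘ f) = fmap g ∘ fmap f.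
Proof.
apply: action_faithful; rewrite ahom_compl !liftE.
by rewrite !compA -(compA _ (th Z)) thti compm1.
Qed.

Let fmap_linear Y Z a (f g : hom Y Z) : fmap (a *: f + g) = a *: fmap f + fmap g.
Proof.
apply: action_faithful; rewrite ahom_linearl !liftE.
by rewrite comp_linearr comp_linearl.
Qed.

Let Phi : lin_functor M (regular C) :=
  @LinFunctor k M (regular C) obj fmap fmap_id fmap_comp fmap_linear.

Let Psi : lin_functor (regular C) M.
Proof.
refine (@LinFunctor k (regular C) M (fun V : C => aob V X)
  (fun (V W : C) (f : hom V W) => ahom f (idm X)) _ _ _).
- by move=> V; exact: ahom_id.
- by move=> V W U f g; exact: ahom_compl.
- by move=> V W a f g; exact: ahom_linearl.
Defined.

Let lift_iso V W (g : hom (aob V X) (aob W X)) : is_iso g -> is_iso (lift g).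
Proof.
move=> [g' [g'g gg']]; exists (lift g').
by split; apply: action_faithful; rewrite ahom_compl !liftE ahom_id.
Qed.

Let Phi_equivalence : is_equivalence Phi.
Proof.
exists Psi, th, (fun V : C => lift (th (aob V X))); split.
- by move=> Y; exists (ti Y); split; [exact: tith|exact: thti].
- by move=> V; apply: lift_iso; exists (ti (aob V X)); split; [exact: tith|exact: thti].
- by move=> Y Z f /=; rewrite liftE !compA thti comp1m.
- move=> V W f; apply: action_faithful; rewrite !ahom_compl !liftE /=.
  by rewrite !compA thti comp1m.
Qed.

(** The lift of the canonical isomorphism through A Y and A (obj Y X). The coherence laws are then
    verified after acting on X, which is enough by faithfulness. *)
Let str A Y : hom (obj (aob A Y)) (tob A (obj Y)) :=
  lift (projT1 (cid (aalpha_iso A (obj Y) X)) ∘ ahom (idm A) (ti Y) ∘ th (aob A Y)).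

Let strE A Y : aalpha A (obj Y) X ∘ ahom (str A Y) (idm X) =
  ahom (idm A) (ti Y) ∘ th (aob A Y).
Proof.
by rewrite liftE; case: cid => /= ai [_ ai2]; rewrite -!compA (comp_reassoc ai2) comp1m.
Qed.

Let str_iso A Y : @is_iso _ (regular C) _ _ (str A Y).
Proof.
apply: lift_iso; do 2?[apply: is_iso_comp]; last by exists (ti (aob A Y)); split; [exact: tith|exact: thti].
  by case: cid => /= ai [ai1 ai2]; exists (aalpha A (obj Y) X).
by apply: is_iso_ahom; [exact: is_iso_id | exists (th Y); split; [exact: thti|exact: tith]].
Qed.

Let str_nat A A' Y Y' (f : hom A A') (g : hom Y Y') :
  str A' Y' ∘ fmap (ahom f g) = thom f (fmap g) ∘ str A Y.
Proof.
apply: action_faithful; apply: (iso_mono (aalpha_iso _ _ _)).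
rewrite !ahom_compl !compA strE aalpha_nat -!compA strE !liftE.
rewrite -!compA (comp_reassoc (thti _)) comp1m !compA -!ahom_comp comp1m.
by rewrite compm1 -compA thti compm1.
Qed.

Let str_assoc A B Y :
  alpha A B (obj Y) ∘ str (tob A B) Y =
  thom (idm A) (str B Y) ∘ str A (aob B Y) ∘ fmap (aalpha A B Y).
Proof.
apply: action_faithful.
have aI : is_iso (ahom (idm A) (aalpha B (obj Y) X) ∘ aalpha A (tob B (obj Y)) X).
  by apply: is_iso_comp; [apply: is_iso_ahom; [exact: is_iso_id|]|]; exact: aalpha_iso.
apply: (iso_mono aI).
transitivity (ahom (idm A) (ahom (idm B) (ti Y)) ∘ aalpha A B Y ∘ th (aob (tob A B) Y)).
  by rewrite !ahom_compl compA -apentagon -compA strE compA -thom_id aalpha_nat.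
rewrite !ahom_compl -!compA (comp_reassoc (aalpha_nat _ _ _)) -!compA.
rewrite (comp_reassoc (strE _ _)) fmapE -!compA (comp_reassoc (thti _)) comp1m.
rewrite (compA (ahom _ _) (ahom _ _)) -ahom_compr strE ahom_compr -!compA.
by rewrite (compA (ahom (idm A) (th _))) -ahom_compr thti ahom_id comp1m.
Qed.

Let str_unit Y : lambda (obj Y) ∘ str tunit Y = fmap (alambda Y).
Proof.
apply: action_faithful; rewrite ahom_compl fmapE -alambda_aalpha -compA strE.
by rewrite !compA alambda_nat.
Qed.

Lemma module_equivalent_regular : module_equivalent M (regular C).
Proof.
by exists (@ModuleFunctor k C M (regular C) Phi str str_iso str_nat str_assoc str_unit);
  exact: Phi_equivalence.
Qed.

End Recognition.

(** * The Casimir operator *)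

Section Elementary.
Variable k : numClosedFieldType.

Let three_neq0 : 3%:R != 0 :> k. Proof. by rewrite pnatr_eq0. Qed.

Fact elem_proof (i j : 'I_3) :
  delta_mx i j - (3%:R^-1 *+ (i == j))%:M \in @traceless k.
Proof.
rewrite inE raddfB /= mxtrace_scalar /mxtrace (bigD1 i) //= big1 ?addr0.
  rewrite !mxE eqxx /=; case: (i == j); last by rewrite mul0rn subrr.
  by rewrite mulr1n -[_ *+ 3]mulr_natr mulVf // subrr.
by move=> l /negPf li; rewrite !mxE li.
Qed.

(** The matrix unit projected from gl3 to sl3 along the scalars. It obeys the commutation rules of
    gl3 uniformly in i and j, at the price of the relation that the diagonal ones sum to 0. *)
Definition elem (i j : 'I_3) : sl3 k := Sl3 (elem_proof i j).

Lemma bracket_elem i j l m : bracket (elem i j) (elem l m) =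
  (j == l)%:R *: elem i m - (m == i)%:R *: elem l j.
Proof.
have comm_scalar (P Q : 'M[k]_3) a b :
    (P - a%:M) *m (Q - b%:M) - (Q - b%:M) *m (P - a%:M) = P *m Q - Q *m P.
  rewrite !mulmxBl !mulmxBr !mul_scalar_mx !mul_mx_scalar !scale_scalar_mx.
  by move: (P *m Q) (Q *m P) => U W; apply/matrixP => u v; rewrite !mxE; ring.
apply: val_inj => /=; rewrite comm_scalar !mul_delta_mx_cond.
rewrite !scalerBr !scaler_nat opprB addrA.
have -> : (3%:R^-1 *+ (i == m))%:M *+ (j == l) =
          (3%:R^-1 *+ (l == j))%:M *+ (m == i) :> 'M[k]_3.
  by rewrite (eq_sym l) (eq_sym i); case: (j == l); case: (m == i); rewrite ?raddf0.
by rewrite subrK.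
Qed.

Lemma elem_sum_diag : \sum_i elem i i = 0.
Proof.
apply: val_inj; rewrite raddf_sum /= sumrB.
under [X in _ - X]eq_bigr do rewrite eqxx mulr1n.
rewrite sumr_const card_ord -raddfMn /= -[_ *+ 3]mulr_natr mulVf //.
by apply/eqP; rewrite subr_eq0 [X in _ == X]scalar_mx_sum_delta; under [X in _ == X]eq_bigr do rewrite scale1r.
Qed.

Lemma elem_gen (x : sl3 k) : x = \sum_i \sum_j x i j *: elem i j.
Proof.
apply: val_inj; rewrite raddf_sum.
under eq_bigr do rewrite raddf_sum.
rewrite /=.
rewrite [LHS]matrix_sum_delta; apply/eqP; rewrite eq_sym -subr_eq0 -sumrB.
under eq_bigr => i _.
  rewrite -sumrB (bigD1 i) //= big1 ?addr0; last first.
    by move=> j ji; rewrite (eq_sym i) (negPf ji) mulr0n raddf0 subr0 subrr.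
  rewrite eqxx mulr1n scalerBr addrAC subrr add0r scale_scalar_mx; over.
rewrite sumrN -raddf_sum /= -mulr_suml.
have /eqP := sl3_mxP x; rewrite /mxtrace => ->.
by rewrite mul0r raddf0 oppr0.
Qed.

End Elementary.

Section Sl3Action.
Variables (k : numClosedFieldType) (V : sl3_module k).
Local Notation E i j := (@elem k i j).

Lemma actDl (x y : sl3 k) (v : V) : act (x + y) v = act x v + act y v.
Proof. by have := act_linearl 1 x y v; rewrite !scale1r. Qed.

Lemma act0l (v : V) : act 0 v = 0.
Proof. by apply: (addrI (act 0 v)); rewrite -actDl !addr0. Qed.

Lemma actZl a x (v : V) : act (a *: x) v = a *: act x v.
Proof. by have := act_linearl a x 0 v; rewrite act0l !addr0. Qed.

Lemma actBl (x y : sl3 k) (v : V) : act (x - y) v = act x v - act y v.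
Proof. by rewrite -scaleN1r actDl actZl scaleN1r. Qed.

Lemma actBr x (v w : V) : act x (v - w) = act x v - act x w.
Proof. by rewrite -scaleN1r actDr actZr scaleN1r. Qed.

Lemma act_suml (I : finType) (x : I -> sl3 k) (v : V) :
  act (\sum_i x i) v = \sum_i act (x i) v.
Proof. by elim/big_rec2: _ => [|i y z _ <-]; rewrite ?act0l ?actDl. Qed.

Lemma act_sumr (I : finType) x (v : I -> V) :
  act x (\sum_i v i) = \sum_i act x (v i).
Proof. by elim/big_rec2: _ => [|i y z _ <-]; rewrite ?act0r ?actDr. Qed.

Lemma act_elem x (v : V) : act x v = \sum_i \sum_j x i j *: act (E i j) v.
Proof.
rewrite {1}(elem_gen x) act_suml; apply: eq_bigr => i _; rewrite act_suml.
by apply: eq_bigr => j _; rewrite actZl.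
Qed.

Lemma act_elemC i j l m (v : V) : act (E i j) (act (E l m) v) =
  act (E l m) (act (E i j) v) +
  ((j == l)%:R *: act (E i m) v - (m == i)%:R *: act (E l j) v).
Proof.
apply/eqP; rewrite addrC -subr_eq -act_bracket bracket_elem actBl !actZl.
exact: eqxx.
Qed.

Lemma act_elem_diag (v : V) : \sum_i act (E i i) v = 0.
Proof. by rewrite -act_suml elem_sum_diag act0l. Qed.

Definition sl3_invariant (v : V) : Prop := forall x, act x v = 0.

Lemma invariant_elem (v : V) : (forall i j, act (E i j) v = 0) -> sl3_invariant v.
Proof.
move=> Ev x; rewrite act_elem big1 // => i _; rewrite big1 // => j _.
by rewrite Ev scaler0.
Qed.

(* sl3 is perfect: elem i j is a third of the sum of the [elem i l, elem l j]. *)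
Lemma invariant_act (v : V) : (forall x, sl3_invariant (act x v)) -> sl3_invariant v.
Proof.
move=> vI; apply: invariant_elem => i j.
have /eqP : \sum_l act (bracket (E i l) (E l j)) v = 0.
  by rewrite big1 // => l _; rewrite act_bracket !vI subrr.
under eq_bigr do rewrite bracket_elem eqxx actBl !actZl scale1r.
rewrite sumrB -scaler_sumr act_elem_diag scaler0 subr0 sumr_const card_ord.
by rewrite -scaler_nat scaler_eq0 pnatr_eq0 /= => /eqP.
Qed.

(** The quadratic Casimir element for the trace form. *)
Definition casimir (v : V) : V := \sum_i \sum_j act (E i j) (act (E j i) v).

Lemma casimir_linear : linear casimir.
Proof.
move=> a v w; rewrite /casimir scaler_sumr -big_split; apply: eq_bigr => i _ /=.
rewrite scaler_sumr -big_split; apply: eq_bigr => j _ /=.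
by rewrite !actDr !actZr.
Qed.

HB.instance Definition _ :=
  GRing.isLinear.Build k V V *:%R casimir casimir_linear.

Lemma sum_delta (m : 'I_3) (G : 'I_3 -> V) : \sum_j (m == j)%:R *: G j = G m.
Proof.
rewrite (bigD1 m) //= eqxx scale1r big1 ?addr0 // => j jm.
by rewrite eq_sym (negPf jm) scale0r.
Qed.

(** The commutator with a matrix unit expands into four sums with Kronecker deltas, which cancel in
    pairs. *)
Lemma casimir_act x (v : V) : casimir (act x v) = act x (casimir v).
Proof.
suff EC l m : casimir (act (E l m) v) = act (E l m) (casimir v).
  rewrite act_elem [RHS]act_elem.
  rewrite linear_sum; apply: eq_bigr => i _; rewrite linear_sum; apply: eq_bigr => j _.
  by rewrite linearZ_LR /= EC.
apply/eqP; rewrite /casimir act_sumr eq_sym -subr_eq0 -sumrB; apply/eqP.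
transitivity (\sum_i \sum_j
  ((m == j)%:R *: act (E i j) (act (E l i) v) - (l == i)%:R *: act (E i j) (act (E j m) v)
   + ((m == i)%:R *: act (E l j) (act (E j i) v)
      - (l == j)%:R *: act (E i m) (act (E j i) v)))).
  apply: eq_bigr => i _; rewrite act_sumr -sumrB; apply: eq_bigr => j _.
  rewrite act_elemC [act (E l m) (act (E j i) v)]act_elemC actDr actBr !actZr.
  by rewrite (eq_sym i l) (eq_sym j l) [LHS]addrAC [X in X + _ = _]addrAC subrr add0r.
under eq_bigr do rewrite big_split !sumrB sum_delta.
rewrite big_split !sumrB /= [X in _ - X + _]exchange_big /= [X in _ + (X - _)]exchange_big /=.
under [X in _ - X + _]eq_bigr do rewrite sum_delta.
under [X in _ + (X - _)]eq_bigr do rewrite sum_delta.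
under [X in _ + (_ - X)]eq_bigr do rewrite sum_delta.
by rewrite addrA subrK subrr.
Qed.

End Sl3Action.

(** * Singular vectors *)

Section Ladder.
Import passmx.
Variables (k : numClosedFieldType) (V : vectType k).

Lemma eigenvalue_finite (h : {linear V -> V}) (c : nat -> k) (v : nat -> V) :
  injective c -> exists n, ~ (v n != 0 /\ h (v n) = c n *: v n).
Proof.
move=> c_inj; apply: contrapT => /forallNP H.
have {H}H n : v n != 0 /\ h (v n) = c n *: v n by apply: contrapT; exact: H.
pose B := vbasis {:V}; have Bb : basis_of {:V} B := vbasisP _.
pose A := mxof B B (linfun h).
(* The number of eigenvalues taken is [size p], one more than the degree of p. *)
pose p := char_poly A; pose s := [seq c i | i <- iota 0 (size p)].
have : (size s < size p)%N.
  apply: max_poly_roots; first exact/monic_neq0/char_poly_monic.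
    apply/allP => _ /mapP [i _ ->]; rewrite -eigenvalue_root_char.
    have [vi0 vi] := H i; apply/eigenvalueP; exists (rVof B (v i)).
      by rewrite -rVof_app // lfunE /= vi linearZ.
    by rewrite rVof_eq0.
  by rewrite map_inj_uniq // iota_uniq.
by rewrite size_map size_iota ltnn.
Qed.

Lemma iter_eigen (h e : {linear V -> V}) d c v n :
  (forall w, h (e w) = e (h w) + d *: e w) -> h v = c *: v ->
  h (iter n e v) = (c + d *+ n) *: iter n e v.
Proof.
move=> he hv; elim: n => [|n IHn] /=; first by rewrite addr0.
by rewrite he IHn linearZ_LR /= -scalerDl mulrSr addrA.
Qed.

(** The iterates of e on v have pairwise distinct h-eigenvalues in characteristic 0, so one of them
    vanishes; n precedes the first that does. *)
Lemma ladder (h e : {linear V -> V}) d c v : d != 0 ->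
  (forall w, h (e w) = e (h w) + d *: e w) -> h v = c *: v -> v != 0 ->
  exists n, [/\ iter n e v != 0, iter n.+1 e v = 0 &
    h (iter n e v) = (c + d *+ n) *: iter n e v].
Proof.
move=> d0 he hv v0.
have hn n := iter_eigen n he hv.
have c_inj : injective (fun n => c + d *+ n).
  by move=> m n /addrI /(mulrIn d0).
have [n] := eigenvalue_finite h (fun n => iter n e v) c_inj.
move=> nP; have : exists n, iter n e v == 0.
  exists n; apply/negPn/negP => n0; apply: nP; split=> //; exact: hn.
case/ex_minnP => -[|m] /eqP m0 mmin; first by rewrite -m0 eqxx in v0.
exists m; split=> //; apply/negP => /mmin.
by rewrite ltnn.
Qed.

(** From e f^(n+1) v = (n+1)(c - n) f^n v, evaluated at the last nonzero f^n v, the highest weight c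
    equals n. *)
Lemma sl2_highest (e f h : {linear V -> V}) c v :
  (forall w, e (f w) = f (e w) + h w) ->
  (forall w, h (f w) = f (h w) - f w *+ 2) ->
  v != 0 -> e v = 0 -> h v = c *: v ->
  exists n, c = n%:R /\ iter n.+1 f v = 0.
Proof.
move=> ef hf v0 ev hv.
have d0 : - 2%:R != 0 :> k by rewrite oppr_eq0 pnatr_eq0.
have hf' w : h (f w) = f (h w) + (- 2%:R) *: f w by rewrite hf scaleNr scaler_nat.
have hn n := iter_eigen n hf' hv.
have en n : e (iter n.+1 f v) = (n.+1%:R * (c - n%:R)) *: iter n f v.
  elim: n => [|n IHn] /=; first by rewrite ef ev linear0 add0r hv subr0 mul1r.
  rewrite ef -[f (iter n f v)]/(iter n.+1 f v) IHn hn linearZ_LR /= -scalerDl.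
  by congr (_ *: _); rewrite -[_ *+ n.+1]mulr_natr -!natr1; ring.
have [n [n0 n1 _]] := ladder d0 hf' hv v0.
exists n; split=> //; move/eqP: (en n); rewrite n1 linear0 eq_sym scaler_eq0.
by rewrite (negPf n0) orbF mulf_eq0 pnatr_eq0 /= subr_eq0 => /eqP.
Qed.

End Ladder.

Local Notation i0 := (@Ordinal 3 0 isT).
Local Notation i1 := (@Ordinal 3 1 isT).
Local Notation i2 := (@Ordinal 3 2 isT).

Lemma sum3 (Z : nmodType) (G : 'I_3 -> Z) : \sum_i G i = G i0 + G i1 + G i2.
Proof.
rewrite !big_ord_recl big_ord0 addr0 addrA.
by congr (G _ + G _ + G _); apply: val_inj.
Qed.

Lemma finite_dimensional_vect (k : numClosedFieldType) (W : vectType k) :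
  finite_dimensional W.
Proof.
exists (\dim {:W}), (fun i => (vbasis {:W})`_i) => v.
by exists (fun i => coord (vbasis {:W}) i v); exact: coord_vbasis (memvf v).
Qed.

Section Singular.
Variables (k : numClosedFieldType) (V : sl3_module k).
Local Notation E i j := (@elem k i j).

Let L x : {linear V -> V} := mk_lin (act_linearr (s := V) x).

Definition weight_vector (v : V) : Prop :=
  v != 0 /\ forall l, exists c, act (E l l) v = c *: v.

(** An eigenvector of the second diagonal element is found inside an eigenspace of the first; the
    third is minus the sum of the other two. *)
Lemma weight_vector_exists (v : V) : v != 0 -> exists w, weight_vector w.
Proof.
move=> v0; have fd := finite_dimensional_vect V.
have [//|u [c [_ u0 uc]]] := finite_dimensional_eigen fd (f := L (E i0 i0)) (P := fun=> True) _ I v0.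
have [w a /= wc|w [a [wc w0 wa]]] := finite_dimensional_eigen fd (f := L (E i1 i1))
    (P := fun w => act (E i0 i0) w = c *: w) _ uc u0.
  rewrite actBr actZr act_elemC /= !scale0r subrr addr0 wc actZr scalerBr.
  by rewrite !scalerA (mulrC a).
exists w; split=> // l; have := act_elem_diag w; rewrite sum3 wc [act (E i1 i1) w]wa.
move=> /eqP; rewrite -scalerDl addrC addr_eq0 -scaleNr => /eqP w2.
case: l => -[|[|[|//]]] l3; [exists c|exists a|exists (- (c + a))];
  by rewrite (bool_irrelevance l3 isT).
Qed.

Lemma weight_vector_raise i j (v : V) : i != j -> weight_vector v ->
  exists n, weight_vector (iter n (act (E i j)) v) /\
    act (E i j) (iter n (act (E i j)) v) = 0.
Proof.
move=> ij [v0 vw].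
have comm l (w : V) : act (E l l) (act (E i j) w) =
    act (E i j) (act (E l l) w) + ((l == i)%:R - (j == l)%:R) *: act (E i j) w.
  rewrite act_elemC scalerBl; congr (_ + (_ - _)).
    by case: eqP => [->|_]; rewrite ?scale0r.
  by case: eqP => [->|_]; rewrite ?scale0r.
have [c vc] := vw i.
have d0 : (i == i)%:R - (j == i)%:R != 0 :> k.
  by rewrite eqxx [j == i]eq_sym (negPf ij) subr0 oner_eq0.
have [n [n0 n1 _]] := ladder (h := L (E i i)) (e := L (E i j)) d0 (comm i) vc v0.
exists n; split=> //; split=> // l; have [c' vc'] := vw l.
by exists (c' + ((l == i)%:R - (j == l)%:R) *+ n);
  exact: (iter_eigen (h := L (E l l)) (e := L (E i j)) n (comm l) vc').
Qed.

Lemma sl2_elem i j c (v : V) : i != j -> v != 0 -> act (E i j) v = 0 ->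
  act (E i i) v - act (E j j) v = c *: v ->
  exists n, c = n%:R /\ iter n.+1 (act (E j i)) v = 0.
Proof.
move=> ij v0 ev hv.
apply: (sl2_highest (e := L (E i j)) (f := L (E j i)) (h := L (E i i - E j j))) => //.
- by move=> w /=; rewrite act_elemC !eqxx !scale1r actBl.
- move=> w /=; rewrite !actBl (act_elemC i i) (act_elemC j j) !eqxx (negPf ij).
  rewrite !scale0r !scale1r sub0r subr0 actBr opprD addrACA; congr (_ + _).
  by rewrite -opprD mulr2n.
- by rewrite /= actBl.
Qed.

(** Highest weight vectors of weight (a, b) with respect to h1 and h2. *)
Definition singular (a b : nat) (v : V) : Prop :=
  [/\ v != 0, act (E i0 i1) v = 0, act (E i1 i2) v = 0,
      act (E i0 i0) v - act (E i1 i1) v = a%:R *: v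
    & act (E i1 i1) v - act (E i2 i2) v = b%:R *: v].

Lemma singular02 a b v : singular a b v -> act (E i0 i2) v = 0.
Proof.
case=> _ e01 e12 _ _; have := act_elemC i0 i1 i1 i2 v.
by rewrite e01 e12 !act0r /= scale1r scale0r subr0 add0r.
Qed.

(** A weight vector is raised by [E i0 i2], then [E i0 i1], then [E i1 i2]. In this order nothing
    already killed reappears, because the first commutes with the others and is their commutator.
    Integrality of the weights is sl2 theory. *)
Lemma singular_exists (v : V) : v != 0 -> exists a b w, singular a b w.
Proof.
move=> /weight_vector_exists [u0 /(@weight_vector_raise i0 i2) [//|n1]].
set u1 := iter _ _ _ => -[/(@weight_vector_raise i0 i1) [//|n2]].
set u2 := iter _ _ _ => -[/(@weight_vector_raise i1 i2) [//|n3]].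
set u3 := iter _ _ _ => -[[u30 u3w] e12 e01] e02.
have {}e02 : act (E i0 i2) u2 = 0.
  rewrite /u2; elim: (n2) => //= n IHn.
  by rewrite act_elemC IHn act0r /= !scale0r subrr addr0.
have [{}e01 {}e02] : act (E i0 i1) u3 = 0 /\ act (E i0 i2) u3 = 0.
  rewrite /u3; elim: (n3) => //= n [IH1 IH2].
  by rewrite (act_elemC i0 i1) (act_elemC i0 i2) IH1 IH2 !act0r /= !(scale0r, scale1r, IH2, subr0, addr0).
have [c0 w0] := u3w i0; have [c1 w1] := u3w i1; have [c2 w2] := u3w i2.
have h1 : act (E i0 i0) u3 - act (E i1 i1) u3 = (c0 - c1) *: u3.
  by rewrite w0 w1 scalerBl.
have h2 : act (E i1 i1) u3 - act (E i2 i2) u3 = (c1 - c2) *: u3.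
  by rewrite w1 w2 scalerBl.
have [a [aE _]] := sl2_elem (isT : i0 != i1) u30 e01 h1.
have [b [bE _]] := sl2_elem (isT : i1 != i2) u30 e12 h2.
by exists a, b, u3; split; rewrite // -?aE -?bE.
Qed.

(** On v, each raising-lowering product acts by a difference of diagonal weights, so the eigenvalue
    is c0^2 + c1^2 + c2^2 + 2(c0 - c2). The factor 3 clears the denominator of c1 = (b - a)/3. *)
Lemma casimir_singular a b v : singular a b v -> casimir v *+ 3 =
  ((a ^ 2 + a * b + b ^ 2) * 2 + (a + b) * 6)%N%:R *: v.
Proof.
move=> vs; have e02 := singular02 vs; case: vs => _ e01 e12 h1 h2.
have three0 : 3%:R != 0 :> k by rewrite pnatr_eq0.
have x0 : act (E i0 i0) v = act (E i1 i1) v + a%:R *: v by rewrite -h1 addrC subrK.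
have x2 : act (E i2 i2) v = act (E i1 i1) v - b%:R *: v.
  by rewrite -h2 opprB addrC subrK.
have w1 : act (E i1 i1) v = ((b%:R - a%:R) / 3%:R) *: v.
  have := act_elem_diag v; rewrite sum3 x0 x2 [_ + _ + act _ _]addrAC addrACA.
  move=> /eqP; rewrite addr_eq0 -scalerBl -scaleNr opprB => /eqP x1.
  rewrite mulrC -scalerA -x1 -!mulr2n -mulrSr -scaler_nat scalerA mulVf //.
  by rewrite scale1r.
rewrite w1 in x0 x2; have {x0 x2} [c0 [c1 [c2 [x0 x1 x2 cE]]]] : exists c0 c1 c2,
    [/\ act (E i0 i0) v = c0 *: v, act (E i1 i1) v = c1 *: v,
        act (E i2 i2) v = c2 *: v &
        (c0 ^+ 2 + c1 ^+ 2 + c2 ^+ 2 + (c0 - c2) *+ 2) *+ 3 =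
        ((a ^ 2 + a * b + b ^ 2) * 2 + (a + b) * 6)%N%:R].
  exists ((b%:R - a%:R) / 3%:R + a%:R), ((b%:R - a%:R) / 3%:R), ((b%:R - a%:R) / 3%:R - b%:R).
  split=> //; first by rewrite scalerDl.
    by rewrite scalerBl.
  by rewrite natrD !natrM !natrD natrM !natrX; field.
have e (i j : 'I_3) ci cj : i != j -> act (E i j) v = 0 -> act (E i i) v = ci *: v ->
    act (E j j) v = cj *: v -> act (E i j) (act (E j i) v) = (ci - cj) *: v.
  move=> ij eij ei ej; rewrite act_elemC eij act0r add0r !eqxx !scale1r ei ej.
  by rewrite scalerBl.
have d (i : 'I_3) ci : act (E i i) v = ci *: v -> act (E i i) (act (E i i) v) = ci ^+ 2 *: v.
  by move=> ei; rewrite ei actZr ei scalerA.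
rewrite /casimir !sum3 (e i0 i1 _ _ isT e01 x0 x1) (e i0 i2 _ _ isT e02 x0 x2).
rewrite (e i1 i2 _ _ isT e12 x1 x2) (d i0 _ x0) (d i1 _ x1) (d i2 _ x2).
rewrite e01 e02 e12 !act0r !add0r -!scalerDl scalerMnl -cE.
by congr (_ *: _); ring.
Qed.

(** By sl2 theory both simple lowering operators kill v, hence so does their commutator; the
    diagonal elements then agree on v and sum to 0. *)
Lemma singular00_invariant v : singular 0 0 v -> sl3_invariant v.
Proof.
move=> vs; have e02 := singular02 vs; case: vs => v0 e01 e12 h1 h2.
have [n [/esym/eqP n0 f1]] := sl2_elem (isT : i0 != i1) v0 e01 h1.
have [m [/esym/eqP m0 f2]] := sl2_elem (isT : i1 != i2) v0 e12 h2.
move: n0 m0; rewrite !pnatr_eq0 => /eqP n0 /eqP m0; subst n m.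
move: f1 f2 => /= f1 f2.
have f3 : act (E i2 i0) v = 0.
  have := act_elemC i2 i1 i1 i0 v.
  by rewrite f1 f2 !act0r /= scale1r scale0r subr0 add0r.
have comm0 i j : act (E i j) v = 0 -> act (E j i) v = 0 -> i != j ->
    act (E i i) v = act (E j j) v.
  move=> eij eji ij; have := act_elemC i j j i v.
  rewrite eij eji !act0r !eqxx !scale1r add0r => /esym/eqP.
  by rewrite subr_eq0 => /eqP.
have w01 := comm0 _ _ e01 f1 isT; have w12 := comm0 _ _ e12 f2 isT.
have w1 : act (E i1 i1) v = 0.
  have /eqP := act_elem_diag v; rewrite sum3 w01 -w12 -mulr2n -mulrSr -scaler_nat.
  by rewrite scaler_eq0 pnatr_eq0 /= => /eqP.
have w0 := w01; rewrite w1 in w0; have w2 := esym w12; rewrite w1 in w2.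
apply: invariant_elem => -[[|[|[|//]]] p] [[|[|[|//]]] q];
  by rewrite (bool_irrelevance p isT) (bool_irrelevance q isT).
Qed.

Lemma casimir_singular_eq0 a b v : singular a b v -> casimir v = 0 -> sl3_invariant v.
Proof.
move=> vs c0; have := casimir_singular vs; rewrite c0 mul0rn => /esym/eqP.
rewrite scaler_eq0 pnatr_eq0 => /orP [|v0]; last by case: vs; rewrite v0.
case: a vs => [|a]; last by rewrite !expnS !addn_eq0 !muln_eq0.
case: b => [|b]; last by rewrite !expnS !addn_eq0 !muln_eq0.
by move=> vs _; exact: singular00_invariant.
Qed.

End Singular.

(** * Complete reducibility *)

Section Induced.
Variables (k : fieldType) (V : sl3_module k) (W : vectType k).
Variables (p : 'Hom(V, W)) (s : 'Hom(W, V)).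

(** The action on a subquotient of V, realised by a projection and a linear section. It serves for a
    complement of the invariants and for the image of an idempotent. *)
Definition induced_act (x : sl3 k) (w : W) : W := p (act x (s w)).

Hypothesis ps : forall x y w, p (act x (s (induced_act y w))) = p (act x (act y (s w))).

Definition induced_module : sl3_module k.
Proof.
apply: (@Sl3Module k W induced_act).
- by move=> a x y w; rewrite /induced_act act_linearl linearP.
- by move=> x a v w; rewrite /induced_act linearP act_linearr linearP.
- by move=> x y v; rewrite {1}/induced_act act_bracket linearB /= -!ps.
Defined.

End Induced.

Section NilpotentCasimir.
Variables (k : numClosedFieldType) (V : sl3_module k).
Local Notation E i j := (@elem k i j).

Definition invariants : {vspace V} := (\bigcap_(q : 'I_3 * 'I_3)
  lker (linfun (mk_lin (act_linearr (s := V) (E q.1 q.2)))))%VS.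

Lemma invariantsP (v : V) : v \in invariants <-> sl3_invariant v.
Proof.
split=> [/[!memvE] /subv_bigcapP vI|vI].
  apply: invariant_elem => i j; have := vI (i, j) isT.
  by rewrite -memvE memv_ker lfunE => /eqP.
rewrite memvE; apply/subv_bigcapP => q _.
by rewrite -memvE memv_ker lfunE /= vI.
Qed.

Lemma iter_casimir_linear n : linear (iter n (@casimir k V)).
Proof. by elim: n => // n IHn; exact: compP (@casimir_linear k V) IHn. Qed.

Let kern n : {vspace V} := lker (linfun (mk_lin (iter_casimir_linear n))).

Let kernP n v : (v \in kern n) = (iter n (@casimir k V) v == 0).
Proof. by rewrite memv_ker lfunE. Qed.

Lemma iter_casimir_act n x (v : V) :
  iter n (@casimir k V) (act x v) = act x (iter n (@casimir k V) v).
Proof. by elim: n => //= n ->; rewrite casimir_act. Qed.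

Lemma casimir_invariant (v : V) : sl3_invariant v -> casimir v = 0.
Proof.
move=> vI; rewrite /casimir big1 // => i _; rewrite big1 // => j _.
by rewrite vI act0r.
Qed.

(* Otherwise a complement U of the invariants in the kernel of casimir^n, seen as
   a subquotient of V, has a singular vector; casimir kills it, so it is invariant
   in U, hence invariant in V since sl3 is perfect. *)
Lemma nilpotent_casimir_invariant n (v : V) :
  iter n (@casimir k V) v = 0 -> sl3_invariant v.
Proof.
move=> /eqP; rewrite -kernP; set K := kern n => vK.
suff /eqP KT : (K :\: invariants == 0)%VS.
  by apply/invariantsP; move: v vK; apply/subvP; rewrite -diffv_eq0 KT.
apply/negPn/negP => KT0; set U := (K :\: invariants)%VS in KT0.
have UT0 : (U :&: invariants = 0)%VS := capv_diff K invariants.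
have UK u : u \in U -> u \in K by apply/subvP/diffvSl.
have Kact x u : u \in K -> act x u \in K.
  by rewrite !kernP iter_casimir_act => /eqP ->; rewrite act0r.
pose s : 'Hom(subvs_of U, V) := linfun vsval.
pose p : 'Hom(V, subvs_of U) := linfun (vsproj U \o daddv_pi U invariants).
have sE w : s w = vsval w by rewrite lfunE.
have pE u : vsval (p u) = daddv_pi U invariants u by rewrite lfunE /= vsprojK ?memv_pi.
(* On K the projection changes a vector only by an invariant, which any further action kills; this
   is what makes the induced action a representation. *)
have psK u : u \in K -> sl3_invariant (u - s (p u)).
  move=> uK; have := @daddv_pi_add _ _ U invariants u UT0.
  rewrite /U addv_diff => /(_ (subvP (addvSl _ _) u uK)) uE.
  by apply/invariantsP; rewrite -[u in X in X - _]uE sE pE addrC addKr memv_pi.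
have sU w : s w \in U by rewrite sE subvsP.
have ps x y w : p (act x (s (induced_act p s y w))) = p (act x (act y (s w))).
  apply/eqP; rewrite eq_sym -subr_eq0 -linearB /= -actBr psK ?linear0 //.
  exact/Kact/UK.
pose W := induced_module ps.
have [z0 z00] : exists w : W, w != 0.
  have u0 := vpick0 U; exists (vsproj U (vpick U)).
  rewrite -(inj_eq val_inj) /= vsprojK ?memv_pick // u0; exact: KT0.
have [a [b [w ws]]] := singular_exists z00.
have casW (u : W) : casimir u = p (casimir (s u)).
  rewrite [RHS]linear_sum; apply: eq_bigr => i _; rewrite linear_sum.
  by apply: eq_bigr => j _; exact: (ps (E i j) (E j i) u).
have psw (u : W) : p (s u) = u.
  apply: val_inj; exact: etrans (pE _) (etrans (daddv_pi_id UT0 (sU u)) (sE u)).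
have iterW m : iter m (@casimir k W) w = p (iter m (@casimir k V) (s w)).
  elim: m => [|m IHm] /=; first by rewrite psw.
  rewrite IHm casW; apply/eqP; rewrite eq_sym -subr_eq0 -linearB /= -linearB /=.
  rewrite casimir_invariant ?linear0 //; apply: psK.
  elim: m {IHm} => [|m IHm] /=; first exact: UK.
  by move: IHm; rewrite !kernP -iterSr iterS => /eqP ->; rewrite linear0.
have w0 : w != 0 by case: ws.
have cw : casimir w = ((((a ^ 2 + a * b + b ^ 2) * 2 + (a + b) * 6)%N%:R) / 3%:R) *: w.
  rewrite mulrC -scalerA -casimir_singular // -scaler_nat scalerA mulVf ?scale1r //.
  by rewrite pnatr_eq0.
(* The n-th power of the eigenvalue vanishes, as n applications of [casimir] kill K. *)
have c0 : casimir w = 0.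
  move: cw; set c := _ / _ => cw; have iterc m : iter m (@casimir k W) w = c ^+ m *: w.
    elim: m => [|m IHm] /=; first by rewrite scale1r.
    by rewrite IHm linearZ_LR /= cw scalerA exprSr.
  have /eqP := iterc n; rewrite iterW.
  have /eqP -> : iter n (@casimir k V) (s w) == 0 by rewrite -kernP UK.
  rewrite linear0 eq_sym scaler_eq0 (negPf w0) orbF expf_eq0 => /andP [_ /eqP c0].
  by rewrite cw c0 scale0r.
have wI := casimir_singular_eq0 ws c0.
have swI : sl3_invariant (s w).
  apply: invariant_act => x; have := psK _ (Kact x _ (UK _ (sU w))).
  by rewrite (wI x : p (act x (s w)) = 0) linear0 subr0.
have : s w \in (U :&: invariants)%VS by rewrite memv_cap sU; apply/invariantsP.
by rewrite UT0 memv0 sE => /eqP sw0; case/eqP: w0; apply: val_inj.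
Qed.

(** Fitting decomposition: write an annihilating polynomial of x as X^n (a + X q) with a nonzero.
    Then x0 = x + a^-1 casimir (q x) is killed by the n-th power, and y = a^-1 q x. *)
Lemma casimir_fitting (x : V) : exists n x0 y,
  iter n (@casimir k V) x0 = 0 /\ x = x0 - casimir y.
Proof.
(* Horner evaluation at [casimir], so that induction on the coefficient list strips low zero
   coefficients while n counts them. *)
pose pe s := foldr (fun a y => a *: x + casimir y) 0 s.
have [p p0 px] := finite_dimensional_dep (finite_dimensional_vect V)
  (fun i => iter i (@casimir k V) x).
have peE s : pe s = \sum_(i < size s) s`_i *: iter i (@casimir k V) x.
  elim: s => [|a s IHs] /=; first by rewrite big_ord0.
  rewrite big_ord_recl /= IHs linear_sum; congr (_ + _); apply: eq_bigr => i _.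
  by rewrite linearZ_LR.
have : has (predC1 0) p.
  by apply/hasP; exists (lead_coef p); rewrite /= ?lead_coef_eq0 // mem_nth // prednK // size_poly_gt0.
have : iter 0 (@casimir k V) (pe p) = 0 by rewrite peE.
elim: {p p0 px}(polyseq p) 0%N => //= a s IHs n.
have [->|a0] := eqVneq a 0; first by rewrite scale0r add0r -iterSr => /IHs.
move=> pe0 _; exists n, (a^-1 *: (a *: x + casimir (pe s))), (a^-1 *: pe s); split.
  by have := iter_casimir_linear n a^-1 (a *: x + casimir (pe s)) 0; rewrite !addr0 pe0
    => ->; rewrite scaler0 add0r; elim: (n) => //= m ->; rewrite linear0.
by rewrite scalerDr scalerA mulVf // scale1r linearZ_LR addrK.
Qed.

End NilpotentCasimir.

(** Write x = x0 - casimir y by the Fitting decomposition; x0 is invariant. The image casimir (f y)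
    is a difference of invariants, so casimir^2 kills f y, which is therefore invariant, and casimir
    (f y) = 0. *)
Lemma invariant_exact (k : numClosedFieldType) (P Q : sl3_module k)
    (f : {linear P -> Q}) (x : P) :
  (forall z v, f (act z v) = act z (f v)) -> sl3_invariant (f x) ->
  exists x0, sl3_invariant x0 /\ f x0 = f x.
Proof.
move=> fE fxI; have [n [x0 [y [x0n xE]]]] := casimir_fitting x.
have fc u : f (casimir u) = casimir (f u).
  rewrite linear_sum; apply: eq_bigr => i _; rewrite linear_sum.
  by apply: eq_bigr => j _; rewrite !fE.
have x0I := nilpotent_casimir_invariant x0n; exists x0; split=> //.
have fx0I : sl3_invariant (f x0) by move=> z; rewrite -fE x0I linear0.
rewrite xE linearB /= fc casimir_invariant ?subr0 //.
apply: (@nilpotent_casimir_invariant _ _ 2) => /=.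
have : casimir (f y) = f x0 - f x by rewrite xE linearB /= fc opprB addrC subrK.
by move=> ->; rewrite linearB /= !casimir_invariant ?subr0.
Qed.

(** * Linear maps as a module, with the equivariant ones as invariants *)

Section HomModule.
Variables (k : numClosedFieldType) (V W : sl3_module k).

Let lact (U : sl3_module k) x : 'End(U) := linfun (mk_lin (act_linearr (s := U) x)).

Definition hom_act x (f : 'Hom(V, W)) : 'Hom(V, W) :=
  (lact W x \o f)%VF - (f \o lact V x)%VF.

Lemma hom_actE x (f : 'Hom(V, W)) v : hom_act x f v = act x (f v) - f (act x v).
Proof. by rewrite add_lfunE opp_lfunE !comp_lfunE !lfunE. Qed.

Fact hom_bracket_aux (Z : zmodType) (a b c d e g : Z) :
  a - e - (g - d) = a - b - (c - d) - (e - c - (b - g)).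
Proof.
rewrite !opprB [LHS]addrACA [X in _ = X + _]addrACA [X in _ = _ + X]addrACA.
by rewrite -!opprD [RHS]addrA subrK (addrC e).
Qed.

Definition hom_module : sl3_module k.
Proof.
apply: (@Sl3Module k 'Hom(V, W) hom_act).
- move=> a x y f; apply/lfunP => v.
  rewrite hom_actE [RHS]add_lfunE [X in _ = X + _]scale_lfunE !hom_actE.
  by rewrite !act_linearl linearP scalerBr opprD addrACA.
- move=> x a f g; apply/lfunP => v.
  rewrite hom_actE [RHS]add_lfunE [X in _ = X + _]scale_lfunE !hom_actE.
  by rewrite !add_lfunE !scale_lfunE act_linearr scalerBr opprD addrACA.
- move=> x y f; apply/lfunP => v.
  rewrite hom_actE [RHS]add_lfunE [X in _ = _ + X]opp_lfunE !hom_actE.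
  by rewrite !act_bracket linearB /= !actBr; exact: hom_bracket_aux.
Defined.

End HomModule.

Section Regular.
Variable k : numClosedFieldType.
Implicit Types A B V W : sl3_module k.

Definition hom_of_invariant V W (f : hom_module V W) (fI : sl3_invariant f) : sl3_hom V W.
Proof.
exists f; apply/asboolP => x v; apply/esym/eqP; rewrite -subr_eq0.
by rewrite -(hom_actE x (f : 'Hom(V, W))) (fI x : hom_act x f = 0) lfunE.
Defined.

Lemma sl3_hom_invariant V W (f : sl3_hom V W) :
  sl3_invariant (sl3_lfun f : hom_module V W).
Proof.
by move=> x; apply/lfunP => v; rewrite hom_actE sl3_homE subrr lfunE.
Qed.

(* Complete reducibility, as von Neumann regularity of the hom spaces. *)
Lemma sl3_hom_regular V W (f : sl3_hom V W) : exists g : sl3_hom W V,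
  sl3_comp (sl3_comp f g) f = f.
Proof.
(* The equivariant map s |-> f s f sends the linear pseudo-inverse of f to the invariant f;
   exactness replaces that preimage by an invariant one. *)
pose Psi (s : hom_module W V) : hom_module V W := (f \o (s : 'Hom(W, V)) \o f)%VF.
have PsiL : linear Psi.
  move=> a s t; apply/lfunP => v; rewrite [RHS]add_lfunE [X in _ = X + _]scale_lfunE.
  by rewrite !comp_lfunE add_lfunE scale_lfunE linearP.
have PsiE x s : Psi (act x s) = act x (Psi s).
  apply/lfunP => v; rewrite [RHS]hom_actE !comp_lfunE hom_actE linearB /=.
  by rewrite !sl3_homE.
have ff : Psi (f^-1)%VF = f.
  by apply/lfunP => v; rewrite !comp_lfunE limg_lfunVK // memv_img // memvf.
have [|s [sI fsf]] := @invariant_exact k _ _ (mk_lin PsiL) (f^-1)%VF PsiE.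
  by rewrite /= ff; exact: sl3_hom_invariant.
exists (hom_of_invariant sI); apply: sl3_hom_eq => v; rewrite !sl3_compE /=.
by move/lfunP/(_ v): fsf => /=; rewrite ff !comp_lfunE.
Qed.

End Regular.

(** * The category of finite dimensional modules *)

Section Sl3Category.
Variable k : numClosedFieldType.
Implicit Types V W : sl3_module k.
Local Notation C := (sl3_lin_cat k).

Lemma sl3_hom0 V W (v : V) : (0 : sl3_hom V W) v = 0.
Proof. exact: zero_lfunE. Qed.

Lemma sl3_homZ V W a (f : sl3_hom V W) v : (a *: f) v = a *: f v.
Proof. by rewrite -[a *: f]addr0 sl3_hom_lin sl3_hom0 addr0. Qed.

Lemma sl3_idempotent_split : idempotent_split C.
Proof.
move=> V e ee; have eE v : e (e v) = e v by rewrite -sl3_compE [sl3_comp e e]ee.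
pose U := limg e.
have eU v : e v \in U by rewrite memv_img // memvf.
have Ue u : u \in U -> e u = u by case/memv_imgP => v _ ->.
pose s : 'Hom(subvs_of U, V) := linfun vsval.
pose p : 'Hom(V, subvs_of U) := linfun (vsproj U \o e).
have sE w : s w = vsval w by rewrite lfunE.
have spE v : s (p v) = e v by rewrite sE lfunE /= vsprojK.
have pe v : p (e v) = p v by rewrite !lfunE /= eE.
have es w : e (s w) = s w by rewrite sE Ue // subvsP.
have psE w : p (s w) = w by apply: val_inj; exact: etrans (esym (sE _)) (etrans (spE _) (etrans (es _) (sE w))).
have ps x y w : p (act x (s (induced_act p s y w))) = p (act x (act y (s w))).
  by rewrite spE -sl3_homE pe.
pose Y := induced_module ps.
have pE x v : p (act x v) = act x (p v : Y) by rewrite /= /induced_act spE -sl3_homE pe.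
have sA x (w : Y) : s (act x w) = act x (s w) by rewrite /= /induced_act spE sl3_homE es.
exists Y, (@mk_hom k V Y p (linearP p) pE), (@mk_hom k Y V s (linearP s) sA); split.
  by apply: sl3_hom_eq => v; rewrite sl3_compE !mk_homE spE.
by apply: sl3_hom_eq => v; rewrite sl3_compE !mk_homE psE.
Qed.

Definition prod_module V W : sl3_module k.
Proof.
apply: (@Sl3Module k (V * W)%type (fun x u => (act x u.1, act x u.2))).
- by move=> a x y u; rewrite !act_linearl.
- by move=> x a u u'; rewrite !act_linearr.
- by move=> x y u; rewrite !act_bracket.
Defined.

Lemma sl3_biproduct (V W : C) : exists (S : C) (iA : hom V S) (iB : hom W S)
  (pA : hom S V) (pB : hom S W), [/\ pA ∘ iA = idm V, pB ∘ iB = idm W,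
    pA ∘ iB = 0 & pB ∘ iA = 0].
Proof.
pose S := prod_module V W.
have i1L : linear (fun v : V => (v, 0) : S).
  by move=> a u v; apply/eqP; rewrite xpair_eqE /= scaler0 addr0 !eqxx.
have i2L : linear (fun w : W => (0, w) : S).
  by move=> a u v; apply/eqP; rewrite xpair_eqE /= scaler0 addr0 !eqxx.
have p1L : linear (fun u : S => u.1) by [].
have p2L : linear (fun u : S => u.2) by [].
have i1E x (v : V) : ((act x v, 0) : S) = act x ((v, 0) : S) by rewrite /= act0r.
have i2E x (w : W) : ((0, act x w) : S) = act x ((0, w) : S) by rewrite /= act0r.
exists S, (mk_hom i1L i1E), (mk_hom i2L i2E).
exists (@mk_hom k S V _ p1L (fun _ _ => erefl)), (@mk_hom k S W _ p2L (fun _ _ => erefl)).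
by split; apply: sl3_hom_eq => v; rewrite sl3_compE 2!mk_homE ?sl3_idE ?lfunE /= ?lfunE.
Qed.

Lemma trivial_end (f : sl3_hom (trivial_module k) (trivial_module k)) :
  f = f (1 : k^o) *: sl3_id _.
Proof.
apply: sl3_hom_eq => a; rewrite sl3_homZ sl3_idE.
rewrite -[a in LHS]mulr1 -[a * 1]/(a *: (1 : k^o)) linearZ; exact: mulrC.
Qed.

Lemma trivial_local : @local_end k C (trivial_module k).
Proof.
split=> [/(congr1 (fun f : sl3_hom (trivial_module k) (trivial_module k) => f (1 : k^o)))|f].
  by rewrite [LHS]sl3_idE [RHS]sl3_hom0 => /eqP; rewrite oner_eq0.
rewrite [f]trivial_end; set c := f _; have [->|c0] := eqVneq c 0.
  by right; rewrite scale0r subr0; exact: is_iso_id.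
left; exists (c^-1 *: idm (trivial_module k : C)).
by rewrite !compZl !compZr !comp1m !scalerA mulVf ?mulfV // scale1r.
Qed.

Lemma sl3_regular (V W : C) (f : hom V W) : exists g : hom W V, f ∘ g ∘ f = f.
Proof. exact: sl3_hom_regular. Qed.

(** With f g f = f, the endomorphism f g of the trivial module is a scalar, which must be 1 as f is
    nonzero. *)
Lemma sl3_section (V : C) (f : hom V (trivial_module k : C)) : f != 0 ->
  exists s : hom (trivial_module k : C) V, f ∘ s = idm _.
Proof.
move=> f0; have [g fgf] := sl3_regular f.
have := trivial_end (f ∘ g); set c := _ (1 : k^o) => fg.
exists g; rewrite fg; move: fgf; rewrite fg => /eqP; rewrite -[_ ∘ f]/((c *: idm _) ∘ f).
rewrite compZl comp1m -subr_eq0 -[X in _ - X]scale1r -scalerBl scaler_eq0 (negPf f0) orbF.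
by rewrite subr_eq0 => /eqP ->; rewrite scale1r.
Qed.

Lemma sl3_finite_dimensional (V W : C) : finite_dimensional (hom V W).
Proof.
pose B := vbasis (invariants (hom_module V W)).
have BI i : sl3_invariant (tnth B i : hom_module V W).
  by apply/invariantsP; apply: vbasis_mem; exact: mem_tnth.
exists (\dim (invariants (hom_module V W))), (fun i => hom_of_invariant (BI i)).
move=> f; exists (fun i => coord B i (sl3_lfun f)); apply: val_inj.
have fI : sl3_lfun f \in invariants (hom_module V W).
  by apply/invariantsP; exact: sl3_hom_invariant.
rewrite [LHS](coord_vbasis fI) raddf_sum; apply: eq_bigr => i _ /=.
by rewrite (tnth_nth 0).
Qed.

(** With f g f = f, both f g and g f are idempotents, hence 0 or 1; so f is 0 or invertible. *)
Lemma sl3_indecomposable_local (V : C) : indecomposable V -> local_end V.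
Proof.
move=> Vi; have [V0 _] := Vi; split=> // f; have [g fgf] := sl3_regular f.
have ee : f ∘ g ∘ (f ∘ g) = f ∘ g by rewrite compA fgf.
have ee' : g ∘ f ∘ (g ∘ f) = g ∘ f by rewrite -compA (compA f) fgf.
have [e0|e1] := indecomposable_idem sl3_idempotent_split Vi ee.
  by right; rewrite -fgf e0 comp0m subr0; exact: is_iso_id.
left; have [e0|e1'] := indecomposable_idem sl3_idempotent_split Vi ee'.
  case: V0; rewrite /is_zero -e1 -fgf -[RHS](comp0m _ g) -[in RHS](compm0 _ f).
  by rewrite -e0 !compA.
by exists g.
Qed.

(** Supplies the measure for the inductions that split off a proper summand. *)
Lemma retract_dim (V W : C) (f : hom V W) (g : hom W V) :
  g ∘ f = idm V -> f ∘ g <> idm W ->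
  (\dim {:(V : sl3_module k)} < \dim {:(W : sl3_module k)})%N.
Proof.
move=> gf fg; have gfE (v : V) : sl3_lfun g (sl3_lfun f v) = v.
  by rewrite -sl3_compE [sl3_comp g f]gf; exact: sl3_idE.
rewrite ltn_neqAle -(limg_dim_eq (f := sl3_lfun f)); last first.
  apply/eqP; rewrite capfv -subv0; apply/subvP => v; rewrite memv_ker memv0 => /eqP fv.
  by rewrite -[v]gfE fv linear0.
rewrite dimvS ?subvf // andbT; apply: contra_notN fg => /eqP d.
apply: sl3_hom_eq => w.
have : w \in limg (sl3_lfun f).
  have /eqP -> : limg (sl3_lfun f) == fullv by rewrite eqEdim subvf /= d.
  exact: memvf.
by case/memv_imgP => v _ ->; rewrite sl3_compE gfE; exact/esym/sl3_idE.
Qed.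

Lemma sl3_krull_schmidt : krull_schmidt_cat C.
Proof.
split; [|exact: sl3_indecomposable_local|exact: sl3_finite_dimensional].
move=> V; have [d] := ubnP (\dim {:(V : sl3_module k)}).
elim: d V => // d IHd V; rewrite ltnS => dV.
have [V0|V0] := pselect (is_zero V).
  have Y0 (i : 'I_0) : C by case: i.
  exists 0%N, Y0; split; first by case.
  by exists (fun i => 0), (fun i => 0); split=> [[]|[]|] //; rewrite big_ord0 V0.
have [Vi|Vi] := pselect (indecomposable V).
  by exists 1%N, (fun=> V); split=> //; exact: direct_sum1.
have [Y YV Y0] : exists2 Y : bool -> C, direct_sum Y V & forall b, ~ is_zero (Y b).
  apply: contrapT => nY; apply: Vi; split=> // Y YV; apply: contrapT => nY0.
  by apply: nY; exists Y => // b Yb; apply: nY0; exists b.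
have Yd b : (\dim {:(Y b : sl3_module k)} < d)%N.
  apply: leq_trans dV; have [inj [proj [p1 p2 p3]]] := YV.
  apply: (retract_dim (p1 b)) => e1; apply: (Y0 (~~ b)).
  rewrite /is_zero -p1 -(comp1m (inj _)) -e1 !compA p2 ?comp0m //.
  by case: b {e1}.
have /dep_choice [n /dep_choice [W WY]] := fun b => IHd _ (Yd b).
pose T := {b : bool & 'I_(n b)}.
exists #|{: T}|, (fun i => let x : T := enum_val i in W (tag x) (tagged x)); split.
  by move=> i; have [Wi _] := WY (tag (enum_val i : T)); exact: Wi.
apply: (direct_sum_reindex (h := fun i => enum_val i : T)
   (W := fun x : T => W (tag x) (tagged x))).
  by exists enum_rank => x; rewrite ?enum_valK ?enum_rankK.
by apply: direct_sum_sigma YV _ => b; have [_] := WY b.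
Qed.

(** * Evaluation, coevaluation and the zigzag identity *)

Section Dual.
Variable W : sl3_module k.
Notation D := (dual_module W).
Notation I := (trivial_module k).

Let evb (f : D) (w : W) : k^o := (f : 'Hom(W, k^o)) w.

Fact evb_bilin : bilin evb.
Proof.
split=> [a f g w|a f v w]; last by rewrite /evb linearP.
by rewrite /evb add_lfunE scale_lfunE.
Qed.

Fact ev_equivariant x (t : tens_module D W) :
  tlift evb (act x t) = act x (tlift evb t : I).
Proof.
move: t; apply: (tens_ext (f := fun t => tlift evb (tact x t)) (g := fun=> 0)).
- by apply: compP; [exact: linearP|exact: tact_linear].
- by move=> a s t; rewrite scaler0 addr0.
move=> f w; rewrite tact_pure linearD /= !tlift_pure; do ?exact: evb_bilin.
by rewrite /evb dual_actE addNr.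
Qed.

Definition dual_ev : sl3_hom (tens_module D W) I :=
  @mk_hom k (tens_module D W) I (tlift evb) (linearP (tlift evb)) ev_equivariant.

Let cb (i : 'I_(\dim {:W})) : D := linfun (coord (vbasis {:W}) i : W -> k^o).

Let cbE i w : (cb i : 'Hom(W, k^o)) w = coord (vbasis {:W}) i w.
Proof. by rewrite lfunE. Qed.

Let canon : tens_module W D := \sum_i pure (bas i : W) (cb i).

(** The matrix of x on the basis and its negative transpose on the dual basis produce the same
    double sum with opposite signs. *)
Fact canon_invariant x : act x canon = 0.
Proof.
have cbx i : act x (cb i) = - \sum_j coord (vbasis {:W}) i (act x (bas j : W)) *: cb j.
  apply/lfunP => w; rewrite [act x (cb i)]/(dual_act x (cb i)) dual_actE cbE.
  rewrite [in LHS](bas_sum w) act_sumr linear_sum opp_lfunE sum_lfunE; congr (- _).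
  apply: eq_bigr => j _; rewrite scale_lfunE cbE actZr linearZ; exact: mulrC.
have actp i : act x (pure (bas i : W) (cb i) : tens_module W D) =
    \sum_j coord (vbasis {:W}) j (act x (bas i : W)) *: (pure (bas j : W) (cb i) : tens W D) -
    \sum_j coord (vbasis {:W}) i (act x (bas j : W)) *: (pure (bas i : W) (cb j) : tens W D).
  rewrite [LHS]tact_pure cbx [in LHS](bas_sum (act x (bas i))).
  rewrite (bilin_suml (pure_bilin W D)); congr (_ + _).
  by rewrite -scaleN1r pureZr scaleN1r (bilin_sumr (pure_bilin W D)).
rewrite act_sumr (eq_bigr _ (fun i _ => actp i)) sumrB.
by rewrite [X in X - _]exchange_big subrr.
Qed.

Fact coev_linear : linear (fun a : I => a *: canon).
Proof. by move=> a u v; rewrite scalerDl scalerA. Qed.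

Fact coev_equivariant x (a : I) : (act x a : k) *: canon = act x ((a : k) *: canon).
Proof. by rewrite actZr canon_invariant scaler0 scale0r. Qed.

Definition dual_coev : sl3_hom I (tens_module W D) :=
  mk_hom coev_linear coev_equivariant.

Lemma dual_evE (f : D) (w : W) : dual_ev (pure f w) = (f : 'Hom(W, k^o)) w.
Proof.
rewrite (mk_homE (V := tens_module D W) (W := I)); exact: (tlift_pure _ _ evb_bilin).
Qed.

Lemma dual_coevE (a : k^o) : dual_coev a = a *: canon.
Proof. exact: (mk_homE (V := I) (W := tens_module W D)). Qed.

Fact sl3_zigzag :
  sl3_comp (sl3_comp (sl3_comp (sl3_runit W) (sl3_tmap (sl3_id W) dual_ev))
    (sl3_assoc W D W)) (sl3_tmap dual_coev (sl3_id W)) = sl3_lunit W.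
Proof.
apply: sl3_ext2 => a w; rewrite sl3_compE sl3_lunitE sl3_tmapE sl3_idE dual_coevE.
set h := sl3_comp _ _.
have hE i : h (pure (pure (bas i : W) (cb i)) w) = coord (vbasis {:W}) i w *: bas i.
  by rewrite /h !sl3E dual_evE cbE.
rewrite [pure _ w](_ : _ = a *: \sum_i pure (pure (bas i : W) (cb i)) w).
  rewrite linearZ /= linear_sum [in RHS](bas_sum w); congr (_ *: _).
  by apply: eq_bigr => i _; exact: hE.
rewrite pureZl; congr (_ *: _).
by apply: (big_morph (fun t => pure t w)) => [u v|]; rewrite ?pureDl ?pure0l.
Qed.

Lemma sl3_is_dual : @is_dual k (sl3_mod k) W D dual_ev dual_coev.
Proof. exact: sl3_zigzag. Qed.

End Dual.

End Sl3Category.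

(** * Generation by tensor powers of the natural module *)

Section TensorGenerator.
Variable k : numClosedFieldType.
Implicit Types V W : sl3_module k.
Local Notation F := (natural_module k).
Local Notation E i j := (@elem k i j).

Section ColumnHom.
Variable V : sl3_module k.

Fact col_hom_linear (t : 'I_3 -> V) : linear (fun u : F => \sum_i (u : 'cV_3) i 0 *: t i).
Proof.
move=> a u v; rewrite scaler_sumr -big_split; apply: eq_bigr => i _ /=.
by rewrite !mxE scalerDl scalerA.
Qed.

(** The linear map given by the images of the three basis vectors; [hom_module F V] plays the role
    of F^* tensor V. *)
Definition col_hom (t : 'I_3 -> V) : hom_module F V := linfun (mk_lin (col_hom_linear t)).

Lemma col_homE (t : 'I_3 -> V) (u : F) :
  (col_hom t : 'Hom(F, V)) u = \sum_i (u : 'cV_3) i 0 *: t i.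
Proof. by rewrite lfunE. Qed.

Lemma col_hom_basis (t : 'I_3 -> V) i :
  (col_hom t : 'Hom(F, V)) (delta_mx i 0 : 'cV_3) = t i.
Proof.
rewrite col_homE (bigD1 i) //= big1 ?addr0; first by rewrite mxE !eqxx scale1r.
by move=> j ji; rewrite mxE (negPf ji) scale0r.
Qed.

Lemma eq_col_hom (t t' : 'I_3 -> V) : (forall i, t i = t' i) -> col_hom t = col_hom t'.
Proof. by move=> tt'; congr col_hom; exact: funext. Qed.

Lemma col_hom_lin a (t t' : 'I_3 -> V) :
  a *: col_hom t + col_hom t' = col_hom (fun i => a *: t i + t' i).
Proof.
apply/lfunP => u; rewrite [LHS]add_lfunE [X in X + _]scale_lfunE !col_homE.
rewrite scaler_sumr -big_split; apply: eq_bigr => i _ /=.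
by rewrite scalerDr !scalerA mulrC.
Qed.

Lemma col_hom0 : col_hom (fun=> 0) = 0.
Proof.
by apply/lfunP => u; rewrite col_homE big1 ?[RHS]zero_lfunE // => i _; rewrite scaler0.
Qed.

Lemma col_homZ a (t : 'I_3 -> V) : a *: col_hom t = col_hom (fun i => a *: t i).
Proof.
by rewrite -[LHS]addr0 -col_hom0 col_hom_lin; apply: eq_col_hom => i; rewrite addr0.
Qed.

Lemma col_homB (t t' : 'I_3 -> V) : col_hom t - col_hom t' = col_hom (fun i => t i - t' i).
Proof.
rewrite addrC -scaleN1r col_hom_lin; apply: eq_col_hom => i.
by rewrite scaleN1r addrC.
Qed.

Lemma col_hom_eq0 (t : 'I_3 -> V) i : t i != 0 -> col_hom t != 0.
Proof.
by apply: contra_neq => t0; rewrite -(col_hom_basis t i) t0 [LHS]zero_lfunE.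
Qed.

(** The last term is the scalar correction that makes [E i j] traceless. *)
Lemma act_col_hom i j (t : 'I_3 -> V) : act (E i j) (col_hom t) = col_hom (fun l =>
  act (E i j) (t l) - (j == l)%:R *: t i + (3%:R^-1 *+ (i == j)) *: t l).
Proof.
apply/lfunP => u; rewrite [LHS](hom_actE (E i j) (col_hom t)) !col_homE act_sumr -sumrB.
rewrite (eq_bigr (fun l => (u : 'cV_3) l 0 *: act (E i j) (t l) - (i == l)%:R *: ((u : 'cV_3) j 0 *: t l)
   + (3%:R^-1 *+ (i == j)) *: ((u : 'cV_3) l 0 *: t l))); last first.
  move=> l _; rewrite actZr -addrA; congr (_ + _).
  rewrite /act /= mulmxBl mul_scalar_mx !mxE scalerBl opprB addrC; congr (_ + _).
    by rewrite scalerA.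
  rewrite (bigD1 j) //= big1 ?addr0; last by move=> m mj; rewrite mxE (negPf mj) andbF mul0r.
  by rewrite !mxE eqxx andbT scalerA eq_sym.
rewrite big_split sumrB /= sum_delta -scaler_sumr.
rewrite [RHS](eq_bigr (fun l => (u : 'cV_3) l 0 *: act (E i j) (t l) - (j == l)%:R *: ((u : 'cV_3) l 0 *: t i)
   + (3%:R^-1 *+ (i == j)) *: ((u : 'cV_3) l 0 *: t l))); last first.
  by move=> l _; rewrite scalerDr scalerBr !scalerA !(mulrC (u l 0)).
by rewrite [RHS]big_split sumrB /= sum_delta -scaler_sumr.
Qed.

Lemma act_col_hom_neq i j (t : 'I_3 -> V) : i != j ->
  act (E i j) (col_hom t) = col_hom (fun l => act (E i j) (t l) - (j == l)%:R *: t i).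
Proof.
move=> ij; rewrite act_col_hom; apply: eq_col_hom => l.
by rewrite (negPf ij) mulr0n scale0r addr0.
Qed.

Definition cartan i j (W : sl3_module k) (v : W) := act (E i i) v - act (E j j) v.

Lemma cartan_col_hom i j (t : 'I_3 -> V) : cartan i j (col_hom t) =
  col_hom (fun l => cartan i j (t l) - ((i == l)%:R - (j == l)%:R) *: t l).
Proof.
rewrite /cartan !act_col_hom col_homB; apply: eq_col_hom => l.
have d m : (m == l)%:R *: t m = (m == l)%:R *: t l.
  by case: eqP => [->|] //; rewrite !scale0r.
rewrite !eqxx !d opprD addrACA subrr addr0 opprB scalerBl opprB.
by rewrite [LHS]addrACA [RHS]addrACA [X in _ + X = _]addrC.
Qed.

End ColumnHom.

Lemma cartan_act i j l m (V : sl3_module k) (v : V) : cartan i j (act (E l m) v) =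
  act (E l m) (cartan i j v) +
  ((i == l)%:R - (m == i)%:R - ((j == l)%:R - (m == j)%:R)) *: act (E l m) v.
Proof.
have d1 p : (p == l)%:R *: act (E p m) v = (p == l)%:R *: act (E l m) v.
  by case: eqP => [->|] //; rewrite !scale0r.
have d2 p : (m == p)%:R *: act (E l p) v = (m == p)%:R *: act (E l m) v.
  by case: eqP => [->|] //; rewrite !scale0r.
rewrite /cartan (act_elemC i i) (act_elemC j j) !d1 !d2 -!scalerBl actBr opprD addrACA.
by rewrite -scalerBl.
Qed.

Lemma cartan_shift i j l m (V : sl3_module k) (v : V) c d : cartan i j v = c *: v ->
  (i == l)%:R - (m == i)%:R - ((j == l)%:R - (m == j)%:R) = d :> k ->
  cartan i j (act (E l m) v) = (c + d) *: act (E l m) v.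
Proof. by move=> cv <-; rewrite cartan_act cv actZr -scalerDl. Qed.

Lemma cartan_eigenZ i j (V : sl3_module k) (v : V) c d :
  cartan i j v = c *: v -> cartan i j (d *: v) = c *: (d *: v).
Proof. by move=> cv; rewrite /cartan !actZr -scalerBr [_ - _]cv !scalerA mulrC. Qed.

Lemma cartan_eigenD i j (V : sl3_module k) (v w : V) c :
  cartan i j v = c *: v -> cartan i j w = c *: w -> cartan i j (v + w) = c *: (v + w).
Proof.
move=> cv cw; rewrite /cartan !actDr opprD addrACA [act _ v - _]cv [act _ w - _]cw.
by rewrite scalerDr.
Qed.

Lemma cartan_col_hom_eigen i j (V : sl3_module k) (t : 'I_3 -> V) c :
  (forall l, cartan i j (t l) = (c + ((i == l)%:R - (j == l)%:R)) *: t l) ->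
  act (E i i) (col_hom t) - act (E j j) (col_hom t) = c *: col_hom t.
Proof.
move=> tc; rewrite -[LHS]/(cartan i j _) cartan_col_hom col_homZ; apply: eq_col_hom => l.
by rewrite tc -scalerBl addrK.
Qed.

Section LowerFirst.
Variables (V : sl3_module k) (a b : nat) (v : V).
Hypothesis vs : singular a.+1 b v.

Let v0 : v != 0. Proof. by case: vs. Qed.
Let e01 : act (E i0 i1) v = 0. Proof. by case: vs. Qed.
Let e12 : act (E i1 i2) v = 0. Proof. by case: vs. Qed.
Let h1 : cartan i0 i1 v = a.+1%:R *: v. Proof. by case: vs. Qed.
Let h2 : cartan i1 i2 v = b%:R *: v. Proof. by case: vs. Qed.

(* The highest weight vector of the component of F^* tensor V of highest weight
   (a, b), that is, of weight lowered by the first weight of F. *)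
Let t (l : 'I_3) : V := match val l with
  | 0 => ((a.+1 + b).+1%:R * a.+1%:R) *: v
  | 1 => (a.+1 + b).+1%:R *: act (E i1 i0) v
  | _ => act (E i2 i1) (act (E i1 i0) v) + a.+1%:R *: act (E i2 i0) v
  end.

Lemma singular_lower_first : exists w : hom_module F V, singular a b w.
Proof.
have e01f : act (E i0 i1) (act (E i1 i0) v) = a.+1%:R *: v.
  by rewrite act_elemC e01 act0r add0r /= !scale1r.
have e12f : act (E i1 i2) (act (E i1 i0) v) = 0.
  by rewrite act_elemC e12 act0r add0r /= !scale0r subrr.
have h1f : cartan i0 i1 (act (E i1 i0) v) = (a.+1%:R - 2%:R) *: act (E i1 i0) v.
  by apply: cartan_shift h1 _ => /=; ring.
have h2f : cartan i1 i2 (act (E i1 i0) v) = (b%:R + 1) *: act (E i1 i0) v.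
  by apply: cartan_shift h2 _ => /=; ring.
exists (col_hom t); split.
- apply: (@col_hom_eq0 _ _ i0); rewrite scaler_eq0 (negPf v0) orbF mulf_eq0.
  by rewrite !pnatr_eq0.
- rewrite act_col_hom_neq // -[RHS]col_hom0; apply: eq_col_hom => -[[|[|[|//]]] p] /=.
  + by rewrite /t /= actZr e01 scaler0 scale0r subrr.
  + by rewrite /t /= actZr e01f scalerA scale1r subrr.
  + rewrite /t /= scale0r subr0 actDr actZr (act_elemC i0 i1 i2 i1) e01f.
    rewrite (act_elemC i0 i1 i2 i0) e01 act0r /= !scale0r !scale1r !subrr addr0 actZr.
    by rewrite !add0r scalerN subrr.
- rewrite act_col_hom_neq // -[RHS]col_hom0; apply: eq_col_hom => -[[|[|[|//]]] p] /=.
  + by rewrite /t /= actZr e12 scaler0 scale0r subrr.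
  + by rewrite /t /= actZr e12f scaler0 scale0r subrr.
  + rewrite /t /= scale1r actDr actZr (act_elemC i1 i2 i2 i1) e12f act0r add0r.
    rewrite (act_elemC i1 i2 i2 i0) e12 act0r /= !scale0r !scale1r subr0 add0r.
    rewrite -[act (E i1 i1) _ - _]/(cartan i1 i2 _) h2f -scalerDl -scalerBl.
    apply/eqP; rewrite scaler_eq0; apply/orP; left; apply/eqP.
    ring.
- apply: cartan_col_hom_eigen => -[[|[|[|//]]] p]; rewrite /t /=.
  + by apply: cartan_eigenZ; rewrite h1; congr (_ *: _); ring.
  + by apply: cartan_eigenZ; rewrite h1f; congr (_ *: _); ring.
  + apply: cartan_eigenD; last apply: cartan_eigenZ.
      by rewrite (cartan_shift h1f erefl) /=; congr (_ *: _); ring.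
    by rewrite (cartan_shift h1 erefl) /=; congr (_ *: _); ring.
- apply: cartan_col_hom_eigen => -[[|[|[|//]]] p]; rewrite /t /=.
  + by apply: cartan_eigenZ; rewrite h2; congr (_ *: _); ring.
  + by apply: cartan_eigenZ; rewrite h2f; congr (_ *: _); ring.
  + apply: cartan_eigenD; last apply: cartan_eigenZ.
      by rewrite (cartan_shift h2f erefl) /=; congr (_ *: _); ring.
    by rewrite (cartan_shift h2 erefl) /=; congr (_ *: _); ring.
Qed.

End LowerFirst.

Section LowerSecond.
Variables (V : sl3_module k) (a b : nat) (v : V).
Hypothesis vs : singular a b.+1 v.

Let v0 : v != 0. Proof. by case: vs. Qed.
Let e01 : act (E i0 i1) v = 0. Proof. by case: vs. Qed.
Let e12 : act (E i1 i2) v = 0. Proof. by case: vs. Qed.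
Let h1 : cartan i0 i1 v = a%:R *: v. Proof. by case: vs. Qed.
Let h2 : cartan i1 i2 v = b.+1%:R *: v. Proof. by case: vs. Qed.

(* The highest weight vector u of the component of F tensor V of highest weight
   (a, b), read in F^* tensor F^* tensor V through the alternating map
   e_m |-> e_i^* /\ e_j^* for (i, j, m) a cyclic permutation of (0, 1, 2). *)
Let u0 : V := act (E i1 i0) (act (E i2 i1) v) - b.+1%:R *: act (E i2 i0) v.
Let u1 : V := - (a + b.+1).+1%:R *: act (E i2 i1) v.
Let u2 : V := ((a + b.+1).+1%:R * b.+1%:R) *: v.

Let s (i j : 'I_3) : V := match val i, val j with
  | 0, 1 => u2 | 1, 0 => - u2
  | 0, 2 => - u1 | 2, 0 => u1
  | 1, 2 => u0 | 2, 1 => - u0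
  | _, _ => 0
  end.

Lemma singular_lower_second : exists w : hom_module F (hom_module F V), singular a b w.
Proof.
have e01f : act (E i0 i1) (act (E i2 i1) v) = 0.
  by rewrite act_elemC e01 act0r add0r /= !scale0r subrr.
have e12f : act (E i1 i2) (act (E i2 i1) v) = b.+1%:R *: v.
  by rewrite act_elemC e12 act0r add0r /= !scale1r.
have h1f : cartan i0 i1 (act (E i2 i1) v) = (a%:R + 1) *: act (E i2 i1) v.
  by apply: cartan_shift h1 _ => /=; ring.
have h2f : cartan i1 i2 (act (E i2 i1) v) = (b.+1%:R - 2%:R) *: act (E i2 i1) v.
  by apply: cartan_shift h2 _ => /=; ring.
have e01u0 : act (E i0 i1) u0 = - u1.
  rewrite /u0 /u1 actBr actZr (act_elemC i0 i1 i1 i0) (act_elemC i0 i1 i2 i0).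
  rewrite e01f e01 !act0r /= !scale1r scale0r !add0r.
  rewrite -[act (E i0 i0) _ - _]/(cartan i0 i1 _) h1f scalerN opprK -scalerDl.
  by rewrite scaleNr opprK; congr (_ *: _); ring.
have e01u1 : act (E i0 i1) u1 = 0 by rewrite /u1 actZr e01f scaler0.
have e01u2 : act (E i0 i1) u2 = 0 by rewrite /u2 actZr e01 scaler0.
have e12u0 : act (E i1 i2) u0 = 0.
  rewrite /u0 actBr actZr (act_elemC i1 i2 i1 i0) (act_elemC i1 i2 i2 i0).
  by rewrite e12f e12 act0r /= actZr !scale0r scale1r !subr0 !add0r addr0 subrr.
have e12u1 : act (E i1 i2) u1 = - u2.
  by rewrite /u1 /u2 actZr e12f scalerA mulNr scaleNr.
have e12u2 : act (E i1 i2) u2 = 0 by rewrite /u2 actZr e12 scaler0.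
have h1u0 : cartan i0 i1 u0 = (a%:R - 1) *: u0.
  rewrite /u0 -scaleNr; apply: cartan_eigenD; last apply: cartan_eigenZ.
    by rewrite (cartan_shift h1f erefl) /=; congr (_ *: _); ring.
  by rewrite (cartan_shift h1 erefl) /=; congr (_ *: _); ring.
have h1u1 : cartan i0 i1 u1 = (a%:R + 1) *: u1 by exact: cartan_eigenZ.
have h1u2 : cartan i0 i1 u2 = a%:R *: u2 by exact: cartan_eigenZ.
have h2u0 : cartan i1 i2 u0 = b%:R *: u0.
  rewrite /u0 -scaleNr; apply: cartan_eigenD; last apply: cartan_eigenZ.
    by rewrite (cartan_shift h2f erefl) /=; congr (_ *: _); ring.
  by rewrite (cartan_shift h2 erefl) /=; congr (_ *: _); ring.
have h2u1 : cartan i1 i2 u1 = (b.+1%:R - 2%:R) *: u1 by exact: cartan_eigenZ.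
have h2u2 : cartan i1 i2 u2 = b.+1%:R *: u2 by exact: cartan_eigenZ.
have cN i j (x : V) c : cartan i j x = c *: x -> cartan i j (- x) = c *: - x.
  by rewrite -scaleN1r; exact: cartan_eigenZ.
have c0 i j c : cartan i j (0 : V) = c *: 0.
  by rewrite /cartan !act0r subrr scaler0.
have actN x (w : V) : act x (- w) = - act x w by rewrite -scaleN1r actZr scaleN1r.
pose t i := col_hom (s i).
(* Reduces each identity for the doubly nested map to the nine entries of the alternating array
   [s]. *)
have act_t i j : i != j -> (forall l m,
    act (E i j) (s l m) - (j == m)%:R *: s l i - (j == l)%:R *: s i m = 0) ->
    act (E i j) (col_hom t) = 0.
  move=> ij H; rewrite act_col_hom_neq // -[RHS]col_hom0; apply: eq_col_hom => l.
  rewrite /t act_col_hom_neq // col_homZ col_homB -[RHS]col_hom0.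
  by apply: eq_col_hom => m; exact: H.
have cartan_t i j c : (forall l m, cartan i j (s l m) =
    (c + ((i == l)%:R - (j == l)%:R) + ((i == m)%:R - (j == m)%:R)) *: s l m) ->
    act (E i i) (col_hom t) - act (E j j) (col_hom t) = c *: col_hom t.
  by move=> H; apply: cartan_col_hom_eigen => l; apply: cartan_col_hom_eigen => m.
exists (col_hom t); split.
- apply: (@col_hom_eq0 _ _ i0); apply: (@col_hom_eq0 _ _ i1).
  by rewrite /s /= scaler_eq0 (negPf v0) orbF mulf_eq0 !pnatr_eq0.
- apply: (act_t i0 i1) => // -[[|[|[|//]]] p] [[|[|[|//]]] q]; rewrite /s /= ?scale1r ?scale0r ?act0r
    ?actN ?e01u0 ?e01u1 ?e01u2 ?(oppr0, opprK) ?(subr0, sub0r);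
    by rewrite ?(oppr0, add0r, addr0, subrr, addNr).
- apply: (act_t i1 i2) => // -[[|[|[|//]]] p] [[|[|[|//]]] q]; rewrite /s /= ?scale1r ?scale0r ?act0r
    ?actN ?e12u0 ?e12u1 ?e12u2 ?(oppr0, opprK) ?(subr0, sub0r);
    by rewrite ?(oppr0, add0r, addr0, subrr, addNr).
- apply: (cartan_t i0 i1) => -[[|[|[|//]]] p] [[|[|[|//]]] q]; rewrite /s /=;
    do ?[exact: c0 | apply: cN]; rewrite ?h1u0 ?h1u1 ?h1u2; congr (_ *: _); ring.
- apply: (cartan_t i1 i2) => -[[|[|[|//]]] p] [[|[|[|//]]] q]; rewrite /s /=;
    do ?[exact: c0 | apply: cN]; rewrite ?h2u0 ?h2u1 ?h2u2; congr (_ *: _); ring.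
Qed.

End LowerSecond.

Section Uncurry.
Variables (V W X : sl3_module k) (f : sl3_hom W (hom_module V X)).

Let fb (v : V) (w : W) : X := (f w : 'Hom(V, X)) v.

Fact uncurry_bilin : bilin fb.
Proof.
split=> [a v v' w|a v w w']; first by rewrite /fb linearP.
by rewrite /fb linearP [LHS]add_lfunE [X in X + _]scale_lfunE.
Qed.

Fact uncurry_equivariant x (t : tens_module V W) :
  tlift fb (act x t) = act x (tlift fb t).
Proof.
move: t; apply: (tens_ext (f := fun t => tlift fb (tact x t))
  (g := fun t => act x (tlift fb t))).
- by apply: compP; [exact: linearP|exact: tact_linear].
- by apply: compP; [exact: act_linearr|exact: linearP].
move=> v w; rewrite tact_pure linearD /= !tlift_pure; do ?exact: uncurry_bilin.
by rewrite /fb sl3_homE [X in _ + X](hom_actE x (f w : 'Hom(V, X))) addrC subrK.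
Qed.

(** The tensor-hom adjunction: a morphism from F^n into Hom(F, V) becomes one from F^(n+1) into
    V. *)
Definition uncurry : sl3_hom (tens_module V W) X :=
  @mk_hom k (tens_module V W) X (tlift fb) (linearP (tlift fb)) uncurry_equivariant.

Lemma uncurry_neq0 : f != 0 -> uncurry != 0.
Proof.
apply: contra_neq => u0; apply: sl3_hom_eq => w; rewrite sl3_hom0.
apply/lfunP => v; rewrite [RHS]zero_lfunE.
have := congr1 (fun g : sl3_hom (tens_module V W) X => g (pure v w)) u0.
rewrite sl3_hom0 (mk_homE (V := tens_module V W)) => <-.
exact/esym/(tlift_pure _ _ uncurry_bilin).
Qed.

End Uncurry.

Local Notation C := (sl3_mod k).

(** Induction on a + b. Lowering a costs one factor F and lowering b costs two, each returned by
    [uncurry]; at weight (0, 0) the vector is invariant and defines a map from the trivial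
    module. *)
Lemma tpow_hom_neq0 a b V (v : V) : singular a b v ->
  exists n (f : sl3_hom (iter n (tens_module F) (trivial_module k)) V), f != 0.
Proof.
have [m] := ubnP (a + b); elim: m a b V v => // m IHm [|a] [|b] V v.
- move=> _ vs; have vI := singular00_invariant vs.
  have fL : linear (fun c : trivial_module k => (c : k) *: v).
    by move=> c x y; rewrite scalerDl scalerA.
  have fE x (c : trivial_module k) : (act x c : k) *: v = act x ((c : k) *: v).
    by rewrite actZr vI scaler0 scale0r.
  exists 0%N, (mk_hom fL fE); case: vs => v0 _ _ _ _; apply: contra_neq v0.
  move/(congr1 (fun g : sl3_hom (trivial_module k) V => g (1 : k^o))).
  by rewrite sl3_hom0 (mk_homE (V := trivial_module k)) scale1r.
- move=> abm /singular_lower_second [w /IHm [//|n [f f0]]].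
  exists n.+2, (uncurry (uncurry f)); exact/uncurry_neq0/uncurry_neq0.
- move=> abm /singular_lower_first [w /IHm [|n [f f0]]].
    exact: abm.
  by exists n.+1, (uncurry f); exact: uncurry_neq0.
- move=> abm /singular_lower_first [w /IHm [|n [f f0]]].
    exact: abm.
  by exists n.+1, (uncurry f); exact: uncurry_neq0.
Qed.

(** Induction on dimension: a nonzero f from a tensor power and g with f g f = f split off the image
    of f, a retract of that power; the complementary summand has smaller dimension. *)
Lemma sl3_tgenerated (V : C) : tgenerated (nat_F k) (idm V).
Proof.
have [d] := ubnP (\dim {:(V : sl3_module k)}).
elim: d V => // d IHd V; rewrite ltnS => dV.
have [V0|/eqP id0] := eqVneq (idm V) 0.
  by rewrite V0; exact: tgenerated0.
have [v v0] : exists v : V : sl3_module k, v != 0.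
  apply: contrapT => nv; apply: id0; apply: sl3_hom_eq => v; rewrite sl3_hom0.
  by apply/eqP/negPn/negP => v0; apply: nv; exists (sl3_id V v).
have [a [b [w ws]]] := singular_exists v0.
have [n [f' f'0]] := tpow_hom_neq0 ws.
pose f : @hom k C (tpow (nat_F k) n) V := f'; have f0 : f != 0 := f'0.
have [g fgf] := sl3_regular f.
pose e := idm V - f ∘ g.
have ef : e ∘ f = 0 by rewrite /e compBl comp1m fgf subrr.
have ee : e ∘ e = e by rewrite {2}/e compBr compm1 compA ef comp0m subr0.
have [W [p [i [ip pi]]]] := sl3_idempotent_split ee.
have dW : (\dim {:(W : sl3_module k)} < d)%N.
  apply: leq_trans dV; apply: (retract_dim pi); rewrite ip => e1.
  by move: f0; rewrite -(comp1m f) -e1 ef eqxx.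
have idE : idm V = f ∘ g + i ∘ idm W ∘ p by rewrite compm1 ip /e addrC subrK.
rewrite idE; apply: tgeneratedD.
(* The presentation of the identity of the complement W is carried to V term by term along i and
   p. *)
elim: (IHd W dW) => [|m h h' u _ IH]; first by rewrite compm0 comp0m; exact: tgenerated0.
rewrite compDr compDl !compA -compA; exact: tgeneratedD.
Qed.

End TensorGenerator.

Theorem theorem1 (R : realType) (M : module_cat (sl3_mod R[i])) :
  admissible M ->
  simple_module_cat M ->
  graph_isomorphic (Gamma M (nat_F R[i]))
                   (Gamma (regular (sl3_mod R[i])) (nat_F R[i])) ->
  graph_isomorphic (Gamma M (dual_F R[i]))
                   (Gamma (regular (sl3_mod R[i])) (dual_F R[i])) ->
  module_equivalent M (regular (sl3_mod R[i])).
Proof.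
move=> [/locally_finitary_ks ksM _] simpleM [phi [phi_bij phi_arrows]] _.
have [psi phiK psiK] := phi_bij.
have [d dT] : exists d : indec_class (regular (sl3_mod R[i])), cls d tunit.
  exact/indec_class_of/local_indecomposable/trivial_local.
have [X cX] := cls_ex (psi d).
have [r rP] := residue_indecomposable ksM (cls_indecomposable ksM cX).
apply: (module_equivalent_regular (F := nat_F R[i]) _ _ _ _ _ _ ksM simpleM
  phi_bij phi_arrows cX _ rP).
- exact: sl3_krull_schmidt.
- exact: sl3_idempotent_split.
- exact: sl3_biproduct.
- exact: sl3_section.
- by move=> W; exists (dual_module W), (dual_ev W), (dual_coev W); exact: sl3_is_dual.
- exact: sl3_tgenerated.
- by rewrite psiK.
Qed.
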